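(* Let $(X,\mathsf{c})$ be a network with transition operator $P$ on $\ell^2(X^0,\mathsf{m}^0)$ and averaging operator $A$ on $L^2(X^1,\mathsf{m}^1)$. Let $\operatorname{spec}_p$ denote the point spectrum (set of eigenvalues on the respective Hilbert space). Then $$ \operatorname{spec}_p(A)\setminus\{0\}=\left(\{1 : 1\in\operatorname{spec}_p(P)\}\cup\left\{\frac{\sin\omega}{\omega} : \omega\in\mathbb{R}\setminus\{0\},\ \cos\omega\in\operatorname{spec}_p(P)\right\}\right)\setminus\{0\}, $$ where $\{1 : 1\in\operatorname{spec}_p(P)\}$ means $\{1\}$ if $1\in\operatorname{spec}_p(P)$ and $\emptyset$ otherwise. Moreover, $0\in\operatorname{spec}_p(A)$ unless $\mathsf{m}^0(X^0)=\infty$ and $X$ is a tree with the property that after removal of any edge, at least one of the two connected components is recurrent (as a subnetwork).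
   Context: Network: $X$ is a countable (finite or infinite) connected graph with symmetric neighbourhood relation $\sim$, without loops or multiple edges, and with at least one edge; $X^0$ is its vertex set. Each edge $[x,y]=[y,x]$ is viewed as a copy of the unit interval, edges being glued together at common endpoints, and $X^1$ is the resulting one-skeleton: its points are $(xy,t)$ with $x\sim y$, $0\le t\le 1$, the point at distance $t$ from $x$ on $[x,y]$, so that $(xy,0)=x$ and $(xy,t)=(yx,1-t)$. Each edge has a conductance $\mathsf{c}(xy)=\mathsf{c}(yx)>0$, and $\mathsf{m}^0(x)=\sum_{y:y\sim x}\mathsf{c}(xy)$ is assumed finite for every $x\in X^0$; $\mathsf{m}^0$ is regarded as a discrete measure on $X^0$. The measure $\mathsf{m}^1$ on $X^1$ is $\mathsf{c}(xy)\,dt$ on the interior of each edge $[x,y]$, and the vertex set has $\mathsf{m}^1$-measure $0$. Hilbert spaces (complex): $\ell^2(X^0,\mathsf{m}^0)$ has inner product $\langle g_1,g_2\rangle=\sum_{x\in X^0}g_1(x)\overline{g_2(x)}\,\mathsf{m}^0(x)$; $L^2(X^1,\mathsf{m}^1)$ has inner product $\langle F_1,F_2\rangle=\frac12\sum_{x\in X^0}\sum_{y\sim x}\mathsf{c}(xy)\int_0^1F_1(xy,t)\overline{F_2(xy,t)}\,dt$. Operators: $Pg(x)=\frac{1}{\mathsf{m}^0(x)}\sum_{y\sim x}\mathsf{c}(xy)g(y)$ and $$AF(xy,t)=\frac{1}{\mathsf{m}^0(x)}\sum_{u\sim x}\mathsf{c}(xu)\int_0^{1-t}F(xu,s)\,ds+\frac{1}{\mathsf{m}^0(y)}\sum_{v\sim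 y}\mathsf{c}(yv)\int_0^{t}F(yv,s)\,ds .$$ $P$ and $A$ are self-adjoint with norm at most $1$ on these spaces. Recurrence: a network is transient if $\sum_{n\ge0}\langle P^n\delta_x,\delta_y\rangle<\infty$ for some (equivalently, all) vertices $x,y$, where $\delta_x$ is the indicator function of $\{x\}$; otherwise it is recurrent. A connected component arising after removal of an edge is regarded as a network with the restricted conductances (and its own $\mathsf{m}^0$ and $P$); a component consisting of a single vertex counts as recurrent. *)

(* Defs.v *)
From HB Require Import structures.
From mathcomp Require Import all_boot all_order all_algebra.
From mathcomp Require Import all_classical all_reals all_analysis.
From mathcomp Require Import complex.

Set Implicit Arguments.
Unset Strict Implicit.
Unset Printing Implicit Defensive.
Import Order.TTheory GRing.Theory Num.Theory.

Local Open Scope classical_set_scope.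
Local Open Scope ring_scope.
Local Open Scope complex_scope.

(* Sums over an arbitrary index set and Lebesgue integrals, for real- and
   complex-valued functions.  They have their usual meaning in the absolutely
   summable (resp. integrable) case, which is the only one arising for elements
   of the Hilbert spaces below. *)
Definition rsum (R : realType) (I : choiceType) (D : set I) (f : I -> R) : R :=
  fine (\esum_(i in D) (Num.max (f i) 0)%:E)
  - fine (\esum_(i in D) (Num.max (- f i) 0)%:E).

Definition csum (R : realType) (I : choiceType) (D : set I) (f : I -> R[i])
    : R[i] :=
  rsum D (fun i => complex.Re (f i)) +i* rsum D (fun i => complex.Im (f i)).

Definition cintegral (R : realType) (D : set R) (f : R -> R[i]) : R[i] :=
  Rintegral lebesgue_measure D (fun t => complex.Re (f t))
  +i* Rintegral lebesgue_measure D (fun t => complex.Im (f t)).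

Definition cmeasurable (R : realType) (D : set R) (f : R -> R[i]) : Prop :=
  measurable_fun D (fun t => complex.Re (f t)) /\
  measurable_fun D (fun t => complex.Im (f t)).

(* A countable vertex set with a neighbourhood relation and weights;
   [cond x y] is only ever used when [adj x y] holds. *)
Record wgraph (R : realType) := WGraph {
  vtx :> countType;
  adj : rel vtx;
  cond : vtx -> vtx -> R }.

Definition nbr (R : realType) (G : wgraph R) (x : G) : set G :=
  [set y | adj x y].

Definition reach (T : eqType) (e : rel T) (x y : T) : Prop :=
  exists2 p, path e x p & last x p = y.

Definition m0 (R : realType) (G : wgraph R) (x : G) : \bar R :=
  \esum_(y in nbr x) (cond x y)%:E.

Record is_network (R : realType) (G : wgraph R) : Prop := IsNetwork {
  adj_sym : symmetric (@adj R G);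
  adj_irrefl : irreflexive (@adj R G);
  adj_connected : forall x y : G, reach (@adj R G) x y;
  adj_edge : exists x y : G, adj x y;
  cond_sym : forall x y : G, adj x y -> cond x y = cond y x;
  cond_gt0 : forall x y : G, adj x y -> 0 < cond x y;
  m0_fin : forall x : G, (m0 x < +oo)%E }.

Definition m0r (R : realType) (G : wgraph R) (x : G) : R := fine (m0 x).

Section VertexSpace.
Context {R : realType} (G : wgraph R).

Definition l2X0 (g : G -> R[i]) : Prop :=
  (\esum_(x in [set: G]) ((ComplexField.Normc.normc (g x) ^+ 2)%:E * m0 x)
   < +oo)%E.

Definition ipX0 (g1 g2 : G -> R[i]) : R[i] :=
  csum [set: G] (fun x => g1 x * (g2 x)^* * (m0r x)%:C).

Definition transP (g : G -> R[i]) : G -> R[i] := fun x =>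
  (m0r x)^-1%:C * csum (nbr x) (fun y => (cond x y)%:C * g y).

Definition specpP : set R[i] := [set lam | exists g : G -> R[i],
  [/\ l2X0 g, exists x, g x != 0 & forall x, transP g x = lam * g x]].

Definition delta (x : G) : G -> R[i] := fun y => (y == x)%:R.

(* The inner products <P^n delta_x, delta_y> are nonnegative reals, whence the
   real part. *)
Definition transient : Prop := exists x y : G,
  (\sum_(0 <= n <oo)
     (complex.Re (ipX0 (iter n transP (delta x)) (delta y)))%:E < +oo)%E.

Definition recurrent : Prop := (forall x y : G, x = y) \/ ~ transient.

End VertexSpace.

Section EdgeSpace.
Context {R : realType} (G : wgraph R).

(* [F x y t] is the value at the point (xy,t); only the values for [adj x y]
   and 0 <= t <= 1 are relevant.  [X1_fun F] says that [F] descends to the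
   one-skeleton, where (xy,t) = (yx,1-t) and (xy,0) = x for all y ~ x. *)
Definition X1_fun (F : G -> G -> R -> R[i]) : Prop :=
  (forall x y t, adj x y -> 0 <= t <= 1 -> F x y t = F y x (1 - t)) /\
  (forall x y z, adj x y -> adj x z -> F x y 0 = F x z 0).

Definition normsqX1 (F : G -> G -> R -> R[i]) : \bar R :=
  ((2^-1)%:E * \esum_(x in [set: G]) \esum_(y in nbr x)
     ((cond x y)%:E * \int[lebesgue_measure]_(t in `[0%R, 1%R])
         (ComplexField.Normc.normc (F x y t) ^+ 2)%:E))%E.

Definition L2X1 (F : G -> G -> R -> R[i]) : Prop :=
  [/\ X1_fun F,
      forall x y, adj x y -> cmeasurable `[0, 1] (F x y)
    & (normsqX1 F < +oo)%E].

(* Equality m^1-almost everywhere, m^1 being c(xy) dt on each of the countably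
   many edges and giving mass 0 to the vertices. *)
Definition aeX1 (F1 F2 : G -> G -> R -> R[i]) : Prop :=
  forall x y, adj x y ->
    {ae @lebesgue_measure R, forall t, t \in `]0%R, 1%R[ ->
       F1 x y t = F2 x y t}.

Definition avgA (F : G -> G -> R -> R[i]) : G -> G -> R -> R[i] := fun x y t =>
  (m0r x)^-1%:C *
    csum (nbr x) (fun u => (cond x u)%:C * cintegral `[0, 1 - t] (F x u))
  + (m0r y)^-1%:C *
    csum (nbr y) (fun v => (cond y v)%:C * cintegral `[0, t] (F y v)).

Definition specpA : set R[i] := [set lam | exists F,
  [/\ L2X1 F, ~ aeX1 F (fun _ _ _ => 0)
    & aeX1 (avgA F) (fun x y t => lam * F x y t)]].

End EdgeSpace.

Section EdgeRemoval.
Context {R : realType} (G : wgraph R).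

Definition is_tree : Prop :=
  (forall x y : G, reach (@adj R G) x y) /\
  (forall p : seq G, ucycle (@adj R G) p -> (size p < 3)%N).

Definition del_edge (x y : G) : wgraph R :=
  WGraph (fun u v : G =>
            adj u v && ~~ (((u == x) && (v == y)) || ((u == y) && (v == x))))
         (@cond R G).

Definition component (x : G) : wgraph R :=
  WGraph (vtx := {z : G | `[< reach (@adj R G) x z >]})
         (fun u v => adj (val u) (val v))
         (fun u v => cond (val u) (val v)).

End EdgeRemoval.

Definition edge_removal_recurrent (R : realType) (G : wgraph R) : Prop :=
  forall x y : G, adj x y ->
    recurrent (component (x : del_edge x y)) \/
    recurrent (component (y : del_edge x y)).

(* Main.v *)
Require Import Defs.
From HB Require Import structures.
From mathcomp Require Import all_boot all_order all_algebra.
From mathcomp Require Import all_classical all_reals all_analysis.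
From mathcomp Require Import complex.
From mathcomp Require Import measurable_realfun.
From mathcomp Require Import ring lra.

(** Eigenfunctions of [A] are waves travelling along the edges, and an
    eigenvalue of [P] is what such a wave looks like at the vertices.

    Suppose [A F = lam F] with [lam <> 0], and let [H t x] be the average over
    the edges at [x] of the integral of [F] over their initial pieces of length
    [t].  Then [A F] at [(xy,t)] equals [H (1 - t) x + H t y], so [F] is
    determined by [H], and averaging the eigenvalue equation over the edges at
    a vertex gives a first order equation in [l^2],

      [H' t = lam^-1 (H (1 - t) + P (H t))],   [H 0 = 0],

    and hence the wave equation [H'' = - lam^-2 (1 - P^2) H].  If [P u = p u],
    the scalar function [h t = <H t, u>] satisfies the same equation with [p] in
    place of [P], and calculus ([scalar_eigen]) shows that a nonzero [h] forces
    [lam = 1 = p] or [lam = sin w / w] and [p = cos w].  It remains to find an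
    eigenvector [u] of [P] that is not orthogonal to [H].

    Put [B = 1 - P^2], so that [0 <= B <= 1], and [v = H' 0].  Solving the wave
    equation by its Taylor series and comparing with the equation at [t = 0]
    gives [f(B) v = 0] for the nonzero entire function
    [f(x) = sin(lam^-1 sqrt x) / (lam^-1 sqrt x) - lam].  The spectral measure
    of [B] at [v] is therefore carried by the finitely many zeros of [f] in
    [[0,1]], all of which are then eigenvalues.  This consequence of the
    spectral theorem is obtained from the functional [L q = <q(B) v, v>] on
    polynomials alone ([annihilator_root]).  A polynomial that is positive on
    [[0,1]] has [L q >= 0] ([moment_pos], by factoring it into linear and
    quadratic factors), so an annihilating power series without zeros in [[0,1]]
    would force [L = 0].  If it has a zero [y], then either some [r(B) v] is an
    eigenvector of [B] for [y], or the series can be divided by [X - y].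
    Division shrinks the coefficients by a factor of 3 without decreasing the
    value at a given point, so the second case cannot occur forever.  Finally,
    an eigenvector of [P^2] splits into eigenvectors of [P] ([eigen_sqrt]),
    which leads to [wave_eigen] and [specpA_specpP].

    Conversely, if [P g = p g], then [F(xy,t) = k (1 - t) g x + k t g y] is an
    eigenfunction for [k t = sin (w t)] when [p = cos w], and for [k t = t] when
    [p = 1] ([specpA_one], [specpA_sinc]).

    For the eigenvalue 0, multiply an antisymmetric function [J] of finite
    energy and zero divergence by [sin (2 pi t)]: the function
    [J x y / c(xy) * sin (2 pi t)] respects the identification of [(xy,t)] with
    [(yx,1-t)], vanishes at the vertices and has zero average over the initial
    pieces of edges at any vertex ([specpA_flow]).  A cycle carries such a flow.
    If removing the edge [xy] leaves two transient components, the gradients of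
    their Green functions are unit flows from [x] and from [y] to infinity
    ([transient_flow]); joining them through the edge gives such a flow as well.
    If the total mass is finite, the constant [g = 1] together with
    [k t = cos (2 pi t)] lies in the kernel of [A] ([specpA_zero_finite]). *)

Set Implicit Arguments.
Unset Strict Implicit.
Unset Printing Implicit Defensive.
Import Order.TTheory GRing.Theory Num.Theory.
Import numFieldNormedType.Exports.

Local Open Scope classical_set_scope.
Local Open Scope ring_scope.


(** * Absolutely summable families *)

HB.lock Definition tsum (R : realType) (I : choiceType) (f : I -> R) : R :=
  rsum [set: I] f.
Canonical tsum_unlockable := Unlockable tsum.unlock.

Definition summ (R : realType) (I : choiceType) (f : I -> R) : Prop :=
  (\esum_(i in [set: I]) `|f i|%:E < +oo)%E.

Section Sums.
Context {R : realType} {I : choiceType}.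
Implicit Types (f g : I -> R) (c : R).

Lemma esum_summ f : (forall i, 0 <= f i) -> summ f ->
  (\esum_(i in [set: I]) (f i)%:E = (tsum f)%:E)%E.
Proof.
move=> f0 sf; rewrite unlock /rsum.
have e1 : (\esum_(i in [set: I]) (Num.max (f i) 0)%:E =
           \esum_(i in [set: I]) (f i)%:E)%E.
  by apply: eq_esum => i _; rewrite max_l.
have e2 : (\esum_(i in [set: I]) (Num.max (- f i) 0)%:E = 0)%E.
  by apply: esum1 => i _; rewrite max_r// oppr_le0.
rewrite e1 e2 /= subr0 fineK// fin_numElt.
rewrite (lt_le_trans (ltNyr 0)) ?esum_ge0//=; last by move=> i _; rewrite lee_fin.
move: sf; rewrite /summ; congr (_ < _)%E.
by apply: eq_esum => i _; rewrite ger0_norm.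
Qed.

Lemma summP f (M : R) : (forall i, 0 <= f i) ->
  (\esum_(i in [set: I]) (f i)%:E <= M%:E)%E -> summ f /\ tsum f <= M.
Proof.
move=> f0 le; have sf : summ f.
  rewrite /summ (eq_esum (b := fun i => (f i)%:E)); first exact: le_lt_trans le (ltry _).
  by move=> i _; rewrite ger0_norm.
by split=> //; rewrite -lee_fin -esum_summ.
Qed.

Lemma summ_ge0P f : (forall i, 0 <= f i) ->
  summ f <-> (\esum_(i in [set: I]) (f i)%:E < +oo)%E.
Proof.
move=> f0; rewrite /summ (eq_esum (b := fun i => (f i)%:E))//.
by move=> i _; rewrite ger0_norm.
Qed.

Lemma summ_abs f : summ (fun i => `|f i|) <-> summ f.
Proof. by rewrite /summ; under eq_esum do rewrite normr_id. Qed.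

Lemma summ_le f g : (forall i, `|f i| <= g i) -> summ g -> summ f.
Proof.
move=> le; apply: le_lt_trans; apply: le_esum => i _.
by rewrite lee_fin (le_trans (le i))// ler_norm.
Qed.

Lemma summD f g : summ f -> summ g -> summ (fun i => f i + g i).
Proof.
move=> sf sg; apply: le_lt_trans (lte_add_pinfty sf sg).
by rewrite -esumD//; apply: le_esum => i _; rewrite -EFinD lee_fin ler_normD.
Qed.

Lemma summN f : summ f -> summ (fun i => - f i).
Proof. by apply: le_lt_trans; apply: le_esum => i _; rewrite normrN. Qed.

Lemma summB f g : summ f -> summ g -> summ (fun i => f i - g i).
Proof. by move=> sf sg; apply: summD => //; exact: summN. Qed.

Lemma summ0 : summ (fun _ : I => 0 : R).
Proof. by rewrite /summ esum1// => i _; rewrite normr0. Qed.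

Lemma esumZl c f : 0 <= c -> (forall i, 0 <= f i) ->
  (\esum_(i in [set: I]) (c * f i)%:E = c%:E * \esum_(i in [set: I]) (f i)%:E)%E.
Proof.
rewrite le_eqVlt => /predU1P[<- _|c0 f0].
  by rewrite mul0e esum1// => i _; rewrite mul0r.
rewrite /esum -ereal_sup_pZl//. congr (ereal_sup _); apply/seteqP; split => x /=.
- move=> [A [fA sA] <-]; exists (\sum_(i \in A) (f i)%:E)%E; first by exists A.
  by rewrite ge0_mule_fsumr// => i; rewrite lee_fin.
- move=> [_ [A [fA sA] <-] <-]; exists A => //.
  by rewrite ge0_mule_fsumr// => i; rewrite lee_fin.
Qed.

Lemma summZ c f : summ f -> summ (fun i => c * f i).
Proof.
move=> sf; rewrite /summ; under eq_esum do rewrite normrM.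
by rewrite esumZl//; apply: lte_mul_pinfty.
Qed.

(** The sum of a signed family may be computed from any decomposition into
    summable nonnegative families, which reduces linearity to the nonnegative
    case. *)
Lemma tsum_rep f (a b : I -> R) : (forall i, 0 <= a i) -> (forall i, 0 <= b i) ->
  summ a -> summ b -> (forall i, f i = a i - b i) -> tsum f = tsum a - tsum b.
Proof.
move=> a0 b0 sa sb fab.
have sf : summ f.
  by rewrite (_ : f = fun i => a i - b i); [exact: summB|exact/funext].
pose p i := Num.max (f i) 0; pose n i := Num.max (- f i) 0.
have p0 i : 0 <= p i by rewrite le_max lexx orbT.
have n0 i : 0 <= n i by rewrite le_max lexx orbT.
have pnf i : f i = p i - n i.
  rewrite /p /n; case: (lerP 0 (f i)) => h; first by rewrite max_r ?subr0// oppr_le0.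
  by rewrite max_l ?oppr_ge0 1?ltW// sub0r opprK.
have pf i : `|p i| <= `|f i| by rewrite ger0_norm// ge_max ler_norm normr_ge0.
have nf i : `|n i| <= `|f i|.
  by rewrite ger0_norm// ge_max normr_ge0 -normrN ler_norm.
have sp : summ p by apply: summ_le pf _; exact/summ_abs.
have sn : summ n by apply: summ_le nf _; exact/summ_abs.
have -> : tsum f = tsum p - tsum n.
  by rewrite [in LHS]unlock /rsum -/(p _) !esum_summ.
have : (\esum_(i in [set: I]) (p i + b i)%:E = \esum_(i in [set: I]) (n i + a i)%:E)%E.
  by apply: eq_esum => i _; congr _%:E; have := fab i; rewrite pnf => h; lra.
under eq_esum do rewrite EFinD; under [in RHS]eq_esum do rewrite EFinD.
rewrite !esumD ?esum_summ//; try by move=> i _; rewrite lee_fin.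
by rewrite -!EFinD => -[] h; lra.
Qed.

Definition pos_part f i := (`|f i| + f i) / 2.
Definition neg_part f i := (`|f i| - f i) / 2.

Lemma pos_neg f i : f i = pos_part f i - neg_part f i.
Proof. by rewrite /pos_part /neg_part; lra. Qed.

Lemma pos_part_ge0 f i : 0 <= pos_part f i.
Proof. by rewrite /pos_part; have := ler_norm (- f i); rewrite normrN => h; lra. Qed.

Lemma neg_part_ge0 f i : 0 <= neg_part f i.
Proof. by rewrite /neg_part; have := ler_norm (f i) => h; lra. Qed.

Lemma pos_part_le f i : pos_part f i <= `|f i|.
Proof. by rewrite /pos_part; have := ler_norm (f i) => h; lra. Qed.

Lemma neg_part_le f i : neg_part f i <= `|f i|.
Proof. by rewrite /neg_part; have := ler_norm (- f i); rewrite normrN => h; lra. Qed.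

Lemma summ_pos f : summ f -> summ (pos_part f).
Proof.
move=> sf; apply: (@summ_le _ (fun i => `|f i|)); last exact/summ_abs.
by move=> i; rewrite ger0_norm ?pos_part_ge0 ?pos_part_le.
Qed.

Lemma summ_neg f : summ f -> summ (neg_part f).
Proof.
move=> sf; apply: (@summ_le _ (fun i => `|f i|)); last exact/summ_abs.
by move=> i; rewrite ger0_norm ?neg_part_ge0 ?neg_part_le.
Qed.

Lemma tsum_pn f : summ f -> tsum f = tsum (pos_part f) - tsum (neg_part f).
Proof.
move=> sf; apply: tsum_rep; [exact: pos_part_ge0|exact: neg_part_ge0|
  exact: summ_pos|exact: summ_neg|exact: pos_neg].
Qed.

Lemma tsumD_ge0 f g : (forall i, 0 <= f i) -> (forall i, 0 <= g i) ->
  summ f -> summ g -> tsum (fun i => f i + g i) = tsum f + tsum g.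
Proof.
move=> f0 g0 sf sg; apply: EFin_inj; rewrite EFinD -esum_summ; last 2 first.
- by move=> i; rewrite addr_ge0.
- exact: summD.
rewrite -!esum_summ// -esumD// => i _; by rewrite lee_fin.
Qed.

Lemma tsumD f g : summ f -> summ g ->
  tsum (fun i => f i + g i) = tsum f + tsum g.
Proof.
move=> sf sg.
rewrite (@tsum_rep _ (fun i => pos_part f i + pos_part g i)
                     (fun i => neg_part f i + neg_part g i)).
- rewrite (tsum_pn sf) (tsum_pn sg).
  rewrite (tsumD_ge0 (pos_part_ge0 f) (pos_part_ge0 g) (summ_pos sf) (summ_pos sg)).
  rewrite (tsumD_ge0 (neg_part_ge0 f) (neg_part_ge0 g) (summ_neg sf) (summ_neg sg)).
  by lra.
- by move=> i; rewrite addr_ge0 ?pos_part_ge0.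
- by move=> i; rewrite addr_ge0 ?neg_part_ge0.
- by apply: summD; exact: summ_pos.
- by apply: summD; exact: summ_neg.
- by move=> i; rewrite {1}pos_neg {1}(pos_neg g); lra.
Qed.

Lemma tsum0 : tsum (fun _ : I => 0 : R) = 0.
Proof.
apply: EFin_inj; rewrite -esum_summ//; [exact: esum1|exact: summ0].
Qed.

Lemma eq_tsum f g : (forall i, f i = g i) -> tsum f = tsum g.
Proof. by move=> fg; congr tsum; exact/funext. Qed.

Lemma tsumN f : summ f -> tsum (fun i => - f i) = - tsum f.
Proof.
move=> sf; have := tsumD sf (summN sf).
rewrite (@eq_tsum _ (fun=> 0)) => [|i]; last by rewrite subrr.
by rewrite tsum0 => h; lra.
Qed.

Lemma tsumB f g : summ f -> summ g ->
  tsum (fun i => f i - g i) = tsum f - tsum g.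
Proof. by move=> sf sg; rewrite tsumD ?tsumN//; exact: summN. Qed.

Lemma tsumZ c f : summ f -> tsum (fun i => c * f i) = c * tsum f.
Proof.
move=> sf; wlog c0 : c / 0 <= c => [H|].
  case: (lerP 0 c) => [/H//|c0]; have := H (- c); rewrite oppr_ge0 => /(_ (ltW c0)).
  rewrite (@eq_tsum _ (fun i => - (c * f i))) => [|i]; last by rewrite mulNr.
  by rewrite tsumN ?mulNr => [/oppr_inj//|]; exact: summZ.
have Z (k : I -> R) : (forall i, 0 <= k i) -> summ k -> tsum (fun i => c * k i) = c * tsum k.
  move=> k0 sk; apply: EFin_inj; rewrite EFinM -(esum_summ k0 sk) -esumZl//.
  by rewrite esum_summ//; [move=> i; rewrite mulr_ge0|exact: summZ].
rewrite (@tsum_rep _ (fun i => c * pos_part f i) (fun i => c * neg_part f i)).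
- rewrite (tsum_pn sf) (Z _ (pos_part_ge0 f) (summ_pos sf)).
  by rewrite (Z _ (neg_part_ge0 f) (summ_neg sf)); lra.
- by move=> i; rewrite mulr_ge0 ?pos_part_ge0.
- by move=> i; rewrite mulr_ge0 ?neg_part_ge0.
- by apply: summZ; exact: summ_pos.
- by apply: summZ; exact: summ_neg.
- by move=> i; rewrite {1}pos_neg mulrBr.
Qed.

Lemma tsum_ge0 f : (forall i, 0 <= f i) -> 0 <= tsum f.
Proof.
move=> f0; rewrite unlock /rsum (esum1 (a := fun i => (Num.max (- f i) 0)%:E)).
  by rewrite subr0 fine_ge0// esum_ge0// => i _; rewrite lee_fin le_max lexx orbT.
by move=> i _; rewrite max_r// oppr_le0.
Qed.

Lemma ler_tsum f g : summ f -> summ g -> (forall i, f i <= g i) ->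
  tsum f <= tsum g.
Proof.
move=> sf sg fg; rewrite -subr_ge0 -tsumB//; apply: tsum_ge0 => i.
by rewrite subr_ge0.
Qed.

Lemma ler_abs_tsum f : summ f -> `|tsum f| <= tsum (fun i => `|f i|).
Proof.
move=> sf; have sa : summ (fun i => `|f i|) by exact/summ_abs.
rewrite ler_norml -tsumN//; apply/andP; split; apply: ler_tsum => //.
- exact: summN.
- by move=> i; have := ler_norm (- f i); rewrite normrN => h; lra.
- by move=> i; exact: ler_norm.
Qed.

Lemma summ_set1 i0 f : (forall i, i != i0 -> f i = 0) -> summ f.
Proof.
move=> f0; rewrite /summ (esumID [set i0])// setTI esum_set1//.
rewrite esum1 ?adde0 ?ltry// => i [_ /= /eqP ii0].
by rewrite f0// normr0.
Qed.

Lemma tsum_set1 i0 f : (forall i, i != i0 -> f i = 0) -> tsum f = f i0.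
Proof.
move=> f0.
have P (g : I -> R) : (forall i, 0 <= g i) -> (forall i, i != i0 -> g i = 0) -> tsum g = g i0.
  move=> g0 gi; apply: EFin_inj; rewrite -esum_summ//; last exact: summ_set1 gi.
  rewrite (esumID [set i0]); last by move=> i _; rewrite lee_fin.
  rewrite setTI esum_set1 ?lee_fin// esum1 ?adde0//.
  by move=> i [_ /= /eqP ii0]; rewrite gi.
rewrite (tsum_pn (summ_set1 f0)) (P _ (pos_part_ge0 f)); last first.
  by move=> i /f0 h; rewrite /pos_part h normr0 addr0 mul0r.
rewrite (P _ (neg_part_ge0 f)); last first.
  by move=> i /f0 h; rewrite /neg_part h normr0 subrr mul0r.
by rewrite [RHS]pos_neg.
Qed.

Lemma le_tsum_term f i0 : (forall i, 0 <= f i) -> summ f -> f i0 <= tsum f.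
Proof.
move=> f0 sf; have h : forall i, i != i0 -> (if i == i0 then f i else 0) = 0.
  by move=> i /negbTE ->.
have := tsum_set1 h; rewrite eqxx => <-; apply: ler_tsum => //.
- exact: summ_set1 h.
- by move=> i; case: ifP.
Qed.

Lemma tsum_eq0 f : (forall i, 0 <= f i) -> summ f -> tsum f = 0 ->
  forall i, f i = 0.
Proof.
move=> f0 sf s0 i; apply/eqP; rewrite eq_le f0 andbT -s0; exact: le_tsum_term.
Qed.

Lemma tsum_seq (s : seq I) f : uniq s -> (forall i, i \notin s -> f i = 0) ->
  summ f /\ tsum f = \sum_(i <- s) f i.
Proof.
elim: s f => [|a s IH] f /=.
  move=> _ h; rewrite big_nil (_ : f = fun=> 0).
    by split; [exact: summ0|exact: tsum0].
  by apply/funext => i; exact: h.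
move=> /andP[as_ us] h; rewrite big_cons.
have hg i : i \notin s -> (if i == a then 0 else f i) = 0.
  move=> is_; case: eqP => // /eqP ia; apply: h.
  by rewrite in_cons (negbTE ia).
have [sg tg] := IH _ us hg.
have hk i : i != a -> (if i == a then f a else 0) = 0 by move=> /negbTE ->.
have fE i : f i = (if i == a then f a else 0) + (if i == a then 0 else f i).
  by case: eqP => [->|]; rewrite ?addr0 ?add0r.
rewrite (_ : f = fun i => (if i == a then f a else 0) +
   (if i == a then 0 else f i)); last exact/funext.
split; first by apply: summD => //; exact: summ_set1 hk.
rewrite tsumD ?(tsum_set1 hk)//; last exact: summ_set1 hk.
rewrite /= eqxx addr0; congr (_ + _); rewrite tg.
apply: eq_big_seq => i is_; case: eqP => [ia|]; last by rewrite add0r.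
by move: as_; rewrite -ia is_.
Qed.

End Sums.

Section Exchange.
Context {R : realType} {I J : choiceType}.
Implicit Types f : I -> J -> R.

Definition summ2 f : Prop :=
  (\esum_(i in [set: I]) \esum_(j in [set: J]) `|f i j|%:E < +oo)%E.

Lemma esum_swap (f : I -> J -> \bar R) : (forall i j, 0 <= f i j)%E ->
  (\esum_(i in [set: I]) \esum_(j in [set: J]) f i j =
   \esum_(j in [set: J]) \esum_(i in [set: I]) f i j)%E.
Proof.
move=> f0; rewrite !esum_esum//.
apply: (@reindex_esum _ _ _ ([set: J] `*`` (fun=> [set: I])) _ (fun p => (p.2, p.1))).
split.
- by move=> [j i].
- by move=> [j i] [j' i'] _ _ [-> ->].
- by move=> [i j] _; exists (j, i).
Qed.

Lemma summ2_row f : summ2 f -> forall i, summ (f i).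
Proof.
move=> s2 i; apply: le_lt_trans s2.
have h k : (0 <= \esum_(j in [set: J]) `|f k j|%:E)%E by apply: esum_ge0.
rewrite [leRHS](esumID [set i])// setTI esum_set1//.
by rewrite leeDl// esum_ge0.
Qed.

Lemma summ2_abs f : summ2 f -> summ (fun i => tsum (fun j => `|f i j|)).
Proof.
move=> s2; apply/summ_ge0P => [i|]; first exact: tsum_ge0.
have sr := summ2_row s2; apply: le_lt_trans s2; apply: le_esum => i _.
by rewrite -esum_summ//; apply/summ_abs.
Qed.

Lemma summ2_tsum f : summ2 f -> summ (fun i => tsum (f i)).
Proof.
move=> s2; apply: summ_le (summ2_abs s2) => i.
by apply: ler_abs_tsum; exact: summ2_row.
Qed.

(** Tonelli: absolute summability of a double family may be checked row by row. *)
Lemma summ2P f : (forall i, summ (f i)) ->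
  summ (fun i => tsum (fun j => `|f i j|)) -> summ2 f.
Proof.
move=> sr; have t0 i : 0 <= tsum (fun j => `|f i j|) by exact: tsum_ge0.
move=> /(summ_ge0P t0); apply: le_lt_trans; apply: le_esum => i _.
by rewrite esum_summ//; exact/summ_abs.
Qed.

End Exchange.

Lemma summ2_swap {R : realType} {I J : choiceType} (f : I -> J -> R) :
  summ2 f -> summ2 (fun j i => f i j).
Proof. by rewrite /summ2 esum_swap. Qed.

Lemma summ2_le {R : realType} {I J : choiceType} (f g : I -> J -> R) :
  (forall i j, `|f i j| <= g i j) -> summ2 g -> summ2 f.
Proof.
move=> fg; apply: le_lt_trans; apply: le_esum => i _; apply: le_esum => j _.
by rewrite lee_fin (le_trans (fg i j))// ler_norm.
Qed.

Lemma summ2D {R : realType} {I J : choiceType} (f g : I -> J -> R) :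
  summ2 f -> summ2 g -> summ2 (fun i j => f i j + g i j).
Proof.
move=> sf sg; apply: le_lt_trans (lte_add_pinfty sf sg).
rewrite -esumD; [|by move=> i _; exact: esum_ge0..].
apply: le_esum => i _; rewrite -esumD//.
by apply: le_esum => j _; rewrite -EFinD lee_fin ler_normD.
Qed.

Lemma summ2Z {R : realType} {I J : choiceType} (c : R) (f : I -> J -> R) :
  summ2 f -> summ2 (fun i j => c * f i j).
Proof.
move=> s2; apply: summ2P => [i|]; first by apply: summZ; exact: summ2_row.
rewrite (_ : (fun i => _) = fun i => `|c| * tsum (fun j => `|f i j|)).
  by apply: summZ; exact: summ2_abs.
apply/funext => i; have sa : summ (fun j => `|f i j|) by apply/summ_abs; exact: summ2_row.
by rewrite -(tsumZ _ sa); apply: eq_tsum => j; rewrite normrM.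
Qed.

Lemma tsum_swap {R : realType} {I J : choiceType} (f : I -> J -> R) : summ2 f ->
  tsum (fun i => tsum (f i)) = tsum (fun j => tsum (fun i => f i j)).
Proof.
move=> s2.
have P (g : I -> J -> R) : (forall i j, 0 <= g i j) -> summ2 g ->
    tsum (fun i => tsum (g i)) = tsum (fun j => tsum (fun i => g i j)).
  move=> g0 sg; apply: EFin_inj; have sg' := summ2_swap sg.
  rewrite -!esum_summ; try by [exact: summ2_tsum|move=> ?; exact: tsum_ge0].
    under eq_esum => i _ do rewrite -(esum_summ (g0 i) (summ2_row sg i)).
    under [RHS]eq_esum => j _ do
      rewrite -(esum_summ (f := fun i => g i j) (fun i => g0 i j) (summ2_row sg' j)).
    by rewrite esum_swap.
have sp : summ2 (fun i => pos_part (f i)).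
  apply: (summ2_le (g := fun i j => `|f i j|)) => [i j|].
    by rewrite ger0_norm ?pos_part_ge0 ?pos_part_le.
  by move: s2; rewrite /summ2; under eq_esum do under eq_esum do rewrite -normr_id.
have sn : summ2 (fun i => neg_part (f i)).
  apply: (summ2_le (g := fun i j => `|f i j|)) => [i j|].
    by rewrite ger0_norm ?neg_part_ge0 ?neg_part_le.
  by move: s2; rewrite /summ2; under eq_esum do under eq_esum do rewrite -normr_id.
have := P _ (fun i j => pos_part_ge0 (f i) j) sp.
have := P _ (fun i j => neg_part_ge0 (f i) j) sn.
have -> : tsum (fun i => tsum (f i)) =
    tsum (fun i => tsum (pos_part (f i))) - tsum (fun i => tsum (neg_part (f i))).
  rewrite -tsumB; try exact: summ2_tsum.
  by apply: eq_tsum => i; rewrite tsum_pn//; exact: summ2_row.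
have -> : tsum (fun j => tsum (fun i => f i j)) =
    tsum (fun j => tsum (fun i => pos_part (f i) j)) -
    tsum (fun j => tsum (fun i => neg_part (f i) j)).
  rewrite -tsumB; try by apply: summ2_tsum; exact: summ2_swap.
  apply: eq_tsum => j; rewrite -tsumB; last 2 first.
  - exact: (summ2_row (summ2_swap sp)).
  - exact: (summ2_row (summ2_swap sn)).
  by apply: eq_tsum => i; rewrite {1}pos_neg.
by move=> -> ->.
Qed.

Lemma summ_tail {R : realType} {I : choiceType} (M : I -> R) (e : R) :
  (forall i, 0 <= M i) -> summ M -> 0 < e ->
  exists2 s : seq I, uniq s & tsum M - \sum_(i <- s) M i < e.
Proof.
move=> M0 sM e0.
have : ((tsum M - e)%:E < \esum_(i in [set: I]) (M i)%:E)%E.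
  by rewrite esum_summ// lte_fin ltrBlDr ltrDl.
move=> /ereal_sup_gt[_ [A [fA _] <-] h].
exists (finmap.enum_fset (fset_set A)); first exact: finmap.fset_uniq.
move: h.
by rewrite fsbig_finite//= sumEFin lte_fin; lra.
Qed.

Lemma near_all_seq {T : Type} {I : eqType} (F : set_system T) {FF : Filter F}
    (s : seq I) (P : T -> I -> Prop) :
  (forall i, \forall t \near F, P t i) ->
  \forall t \near F, forall i, i \in s -> P t i.
Proof.
move=> h; elim: s => [|a s IH]; first exact: nearW.
near=> t => i; rewrite in_cons => /orP[/eqP ->|]; first by near: t.
by move: i; near: t.
Unshelve. all: by end_near. Qed.

(** Tannery's theorem, i.e. dominated convergence for sums. *)
Lemma tsum_cvg {R : realType} {I : choiceType} {T : Type}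
    {F : set_system T} {FF : ProperFilter F}
    (phi : T -> I -> R) (psi M : I -> R) :
  summ M -> (\forall t \near F, forall i, `|phi t i| <= M i) ->
  (forall i, phi t i @[t --> F] --> psi i) ->
  tsum (phi t) @[t --> F] --> tsum psi.
Proof.
move=> sM bd cv.
have M0 i : 0 <= M i.
  have /filter_ex[t /(_ i)] := bd; exact: le_trans.
have bpsi i : `|psi i| <= M i.
  have c : `|phi t i| @[t --> F] --> `|psi i| by apply: cvg_norm; exact: cv.
  apply: (cvgr_to_le c).
  by apply: filterS bd => t; exact.
have spsi : summ psi by exact: summ_le bpsi sM.
apply/cvgrPdist_le => e e0.
have e30 : 0 < e / 4 by lra.
have [s us tl] := summ_tail M0 sM e30.
have sz0 : 0 < ((size s).+1)%:R :> R by rewrite ltr0n.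
near=> t.
have bt i : `|phi t i| <= M i by move: i; near: t.
have st : summ (phi t) by exact: summ_le bt sM.
rewrite -tsumB//.
have sd : summ (fun i => psi i - phi t i) by exact: summB.
apply: (le_trans (ler_abs_tsum sd)).
pose a i := if i \in s then `|psi i - phi t i| else 0.
pose b i := if i \in s then 2 * M i else 0.
have [sa ta] : summ a /\ tsum a = \sum_(i <- s) a i.
  by apply: tsum_seq => // i; rewrite /a => /negbTE ->.
have [sb tb] : summ b /\ tsum b = \sum_(i <- s) b i.
  by apply: tsum_seq => // i; rewrite /b => /negbTE ->.
apply: (@le_trans _ _ (tsum (fun i => a i + (2 * M i - b i)))).
  apply: ler_tsum.
  - exact/summ_abs.
  - by apply: summD => //; apply: summB => //; exact: summZ.
  move=> i; rewrite /a /b; case: ifP => _; first by rewrite subrr addr0.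
  rewrite add0r subr0; apply: le_trans (ler_normB _ _) _.
  by have := bpsi i; have := bt i; lra.
rewrite tsumD//; last by apply: summB => //; exact: summZ.
rewrite tsumB//; last exact: summZ.
rewrite tsumZ// ta tb.
have -> : \sum_(i <- s) b i = 2 * \sum_(i <- s) M i.
  by rewrite big_distrr/=; apply: eq_big_seq => i is_; rewrite /b is_.
have : \sum_(i <- s) a i <= e / 4; last by lra.
have : \sum_(i <- s) a i <= \sum_(i <- s) (e / 4 / (size s).+1%:R).
  rewrite big_seq [leRHS]big_seq; apply: ler_sum => i is_.
  rewrite /a is_; move: i is_; near: t; apply: near_all_seq => i.
  by have /cvgrPdist_le := cv i; apply; rewrite divr_gt0.
move=> /le_trans; apply; rewrite big_const_seq count_predT iter_addr_0.
have -> : e / 4 / (size s).+1%:R *+ size s = e / 4 * ((size s)%:R / (size s).+1%:R).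
  by rewrite -mulr_natr mulrAC -mulrA.
rewrite ger_pMr// ler_pdivrMr// mul1r ler_nat; exact: leqnSn.
Unshelve. all: by end_near. Qed.

Section Jensen.
Context {R : realType} {I : choiceType}.
Variables (c : I -> R) (m : R).
Hypothesis c0 : forall i, 0 <= c i.
Hypothesis sc : summ c.
Hypothesis cm : tsum c = m.
Hypothesis m0 : 0 < m.

(** The weights being summable, [|a| <= 1 + a^2] suffices. *)
Lemma jensen_summ (a : I -> R) : summ (fun i => c i * a i ^+ 2) ->
  summ (fun i => c i * a i).
Proof.
move=> sa; apply: (@summ_le _ _ _ (fun i => c i + c i * a i ^+ 2)); last exact: summD.
move=> i; rewrite normrM (ger0_norm (c0 i)) -{2}(mulr1 (c i)) -mulrDr ler_wpM2l//.
rewrite -real_normK ?num_real//.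
have : 0 <= (`|a i| - 1) ^+ 2 by exact: sqr_ge0.
by have := normr_ge0 (a i); rewrite sqrrB1; lra.
Qed.

(** Cauchy-Schwarz, from the nonnegativity of the variance
    [sum c (m a - A)^2] where [A = sum c a]. *)
Lemma jensen_tsum (a : I -> R) : summ (fun i => c i * a i ^+ 2) ->
  tsum (fun i => c i * a i) ^+ 2 <= m * tsum (fun i => c i * a i ^+ 2).
Proof.
move=> sa; have s1 := jensen_summ sa.
set A := tsum _; set Q := tsum _.
have : 0 <= tsum (fun i => c i * (m * a i - A) ^+ 2).
  by apply: tsum_ge0 => i; rewrite mulr_ge0 ?sqr_ge0.
rewrite (@eq_tsum _ _ _ (fun i => m ^+ 2 * (c i * a i ^+ 2) +
   ((- 2 * m * A) * (c i * a i) + A ^+ 2 * c i))); last by move=> i; ring.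
rewrite (tsumD (summZ _ sa) (summD (summZ _ s1) (summZ _ sc))).
rewrite (tsumD (summZ _ s1) (summZ _ sc)) (tsumZ _ sa) (tsumZ _ s1) (tsumZ _ sc).
rewrite -/A -/Q cm => h.
have {}h : 0 <= m * (m * Q - A ^+ 2) by move: h; congr (_ <= _); ring.
by rewrite pmulr_rge0// in h; lra.
Qed.

End Jensen.

(** * The transition operator on the real weighted space *)

Section ComplexParts.
Context {R : realType}.
Implicit Types z : R[i].

Lemma ReD z1 z2 : complex.Re (z1 + z2) = complex.Re z1 + complex.Re z2.
Proof. by case: z1; case: z2. Qed.

Lemma ImD z1 z2 : complex.Im (z1 + z2) = complex.Im z1 + complex.Im z2.
Proof. by case: z1; case: z2. Qed.

Lemma ReM z1 z2 : complex.Re (z1 * z2) =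
  complex.Re z1 * complex.Re z2 - complex.Im z1 * complex.Im z2.
Proof. by case: z1; case: z2. Qed.

Lemma ImM z1 z2 : complex.Im (z1 * z2) =
  complex.Re z1 * complex.Im z2 + complex.Im z1 * complex.Re z2.
Proof. by case: z1; case: z2. Qed.

Lemma complexP z1 z2 : complex.Re z1 = complex.Re z2 ->
  complex.Im z1 = complex.Im z2 -> z1 = z2.
Proof. by case: z1; case: z2 => ? ? ? ? /= -> ->. Qed.

Lemma normc2E z : ComplexField.Normc.normc z ^+ 2 =
  complex.Re z ^+ 2 + complex.Im z ^+ 2.
Proof. by case: z => a b /=; rewrite sqr_sqrtr// addr_ge0 ?sqr_ge0. Qed.

End ComplexParts.

Section Network.
Context {R : realType} (X : wgraph R).
Hypothesis hX : is_network X.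
Implicit Types (x y : X) (f g h : X -> R).

(** Conductances extended by zero, so that sums over neighbours become sums over
    all vertices. *)
Definition wt x y : R := if adj x y then cond x y else 0.

Definition mass x : R := m0r x.

Lemma wt_ge0 x y : 0 <= wt x y.
Proof. by rewrite /wt; case: ifP => // /(cond_gt0 hX)/ltW. Qed.

Lemma wt_gt0 x y : adj x y -> 0 < wt x y.
Proof. by move=> xy; rewrite /wt xy; exact: cond_gt0. Qed.

Lemma wt_adj x y : adj x y -> wt x y = cond x y.
Proof. by rewrite /wt => ->. Qed.

Lemma wtC x y : wt x y = wt y x.
Proof.
by rewrite /wt (adj_sym hX); case: ifP => // /(cond_sym hX).
Qed.

Lemma esum_nbr x (F : X -> \bar R) :
  (\esum_(y in nbr x) ((cond x y)%:E * F y) =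
   \esum_(y in [set: X]) ((wt x y)%:E * F y))%E.
Proof.
rewrite esum_mkcond; apply: eq_esum => y _; rewrite /wt /nbr.
case: (boolP (adj x y)) => xy; first by rewrite mem_set.
by rewrite memNset ?mul0e//; exact/negP.
Qed.

Lemma rsum_nbr x f : rsum (nbr x) (fun y => cond x y * f y) =
  tsum (fun y => wt x y * f y).
Proof.
rewrite unlock /rsum; congr (fine _ - fine _); rewrite esum_mkcond;
  apply: eq_esum => y _; rewrite /wt /nbr.
- case: (boolP (adj x y)) => xy; first by rewrite mem_set.
  by rewrite memNset ?mul0r ?maxxx//; exact/negP.
- case: (boolP (adj x y)) => xy; first by rewrite mem_set.
  by rewrite memNset ?mul0r ?oppr0 ?maxxx//; exact/negP.
Qed.

Lemma m0_wt x : (m0 x = \esum_(y in [set: X]) (wt x y)%:E)%E.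
Proof.
rewrite /m0 -(eq_esum (a := fun y => (cond x y)%:E * 1)%E); last first.
  by move=> y _; rewrite mule1.
by rewrite esum_nbr; apply: eq_esum => y _; rewrite mule1.
Qed.

Lemma summ_wt x : summ (wt x).
Proof.
by apply/summ_ge0P; [exact: wt_ge0|rewrite -m0_wt; exact: m0_fin].
Qed.

Lemma tsum_wt x : tsum (wt x) = mass x.
Proof.
apply: EFin_inj; rewrite -esum_summ; [|exact: wt_ge0|exact: summ_wt].
rewrite -m0_wt /mass /m0r fineK// fin_numElt (m0_fin hX) andbT.
rewrite (lt_le_trans (ltNyr 0))// m0_wt esum_ge0// => y _.
by rewrite lee_fin wt_ge0.
Qed.

Lemma m0E x : m0 x = (mass x)%:E.
Proof.
by rewrite m0_wt -tsum_wt esum_summ//; [exact: wt_ge0|exact: summ_wt].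
Qed.

Lemma exists_nbr x : exists y, adj x y.
Proof.
have [a [b ab]] := adj_edge hX.
have [p] := adj_connected hX x a; case: p => [/= _ ->|y p /= /andP[xy _] _].
  by exists b.
by exists y.
Qed.

Lemma mass_gt0 x : 0 < mass x.
Proof.
have [y xy] := exists_nbr x; rewrite -tsum_wt.
apply: lt_le_trans (wt_gt0 xy) _; apply: le_tsum_term; last exact: summ_wt.
exact: wt_ge0.
Qed.

Lemma mass_ge0 x : 0 <= mass x.
Proof. exact: ltW (mass_gt0 x). Qed.

Definition opP g x : R := (mass x)^-1 * tsum (fun y => wt x y * g y).

Lemma Re_transP (g : X -> R[i]) x :
  complex.Re (transP g x) = opP (fun y => complex.Re (g y)) x.
Proof.
rewrite /transP ReM /= mul0r subr0 /opP; congr (_ * _); rewrite -rsum_nbr.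
by congr rsum; apply/funext => y; rewrite ReM /= mul0r subr0.
Qed.

Lemma Im_transP (g : X -> R[i]) x :
  complex.Im (transP g x) = opP (fun y => complex.Im (g y)) x.
Proof.
rewrite /transP ImM /= mul0r addr0 /opP; congr (_ * _); rewrite -rsum_nbr.
by congr rsum; apply/funext => y; rewrite ImM /= mul0r addr0.
Qed.

Definition l2 g : Prop := summ (fun x => mass x * g x ^+ 2).

Definition ip f g : R := tsum (fun x => mass x * (f x * g x)).

Lemma mass_sqr_ge0 g x : 0 <= mass x * g x ^+ 2.
Proof. by rewrite mulr_ge0 ?sqr_ge0// mass_ge0. Qed.

Lemma l2X0_parts (g : X -> R[i]) : l2X0 g <->
  l2 (fun x => complex.Re (g x)) /\ l2 (fun x => complex.Im (g x)).
Proof.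
pose r x := mass x * complex.Re (g x) ^+ 2.
pose s x := mass x * complex.Im (g x) ^+ 2.
have r0 x : 0 <= r x by exact: (mass_sqr_ge0 (fun x => complex.Re (g x))).
have s0 x : 0 <= s x by exact: (mass_sqr_ge0 (fun x => complex.Im (g x))).
have re0 : (0 <= \esum_(x in [set: X]) (r x)%:E)%E.
  by apply: esum_ge0 => x _; rewrite lee_fin.
have se0 : (0 <= \esum_(x in [set: X]) (s x)%:E)%E.
  by apply: esum_ge0 => x _; rewrite lee_fin.
have E : (\esum_(x in [set: X]) ((ComplexField.Normc.normc (g x) ^+ 2)%:E * m0 x) =
   \esum_(x in [set: X]) (r x)%:E + \esum_(x in [set: X]) (s x)%:E)%E.
  rewrite -esumD; [|by move=> x _; rewrite lee_fin..].
  by apply: eq_esum => x _; rewrite m0E -EFinM -EFinD normc2E /r /s; congr _%:E; ring.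
rewrite /l2X0 E; split=> [h|[/(summ_ge0P r0) h1 /(summ_ge0P s0) h2]].
  by split; [apply/(summ_ge0P r0)|apply/(summ_ge0P s0)]; apply: le_lt_trans h;
    [exact: leeDl|exact: leeDr].
exact: lte_add_pinfty.
Qed.

Lemma sqr_ave (a b : R) : `|a * b| <= a ^+ 2 + b ^+ 2.
Proof.
have h1 : 0 <= a ^+ 2 - 2 * (a * b) + b ^+ 2.
  by rewrite (_ : _ + _ = (a - b) ^+ 2) ?sqr_ge0//; ring.
have h2 : 0 <= a ^+ 2 + 2 * (a * b) + b ^+ 2.
  by rewrite (_ : _ + _ = (a + b) ^+ 2) ?sqr_ge0//; ring.
have := sqr_ge0 a; have := sqr_ge0 b.
by rewrite ler_norml => ? ?; apply/andP; split; lra.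
Qed.

Lemma l2_mul f g : l2 f -> l2 g -> summ (fun x => mass x * (f x * g x)).
Proof.
move=> sf sg; apply: summ_le (summD sf sg) => x.
rewrite normrM (gtr0_norm (mass_gt0 x)) -mulrDr ler_wpM2l ?mass_ge0//.
exact: sqr_ave.
Qed.

Lemma l2Z c g : l2 g -> l2 (fun x => c * g x).
Proof.
move=> sg; rewrite /l2 (_ : (fun x => _) = (fun x => c ^+ 2 * (mass x * g x ^+ 2))).
  exact: summZ.
by apply/funext => x; ring.
Qed.

Lemma l2D f g : l2 f -> l2 g -> l2 (fun x => f x + g x).
Proof.
move=> sf sg.
rewrite /l2 (_ : (fun x => _) = (fun x => mass x * f x ^+ 2 +
   (2 * (mass x * (f x * g x)) + mass x * g x ^+ 2))).
  by apply: summD => //; apply: summD => //; apply: summZ; exact: l2_mul.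
by apply/funext => x; ring.
Qed.

Lemma l2B f g : l2 f -> l2 g -> l2 (fun x => f x - g x).
Proof.
move=> sf sg; have -> : (fun x => f x - g x) = (fun x => f x + -1 * g x).
  by apply/funext => x; rewrite mulN1r.
by apply: l2D => //; exact: l2Z.
Qed.

Lemma l20 : l2 (fun=> 0).
Proof.
rewrite /l2; have -> : (fun x => mass x * 0 ^+ 2) = fun=> 0.
  by apply/funext => x; rewrite expr0n/= mulr0.
exact: summ0.
Qed.

Lemma l2_le f g : (forall x, `|f x| <= `|g x|) -> l2 g -> l2 f.
Proof.
move=> fg; apply: summ_le => x; rewrite ger0_norm ?mass_sqr_ge0//.
rewrite ler_wpM2l ?mass_ge0//.
by rewrite -real_normK ?num_real// -(real_normK (x := g x)) ?num_real// lerXn2r ?nnegrE.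
Qed.

Lemma ipC f g : ip f g = ip g f.
Proof. by apply: eq_tsum => x; rewrite (mulrC (f x)). Qed.

Lemma ipDl f g h : l2 f -> l2 g -> l2 h ->
  ip (fun x => f x + g x) h = ip f h + ip g h.
Proof.
move=> sf sg sh; rewrite /ip -(tsumD (l2_mul sf sh) (l2_mul sg sh)).
by apply: eq_tsum => x; ring.
Qed.

Lemma ipZl c f h : l2 f -> l2 h -> ip (fun x => c * f x) h = c * ip f h.
Proof.
move=> sf sh; rewrite /ip -(tsumZ _ (l2_mul sf sh)).
by apply: eq_tsum => x; ring.
Qed.

Lemma ipBl f g h : l2 f -> l2 g -> l2 h ->
  ip (fun x => f x - g x) h = ip f h - ip g h.
Proof.
move=> sf sg sh; rewrite /ip -(tsumB (l2_mul sf sh) (l2_mul sg sh)).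
by apply: eq_tsum => x; ring.
Qed.

Lemma ip_ge0 f : 0 <= ip f f.
Proof. by apply: tsum_ge0 => x; rewrite -expr2 mass_sqr_ge0. Qed.

Lemma ip_eq0 f : l2 f -> ip f f = 0 -> forall x, f x = 0.
Proof.
move=> sf f0 x; have h := @tsum_eq0 _ _ (fun x => mass x * f x ^+ 2).
have : mass x * f x ^+ 2 = 0.
  by apply: (h (mass_sqr_ge0 f) sf); rewrite -f0; apply: eq_tsum => y; rewrite expr2.
by move=> /eqP; rewrite mulf_eq0 (gt_eqF (mass_gt0 x))/= sqrf_eq0 => /eqP.
Qed.

Lemma ip_bound f g : l2 f -> l2 g -> `|ip f g| <= ip f f + ip g g.
Proof.
move=> sf sg; apply: (le_trans (ler_abs_tsum (l2_mul sf sg))).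
rewrite /ip -(tsumD (l2_mul sf sf) (l2_mul sg sg)); apply: ler_tsum.
- by apply/summ_abs; exact: l2_mul.
- by apply: summD; exact: l2_mul.
move=> x; rewrite normrM (gtr0_norm (mass_gt0 x)) -mulrDr ler_wpM2l ?mass_ge0//.
exact: sqr_ave.
Qed.

Lemma summ2_sqr_l g : l2 g -> summ2 (fun x y => wt x y * g x ^+ 2).
Proof.
move=> sg; apply: summ2P => [x|].
  rewrite (_ : (fun y => _) = (fun y => g x ^+ 2 * wt x y)); last first.
    by apply/funext => y; rewrite mulrC.
  by apply: summZ; exact: summ_wt.
apply: summ_le sg => x; rewrite ger0_norm; last exact: tsum_ge0.
rewrite (_ : (fun y => _) = (fun y => g x ^+ 2 * wt x y)); last first.
  apply/funext => y; rewrite (mulrC (g x ^+ 2)) ger0_norm//.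
  by rewrite mulr_ge0 ?wt_ge0 ?sqr_ge0.
by rewrite (tsumZ _ (summ_wt x)) tsum_wt mulrC.
Qed.

Lemma summ2_sqr_r g : l2 g -> summ2 (fun x y => wt x y * g y ^+ 2).
Proof.
move=> /summ2_sqr_l/summ2_swap.
have -> // : (fun x y => wt y x * g y ^+ 2) = (fun x y => wt x y * g y ^+ 2).
by apply/funext => x; apply/funext => y; rewrite wtC.
Qed.

Lemma summ_row g x : l2 g -> summ (fun y => wt x y * g y).
Proof.
move=> sg; apply: jensen_summ; [exact: wt_ge0|exact: summ_wt|].
exact: (summ2_row (summ2_sqr_r sg)).
Qed.

Lemma tsum_sqr_r g : l2 g -> tsum (fun x => tsum (fun y => wt x y * g y ^+ 2)) = ip g g.
Proof.
move=> sg; rewrite tsum_swap; last exact: summ2_sqr_r.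
apply: eq_tsum => y; rewrite -(tsum_wt y).
rewrite (@eq_tsum _ _ _ (fun x => g y ^+ 2 * wt y x)); last first.
  by move=> x; rewrite wtC mulrC.
by rewrite (tsumZ _ (summ_wt y)) tsum_wt expr2 mulrC.
Qed.

(** Jensen's inequality for the probability weights [c(xy) / m(x)]; summed over
    [x] it says that [P] is a contraction. *)
Lemma opP_sqr g x : l2 g ->
  mass x * opP g x ^+ 2 <= tsum (fun y => wt x y * g y ^+ 2).
Proof.
move=> sg; have := jensen_tsum (@wt_ge0 x) (summ_wt x) (tsum_wt x) (mass_gt0 x)
  (summ2_row (summ2_sqr_r sg) x).
rewrite /opP; set Q := tsum _; set S := tsum _ => h.
have m0 := mass_gt0 x.
have -> : mass x * ((mass x)^-1 * Q) ^+ 2 = (mass x)^-1 * Q ^+ 2.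
  by field; rewrite gt_eqF.
by rewrite mulrC ler_pdivrMr// mulrC.
Qed.

Lemma l2P g : l2 g -> l2 (opP g).
Proof.
move=> sg; apply: summ_le (summ2_tsum (summ2_sqr_r sg)) => x.
by rewrite ger0_norm ?mass_sqr_ge0// opP_sqr.
Qed.

Lemma opP_contr g : l2 g -> ip (opP g) (opP g) <= ip g g.
Proof.
move=> sg; rewrite -(tsum_sqr_r sg); apply: ler_tsum.
- by apply: l2_mul; exact: l2P.
- exact: summ2_tsum (summ2_sqr_r sg).
- by move=> x; rewrite -expr2; exact: opP_sqr.
Qed.

Lemma opPD f g x : l2 f -> l2 g -> opP (fun y => f y + g y) x = opP f x + opP g x.
Proof.
move=> sf sg; rewrite /opP -mulrDr -(tsumD (summ_row x sf) (summ_row x sg)).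
by congr (_ * _); apply: eq_tsum => y; ring.
Qed.

Lemma opPZ c g x : l2 g -> opP (fun y => c * g y) x = c * opP g x.
Proof.
move=> sg; rewrite /opP mulrCA -(tsumZ _ (summ_row x sg)).
by congr (_ * _); apply: eq_tsum => y; ring.
Qed.

Lemma summ2_mixed f g : l2 f -> l2 g -> summ2 (fun x y => wt x y * (f y * g x)).
Proof.
move=> sf sg.
apply: (@summ2_le _ _ _ _ (fun x y => wt x y * f y ^+ 2 + wt x y * g x ^+ 2)).
  move=> x y; rewrite normrM (ger0_norm (wt_ge0 x y)) -mulrDr ler_wpM2l ?wt_ge0//.
  exact: sqr_ave.
exact: summ2D (summ2_sqr_r sf) (summ2_sqr_l sg).
Qed.

Lemma ip_opP f g : l2 f -> l2 g ->
  ip (opP f) g = tsum (fun x => tsum (fun y => wt x y * (f y * g x))).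
Proof.
move=> sf sg; apply: eq_tsum => x.
rewrite (@eq_tsum _ _ _ (fun y => g x * (wt x y * f y))) => [|y]; last by ring.
rewrite (tsumZ _ (summ_row x sf)) /opP.
by rewrite mulrA mulVKf ?gt_eqF ?mass_gt0// mulrC.
Qed.

Lemma opP_sym f g : l2 f -> l2 g -> ip (opP f) g = ip f (opP g).
Proof.
move=> sf sg; rewrite [RHS]ipC !ip_opP// tsum_swap; last exact: summ2_mixed.
by apply: eq_tsum => y; apply: eq_tsum => x; rewrite wtC (mulrC (f y)).
Qed.

End Network.

(** * Positive functionals on polynomials and power series annihilating them *)

Section Positivity.
Context {R : realType}.
Implicit Types (L : {poly R} -> R) (p q r u : {poly R}).

(** The model is [p |-> <p(B) v, v>] for a symmetric operator [B] with
    [0 <= B <= 1]: the two sign conditions encode the two operator inequalities. *)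
Record moment L : Prop := Moment {
  momentD : forall p q, L (p + q) = L p + L q;
  momentZ : forall c p, L (c *: p) = c * L p;
  momentX : forall q, 0 <= L ('X * q ^+ 2);
  momentB : forall q, 0 <= L ((1 - 'X) * q ^+ 2) }.

Lemma moment_sqr L q : moment L -> 0 <= L (q ^+ 2).
Proof.
move=> mL; rewrite (_ : q ^+ 2 = 'X * q ^+ 2 + (1 - 'X) * q ^+ 2); last by ring.
by rewrite (momentD mL) addr_ge0 ?(momentX mL) ?(momentB mL).
Qed.

Lemma moment_XB L q : moment L -> 0 <= L (('X * (1 - 'X)) * q ^+ 2).
Proof.
move=> mL.
rewrite (_ : _ * _ = 'X * ((1 - 'X) * q) ^+ 2 + (1 - 'X) * ('X * q) ^+ 2); last by ring.
by rewrite (momentD mL) addr_ge0 ?(momentX mL) ?(momentB mL).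
Qed.

Lemma moment_mul L d : moment L ->
  (forall q, 0 <= L (d * ('X * q ^+ 2))) ->
  (forall q, 0 <= L (d * ((1 - 'X) * q ^+ 2))) -> moment (fun p => L (d * p)).
Proof.
move=> mL h1 h2; split=> //.
- by move=> p q; rewrite mulrDr (momentD mL).
- by move=> c p; rewrite -scalerAr (momentZ mL).
Qed.

Lemma moment_mul_sqr L q : moment L -> moment (fun p => L (q ^+ 2 * p)).
Proof.
move=> mL; apply: moment_mul => // r.
- have -> : q ^+ 2 * ('X * r ^+ 2) = 'X * (q * r) ^+ 2 by ring.
  exact: (momentX mL).
- have -> : q ^+ 2 * ((1 - 'X) * r ^+ 2) = (1 - 'X) * (q * r) ^+ 2 by ring.
  exact: (momentB mL).
Qed.

Lemma moment0 L : moment L -> L 0 = 0.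
Proof. by move=> mL; rewrite -(scale0r 0) (momentZ mL) mul0r. Qed.

Lemma moment_sum L (n : nat) (F : nat -> {poly R}) : moment L ->
  L (\sum_(0 <= i < n) F i) = \sum_(0 <= i < n) L (F i).
Proof.
by move=> mL; elim/big_rec2: _ => [|i y1 y2 _ <-]; rewrite ?moment0 ?momentD.
Qed.

(** A non-real root comes with its conjugate, hence with the real quadratic
    factor [(X - Re z)^2 + (Im z)^2]. *)
Lemma complex_root_factor p (z : R[i]) : complex.Im z != 0 ->
  root (map_poly (real_complex R) p) z ->
  exists q, p = q * (('X - (complex.Re z)%:P) ^+ 2 + ((complex.Im z) ^+ 2)%:P).
Proof.
move: z => [a b] /= b0 rz; set d := _ + _.
have dE : d = 'X^2 + ((- (2 * a)) *: 'X + (a ^+ 2 + b ^+ 2)%:P).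
  have -> : 2 * a = a + a by lra.
  by rewrite /d -mul_polyC !(polyCN, polyCM, polyCD, polyC_exp); ring.
have sd : size d = 3%N.
  rewrite dE size_polyDl ?size_polyXn//.
  rewrite (leq_ltn_trans (size_polyD _ _))// gtn_max.
  by rewrite (leq_ltn_trans (size_scale_leq _ _)) ?size_polyX//= (leq_ltn_trans (size_polyC_leq1 _)).
have d0 : d != 0 by rewrite -size_poly_eq0 sd.
have dz : (map_poly (real_complex R) d).[(a +i* b)%C] = 0.
  rewrite /d rmorphD/= rmorphXn rmorphB/= map_polyX !map_polyC/= !hornerE/=.
  by simpc; congr (_ +i* _)%C; ring.
exists (divp p d); rewrite {1}(divp_eq p d).
suff -> : modp p d = 0 by rewrite addr0.
have sr : (size (modp p d) <= 2)%N by have := ltn_modpN0 p d0; rewrite sd.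
have : (map_poly (real_complex R) (modp p d)).[(a +i* b)%C] = 0.
  move: rz; rewrite /root {1}(divp_eq p d) rmorphD rmorphM/= hornerD hornerM dz.
  by rewrite mulr0 add0r => /eqP.
set r := modp p d in sr *.
have rE : r = r`_1 *: 'X + (r`_0)%:P.
  apply/polyP => i; rewrite coefD coefZ coefX coefC.
  case: i => [|[|i]]/=; rewrite ?mulr0 ?mulr1 ?addr0 ?add0r//.
  by rewrite nth_default// (leq_trans sr).
rewrite rE rmorphD/= map_polyZ/= map_polyX map_polyC/= !hornerE/=.
simpc => -[]/= h1 h2.
have r1 : r`_1 = 0.
  by move/eqP: h2; rewrite ?mul0r ?addr0 mulf_eq0 (negbTE b0) orbF => /eqP.
by move: h1; rewrite r1 !(mul0r, mulr0, add0r, addr0, subr0) scale0r add0r => ->; rewrite polyC0.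
Qed.

(** Factors of [p] without roots in [[0,1]] can be moved into the functional: for
    each of them, [q |-> L (d q)] is again of the same kind, because [d X] and
    [d (1 - X)] are combinations of squares with nonnegative coefficients times
    [1], [X], [1 - X] and [X (1 - X)].  This is an induction on the degree with a
    varying functional. *)
Lemma moment_pos n L p : (size p <= n)%N -> moment L ->
  (forall x, 0 <= x <= 1 -> 0 < p.[x]) -> 0 <= L p.
Proof.
elim: n L p => [|n IH] L p sp mL p0.
  move: sp; rewrite leqn0 size_poly_eq0 => /eqP ->; by rewrite moment0.
have [/eqP s1|s1] := boolP (size p == 1%N).
  have [c c0 pE] := size_poly1P _ (introT eqP s1).
  have := p0 0; rewrite lexx ler01 pE hornerC => /(_ isT) c1.
  rewrite -(alg_polyC c) (momentZ mL) mulr_ge0 ?(ltW c1)//.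
  by have := moment_sqr 1 mL; rewrite expr1n.
have [z rz] : exists z : R[i], root (map_poly (real_complex R) p) z.
  by apply/closed_rootP; rewrite size_map_poly.
have [bz|bz] := eqVneq (complex.Im z) 0; last first.
  have [q pE] := complex_root_factor bz rz.
  move: pE; set a := complex.Re z; set b := complex.Im z in bz *.
  set d := _ + _ => pE.
  have d0 x : 0 < d.[x].
    rewrite /d hornerD hornerC horner_exp hornerXsubC.
    by apply: ltr_wpDl; rewrite ?sqr_ge0// exprn_even_gt0.
  have -> : L p = L (d * q) by rewrite pE mulrC.
  have p00 : p != 0.
    by apply/eqP => p00; have := p0 0; rewrite lexx ler01 p00 horner0 ltxx => /(_ isT).
  have q0 : q != 0 by apply: contra_neq p00 => q0; rewrite pE q0 mul0r.
  apply: (IH (fun s => L (d * s)) q).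
  - have sd : size d = 3%N.
      rewrite /d size_polyDl.
        by rewrite size_exp_XsubC.
      by rewrite size_exp_XsubC (leq_ltn_trans (size_polyC_leq1 _)).
    have d00 : d != 0 by rewrite -size_poly_eq0 sd.
    by move: sp; rewrite pE size_mul// sd addn3 /= => /ltnW.
  - apply: moment_mul => // r.
    + have -> : d * ('X * r ^+ 2) = 'X * (('X - a%:P) * r) ^+ 2 + (b ^+ 2) *: ('X * r ^+ 2).
        by rewrite /d -mul_polyC; ring.
      rewrite (momentD mL) (momentZ mL); apply: addr_ge0; first exact: (momentX mL).
      by apply: mulr_ge0; [exact: sqr_ge0|exact: (momentX mL)].
    + have -> : d * ((1 - 'X) * r ^+ 2) =
         (1 - 'X) * (('X - a%:P) * r) ^+ 2 + (b ^+ 2) *: ((1 - 'X) * r ^+ 2).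
        by rewrite /d -mul_polyC; ring.
      rewrite (momentD mL) (momentZ mL); apply: addr_ge0; first exact: (momentB mL).
      by apply: mulr_ge0; [exact: sqr_ge0|exact: (momentB mL)].
  - by move=> x /p0; rewrite pE hornerM pmulr_lgt0.
set a := complex.Re z.
have ra : root p a.
  have zE : z = real_complex R a by rewrite /a; case: z bz {rz a} => x y /= ->.
  by move: rz; rewrite zE fmorph_root.
have [q pE] := factor_theorem p a ra.
have p00 : p != 0.
  by apply/eqP => p00; have := p0 0; rewrite lexx ler01 p00 horner0 ltxx => /(_ isT).
have q0 : q != 0 by apply: contra_neq p00 => q0; rewrite pE q0 mul0r.
have sq : (size q <= n)%N.
  by move: sp; rewrite pE size_mul ?polyXsubC_eq0// size_XsubC addn2.
have [a0|a0] := ltP a 0.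
  have -> : L p = L (('X - a%:P) * q) by rewrite pE mulrC.
  apply: (IH (fun s => L (('X - a%:P) * s)) q) => //.
    apply: moment_mul => // r.
    + have -> : ('X - a%:P) * ('X * r ^+ 2) = ('X * r) ^+ 2 + (- a) *: ('X * r ^+ 2).
        by rewrite -mul_polyC polyCN; ring.
      rewrite (momentD mL) (momentZ mL) addr_ge0 ?moment_sqr// mulr_ge0//; [lra|exact: (momentX mL)].
    + have -> : ('X - a%:P) * ((1 - 'X) * r ^+ 2) =
         'X * (1 - 'X) * r ^+ 2 + (- a) *: ((1 - 'X) * r ^+ 2).
        by rewrite -mul_polyC polyCN; ring.
      rewrite (momentD mL) (momentZ mL) addr_ge0 ?moment_XB// mulr_ge0//; [lra|exact: (momentB mL)].
  move=> x x01; have := p0 x x01; rewrite pE hornerM hornerXsubC pmulr_lgt0//; lra.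
have [a1|a1] := leP a 1.
  by have := p0 a; rewrite a0 a1 (rootP ra) ltxx => /(_ isT).
have -> : L p = L ((a%:P - 'X) * - q) by congr L; rewrite pE; ring.
apply: (IH (fun s => L ((a%:P - 'X) * s)) (- q)); first by rewrite size_polyN.
  apply: moment_mul => // r.
  + have -> : (a%:P - 'X) * ('X * r ^+ 2) =
        'X * (1 - 'X) * r ^+ 2 + (a - 1) *: ('X * r ^+ 2).
      by rewrite -mul_polyC polyCB; ring.
    rewrite (momentD mL) (momentZ mL) addr_ge0 ?moment_XB// mulr_ge0//; [lra|exact: (momentX mL)].
  + have -> : (a%:P - 'X) * ((1 - 'X) * r ^+ 2) =
        ((1 - 'X) * r) ^+ 2 + (a - 1) *: ((1 - 'X) * r ^+ 2).
      by rewrite -mul_polyC polyCB; ring.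
    rewrite (momentD mL) (momentZ mL) addr_ge0 ?moment_sqr// mulr_ge0//; [lra|exact: (momentB mL)].
move=> x x01; have := p0 x x01; rewrite pE hornerM hornerXsubC hornerN.
have xa : 0 < a - x by lra.
by rewrite -(pmulr_rgt0 (- q.[x]) xa) => h; move: h; congr (_ < _); ring.
Qed.

(** Powers [X^n] are [1] or [X] up to a square, and [X^n (1 - X)] likewise. *)
Lemma moment_Xn_sqr L q n : moment L ->
  0 <= L ('X^n * q ^+ 2) <= L (q ^+ 2).
Proof.
move=> mL; have P m r : 0 <= L ('X^m * r ^+ 2) /\ 0 <= L ((1 - 'X) * 'X^m * r ^+ 2).
  elim: m {-2}m (leqnn m) r => [|k IH] m.
    rewrite leqn0 => /eqP -> r; rewrite expr0 !mulr1 mul1r.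
    by split; [exact: moment_sqr|exact: (momentB mL)].
  case: m => [|[|m]] km r.
  - exact: IH.
  - rewrite expr1; split; first exact: (momentX mL).
    by rewrite mulrC (mulrC (1 - _)) mulrC; exact: moment_XB.
  have [|h1 h2] := IH m _ ('X * r); first by rewrite -ltnS ltnW.
  have -> : 'X^(m.+2) * r ^+ 2 = 'X^m * ('X * r) ^+ 2 by rewrite !(exprS 'X); ring.
  have -> : (1 - 'X : {poly R}) * 'X^(m.+2) * r ^+ 2 = (1 - 'X) * 'X^m * ('X * r) ^+ 2.
    by rewrite !(exprS 'X); ring.
  by [].
elim: n => [|n /andP[_ IH]]; first by rewrite expr0 mul1r lexx moment_sqr.
rewrite (P _ _).1 /=; apply: le_trans IH.
have := (P n q).2.
have -> : (1 - 'X) * 'X^n * q ^+ 2 = 'X^n * q ^+ 2 + (- 1) *: ('X^(n.+1) * q ^+ 2).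
  by rewrite (exprS _ n) -mul_polyC polyCN polyC1; ring.
by rewrite (momentD mL) (momentZ mL); lra.
Qed.

(** Polarization reduces the claim to squares. *)
Lemma moment_bounded L u : moment L ->
  exists D, forall n, `|L ('X^n * u)| <= D.
Proof.
move=> mL; exists (L ((u + 1) ^+ 2) + L ((u - 1) ^+ 2)) => n.
have -> : 'X^n * u = 4^-1 *: ('X^n * (u + 1) ^+ 2 + (- 1) *: ('X^n * (u - 1) ^+ 2)).
  have -> : 'X^n * (u + 1) ^+ 2 + (- 1) *: ('X^n * (u - 1) ^+ 2) = 4%:R *: ('X^n * u).
    by rewrite -!mul_polyC polyCN polyC1 polyC_natr; ring.
  by rewrite scalerA mulVf ?scale1r// pnatr_eq0.
rewrite (momentZ mL) (momentD mL) (momentZ mL).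
have := moment_Xn_sqr (u + 1) n mL; have := moment_Xn_sqr (u - 1) n mL.
move=> /andP[h1 h2] /andP[h3 h4].
by rewrite ler_norml; apply/andP; split; lra.
Qed.

End Positivity.

Section Clamp.
Context {R : realType}.
Implicit Types x y : R.

Definition clamp x : R := Num.max 0 (Num.min x 1).

Lemma clampE x : clamp x = if x <= 0 then 0 else if x <= 1 then x else 1.
Proof.
rewrite /clamp; case: (lerP x 1) => h1; case: (lerP x 0) => h2 //; first lra.
by rewrite max_r.
Qed.

Lemma clamp01 x : 0 <= clamp x <= 1.
Proof. by rewrite clampE; case: (lerP x 0) => h1; [|case: (lerP x 1) => h2]; lra. Qed.

Lemma clamp_id x : 0 <= x <= 1 -> clamp x = x.
Proof. by rewrite clampE; case: (lerP x 0) => h1; [|case: (lerP x 1) => h2]; lra. Qed.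

Lemma clamp_lip x y : `|clamp x - clamp y| <= `|x - y|.
Proof.
have P u v : u <= v -> `|clamp u - clamp v| <= `|u - v|.
  move=> uv; rewrite (distrC u v) (ger0_norm (x := v - u)) ?subr_ge0//.
  rewrite ler_norml !clampE; case: (lerP u 0) => h1; case: (lerP v 0) => h2;
    case: (lerP u 1) => h3; case: (lerP v 1) => h4; lra.
by have /orP[/P//|/P] := le_total x y; rewrite (distrC y) (distrC (clamp y)).
Qed.

End Clamp.

Section Pairing.
Context {R : realType}.
Implicit Types (a xi : nat -> R) (C D x y : R).

(** Radius of convergence at least 4, with a quantitative bound.  The ratio 1/4 is
    small enough for [geo_quotient] to improve the constant. *)
Definition geo C a := forall n, `|a n| <= C * 4^-1 ^+ n.

Definition bdseq D xi := forall n : nat, `|xi n| <= D.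

(** A power series with coefficients [a], in which the bounded sequence [xi] takes
    the place of the powers of a point.  For [xi n = L (X^n u)] this is the
    extension of the functional to power series. *)
Definition pairing a xi : R := limn (series (fun n => a n * xi n)).

Lemma quarter_series : series (geometric 1 4^-1) @ \oo --> (4 / 3 : R).
Proof.
have -> : (4 / 3 : R) = 1 / (1 - 4^-1) by field.
by apply: cvg_geometric_series; rewrite ger0_norm; lra.
Qed.

Lemma pairing_cvg C D a xi : geo C a -> bdseq D xi ->
  cvgn (series (fun n => a n * xi n)) /\ `|pairing a xi| <= 4 / 3 * C * D.
Proof.
move=> ga bx.
have C0 : 0 <= C by have := ga 0%N; rewrite expr0 mulr1; exact: le_trans.
have D0 : 0 <= D by have := bx 0%N; exact: le_trans.
have le n : `|a n * xi n| <= C * D * geometric 1 4^-1 n.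
  rewrite normrM /= mul1r mulrAC ler_pM//; exact: ga.
have cg : series (fun n => C * D * geometric 1 4^-1 n) @ \oo --> (C * D * (4 / 3)).
  rewrite (_ : series _ = (fun n => C * D * series (geometric 1 4^-1) n)).
    by apply: cvgMr; exact: quarter_series.
  by apply/funext => n; rewrite /series/= big_distrr.
have cn : cvgn [normed series (fun n => a n * xi n)].
  apply: (@series_le_cvg _ _ (fun n => C * D * geometric 1 4^-1 n) _ _ le) => //.
  - by move=> n; exact: le_trans (normr_ge0 _) (le n).
  - by apply: cvgP cg.
have c := normed_cvg cn; split=> //.
rewrite /pairing (le_trans (lim_series_norm cn))//.
apply: (@le_trans _ _ (limn (series (fun n => C * D * geometric 1 4^-1 n)))).
  apply: lim_series_le => //; by apply: cvgP cg.
by rewrite (cvg_lim _ cg)//; lra.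
Qed.

Lemma pairingE C D a xi N : geo C a -> bdseq D xi ->
  pairing a xi = \sum_(0 <= n < N) a n * xi n +
    pairing (fun n => a (N + n)%N) (fun n => xi (N + n)%N).
Proof.
move=> ga bx; have [c _] := pairing_cvg ga bx.
have C0 : 0 <= C by have := ga 0%N; rewrite expr0 mulr1; exact: le_trans.
have ga' : geo C (fun n => a (N + n)%N).
  move=> n; apply: le_trans (ga _) _; rewrite ler_wpM2l// exprD ger_pMl ?exprn_gt0//.
  by apply: exprn_ile1; lra.
have [c' _] := pairing_cvg ga' (fun n => bx (N + n)%N).
apply: cvg_lim => //; rewrite -(cvg_shiftn N) /pairing/=; set S := \sum_(0 <= n < N) _.
rewrite (_ : (fun n => _) = (fun n => S + series (fun n => a (N + n)%N * xi (N + n)%N) n)).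
  by apply: cvgD; [exact: cvg_cst|exact: c'].
apply/funext => n; rewrite /series/= (big_cat_nat (n := N)) ?leq_addl//.
by congr (_ + _); rewrite -{1}(add0n N) big_addn addnK; apply: eq_bigr => i _; rewrite addnC.
Qed.

Lemma pairing_tail C D a xi N : geo C a -> bdseq D xi ->
  `|pairing a xi - \sum_(0 <= n < N) a n * xi n| <= 4 / 3 * C * D * 4^-1 ^+ N.
Proof.
move=> ga bx; rewrite (pairingE N ga bx) addrAC subrr add0r.
have ga' : geo (C * 4^-1 ^+ N) (fun n => a (N + n)%N).
  by move=> n; rewrite -mulrA -exprD; exact: ga.
have [_] := pairing_cvg ga' (fun n => bx (N + n)%N).
by move=> /le_trans; apply; rewrite le_eqVlt; apply/orP; left; apply/eqP; ring.
Qed.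

Definition powseq x : nat -> R := fun n => x ^+ n.

Lemma bd_powseq x : 0 <= x <= 1 -> bdseq 1 (powseq x).
Proof.
move=> /andP[x0 x1] n; rewrite ger0_norm ?exprn_ge0//; exact: exprn_ile1.
Qed.

(** Synthetic division of a power series by [X - y]: the [n]th coefficient of the
    quotient is [sum_j a_(n+1+j) y^j]. *)
Definition quotient a y : nat -> R :=
  fun n => pairing (fun j => a (n.+1 + j)%N) (powseq y).

(** The tail of a geometric series of ratio 1/4 starting at [n + 1] sums to
    [4/3 * 4^-(n+1) = 4^-n / 3]. *)
Lemma geo_quotient C a y : geo C a -> 0 <= y <= 1 -> geo (C / 3) (quotient a y).
Proof.
move=> ga y01 n.
have ga' : geo (C * 4^-1 ^+ n.+1) (fun j => a (n.+1 + j)%N).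
  by move=> j; rewrite -mulrA -exprD; exact: ga.
have [_] := pairing_cvg ga' (bd_powseq y01).
by move=> /le_trans; apply; rewrite le_eqVlt; apply/orP; left; apply/eqP; rewrite exprS; field.
Qed.

(** Division with remainder for power series, by Abel summation. *)
Lemma pairing_quotient C D a xi y : geo C a -> bdseq D xi -> 0 <= y <= 1 ->
  pairing a xi = pairing a (powseq y) * xi 0%N +
    pairing (quotient a y) (fun n => xi n.+1 - y * xi n).
Proof.
move=> ga bx y01.
pose T n := pairing (fun j => a (n + j)%N) (powseq y).
have C0 : 0 <= C by have := ga 0%N; rewrite expr0 mulr1; exact: le_trans.
have D0 : 0 <= D by have := bx 0%N; exact: le_trans.
have gan n : geo (C * 4^-1 ^+ n) (fun j => a (n + j)%N).
  by move=> j; rewrite -mulrA -exprD; exact: ga.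
have TS n : T n = a n + y * T n.+1.
  rewrite /T (pairingE 1 (gan n) (bd_powseq y01)) big_nat1 addn0 [powseq y 0%N]expr0 mulr1.
  congr (_ + _); have [c _] := pairing_cvg (gan n.+1) (bd_powseq y01).
  apply: cvg_lim => //.
  rewrite (_ : series _ = (fun N => y * series (fun j => a (n.+1 + j)%N * powseq y j) N)).
    by apply: cvgMr; exact: c.
  apply/funext => N; rewrite /series/= big_distrr/=; apply: eq_bigr => i _.
  by rewrite addnCA addSn addnC -addnS add1n /powseq addnC exprS addSnnS; ring.
have Tb n : `|T n| <= 4 / 3 * C * 4^-1 ^+ n.
  have [_] := pairing_cvg (gan n) (bd_powseq y01).
  by move=> /le_trans; apply; rewrite mulr1 !mulrA.
have bq : bdseq (2 * D) (fun n => xi n.+1 - y * xi n).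
  move=> n; apply: le_trans (ler_normB _ _) _.
  have h1 := bx n; have h2 := bx n.+1; have /andP[y0 y1] := y01.
  have : y * `|xi n| <= `|xi n| by rewrite ler_piMl.
  by rewrite normrM (ger0_norm y0); lra.
have gT : geo (4 / 3 * C) T by exact: Tb.
have [cT _] := pairing_cvg gT bx.
have [ca _] := pairing_cvg ga bx.
have [cq _] := pairing_cvg (geo_quotient ga y01) bq.
have key N : series (fun n => a n * xi n) N = T 0%N * xi 0%N - T N * xi N +
    series (fun n => quotient a y n * (xi n.+1 - y * xi n)) N.
  elim: N => [|N IH]; first by rewrite /series/= !big_nil; lra.
  rewrite !seriesSr IH/=; have -> : quotient a y N = T N.+1 by [].
  have -> : a N = T N - y * T N.+1 by have := TS N; lra.
  by ring.
apply: cvg_lim => //; rewrite (_ : series _ = (fun N => T 0%N * xi 0%N - T N * xi N +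
    series (fun n => quotient a y n * (xi n.+1 - y * xi n)) N)); last exact/funext.
rewrite -[X in _ --> X + _]subr0; apply: cvgD; last exact: cq.
by apply: cvgB; [exact: cvg_cst|exact: cvg_series_cvg_0].
Qed.

Lemma powseq_shift x y n : powseq x n.+1 - y * powseq x n = (x - y) * powseq x n.
Proof. by rewrite /powseq exprS mulrBl. Qed.

Lemma pairingZ C D a xi c : geo C a -> bdseq D xi ->
  pairing a (fun n => c * xi n) = c * pairing a xi.
Proof.
move=> ga bx; have [ca _] := pairing_cvg ga bx.
apply: cvg_lim => //.
rewrite (_ : series _ = (fun N => c * series (fun n => a n * xi n) N)).
  by apply: cvgMr; exact: ca.
by apply/funext => N; rewrite /series/= big_distrr/=; apply: eq_bigr => i _; ring.
Qed.

Lemma pairing_pow_quotient C a x y : geo C a -> 0 <= x <= 1 -> 0 <= y <= 1 ->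
  pairing a (powseq x) = pairing a (powseq y) +
    (x - y) * pairing (quotient a y) (powseq x).
Proof.
move=> ga x01 y01; rewrite (pairing_quotient ga (bd_powseq x01) y01).
rewrite [powseq x 0%N]expr0 mulr1; congr (_ + _).
rewrite -(pairingZ _ (geo_quotient ga y01) (bd_powseq x01)).
by congr pairing; apply/funext => n; exact: powseq_shift.
Qed.

(** Dividing by [X - y] exhibits the difference of two values as a multiple of
    [x - y], with a quotient bounded uniformly in [y]. *)
Lemma pairing_pow_continuous C a : geo C a ->
  continuous (fun x => pairing a (powseq (clamp x))).
Proof.
move=> ga x; have C0 : 0 <= C by have := ga 0%N; rewrite expr0 mulr1; exact: le_trans.
apply/cvgrPdist_le => e e0.
have d0 : 0 < e / (C + 1) by rewrite divr_gt0//; lra.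
near=> y.
rewrite (pairing_pow_quotient ga (clamp01 x) (clamp01 y)) addrAC subrr add0r normrM.
have [_ h] := pairing_cvg (geo_quotient ga (clamp01 y)) (bd_powseq (clamp01 x)).
have xy : `|x - y| <= e / (C + 1).
  by near: y; have /cvgrPdist_le := @cvg_id _ (nbhs x); exact.
apply: (@le_trans _ _ (e / (C + 1) * (C + 1))); last by rewrite divfK//; lra.
apply: ler_pM => //; first exact: le_trans (clamp_lip _ _) xy.
by apply: le_trans h _; lra.
Unshelve. all: by end_near. Qed.

End Pairing.

Section Annihilator.
Context {R : realType}.
Variables (L : {poly R} -> R) (C : R) (a : nat -> R) (x0 : R).
Hypotheses (mL : moment L) (ga : geo C a) (L1 : 0 < L 1) (x01 : 0 <= x0 <= 1).
Hypothesis ann : forall u, pairing a (fun n => L ('X^n * u)) = 0.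
Hypothesis ax0 : pairing a (powseq x0) != 0.

(** Without a zero, the series has constant sign and is bounded away from zero by
    some [d] on [[0,1]].  A partial sum close to it, minus [d / 2], is then a
    polynomial to which [moment_pos] applies, with the functional
    [p |-> L (q^2 p)]; in the limit [L (q^2)] would be nonpositive. *)
Lemma annihilator_no_zero C' b q : geo C' b -> L (q ^+ 2) != 0 ->
  pairing b (fun n => L ('X^n * (q * q))) = 0 ->
  exists2 y : R, 0 <= y <= 1 & pairing b (powseq y) = 0.
Proof.
move=> gb q0 bq; apply: contrapT => nz.
pose f x := pairing b (powseq (clamp x)).
have cf : {within `[0, 1], continuous f}.
  by apply: continuous_subspaceT; exact: pairing_pow_continuous gb.
have fE x : 0 <= x <= 1 -> f x = pairing b (powseq x) by move=> h; rewrite /f clamp_id.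
have fn0 x : 0 <= x <= 1 -> f x != 0.
  by move=> h; apply/eqP; rewrite fE// => h'; apply: nz; exists x.
have [s [d [s1 d0 fd]]] : exists s d : R, [/\ s ^+ 2 = 1, 0 < d &
    forall x : R, 0 <= x <= 1 -> d <= s * f x].
  have [c1 c1I h1] := EVT_min ler01 cf.
  have [c2 c2I h2] := EVT_max ler01 cf.
  move: c1I c2I; rewrite !in_itv/= => c1I c2I.
  have [f1|f1] := ltP 0 (f c1).
    exists 1, (f c1); split=> //; first by rewrite expr1n.
    by move=> x x01'; rewrite mul1r h1// in_itv.
  have [f2|f2] := ltP (f c2) 0.
    exists (- 1), (- f c2); split; first by rewrite sqrrN expr1n.
      by rewrite oppr_gt0.
    by move=> x x01'; rewrite mulN1r lerN2 h2// in_itv.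
  exfalso.
  have cfT i : {within i, continuous f}.
    by apply: continuous_subspaceT; exact: pairing_pow_continuous gb.
  have [c12|/ltW c21] := leP c1 c2.
    have [|c] := @IVT _ f c1 c2 0 c12 (cfT _).
      by rewrite ge_min le_max f1 f2 orbT.
    rewrite in_itv/= => cI /eqP; apply/negP; apply: fn0; lra.
  have [|c] := @IVT _ f c2 c1 0 c21 (cfT _).
    by rewrite ge_min le_max f1 f2 orbT.
  rewrite in_itv/= => cI /eqP; apply/negP; apply: fn0; lra.
have Lq0 : 0 < L (q ^+ 2) by rewrite lt_neqAle eq_sym q0 moment_sqr.
have [D hD] := moment_bounded (q * q) mL.
have C'0 : 0 <= C' by have := gb 0%N; rewrite expr0 mulr1; exact: le_trans.
have D0 : 0 <= D by have := hD 0%N; exact: le_trans.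
pose K := 4 / 3 * C' * (1 + D).
(* [K 4^-N] bounds the truncation error both of the series on [0,1] and of its
   pairing with the moments of [q^2]. *)
have [N hN] : exists N, K * 4^-1 ^+ N < d / 2 * Num.min 1 (L (q ^+ 2)).
  have h : (fun n => K * 4^-1 ^+ n) @ \oo --> (K * 0 : R).
    by apply: cvgMr; apply: cvg_expr; rewrite ger0_norm; lra.
  have e0 : 0 < d / 2 * Num.min 1 (L (q ^+ 2)).
    by rewrite mulr_gt0 ?lt_min ?ltr01 ?divr_gt0.
  have /cvgrPdist_lt/(_ _ e0) := h.
  move=> [N _ /(_ N (leqnn N))]/=; rewrite mulr0 sub0r normrN => hh.
  by exists N; exact: le_lt_trans (ler_norm _) hh.
have K0 : 0 <= 4 / 3 * C' * 4^-1 ^+ N by rewrite !mulr_ge0 ?exprn_ge0.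
have KE : K * 4^-1 ^+ N = 4 / 3 * C' * 4^-1 ^+ N + 4 / 3 * C' * D * 4^-1 ^+ N.
  by rewrite /K; ring.
have K0' : 0 <= 4 / 3 * C' * D * 4^-1 ^+ N by rewrite !mulr_ge0 ?exprn_ge0.
have hN1 : K * 4^-1 ^+ N < d / 2.
  by apply: lt_le_trans hN _; rewrite ger_pMr ?divr_gt0// ge_min lexx.
have hN2 : K * 4^-1 ^+ N < d / 2 * L (q ^+ 2).
  by apply: lt_le_trans hN _; rewrite ler_pM2l ?divr_gt0// ge_min lexx orbT.
pose p := s *: (\sum_(0 <= n < N) b n *: 'X^n) - (d / 2)%:P.
have s1' : `|s| = 1.
  by apply/eqP; rewrite -(@eqrXn2 _ 2)// expr1n real_normK ?num_real// s1.
have p0 x : 0 <= x <= 1 -> 0 < p.[x].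
  move=> h; rewrite /p hornerD hornerN hornerC hornerZ horner_sum.
  under eq_bigr do rewrite hornerZ hornerXn.
  have := pairing_tail N gb (bd_powseq h); have := fd x h; rewrite (fE _ h).
  set S := \sum_(_ <= _ < _) _; set P := pairing _ _ => h1.
  rewrite mulr1 => h2; have := ler_norm (s * (P - S)).
  by rewrite normrM s1' mul1r mulrBr; lra.
have := moment_pos (leqnn (size p)) (moment_mul_sqr q mL) p0.
have -> : q ^+ 2 * p = s *: (\sum_(0 <= n < N) b n *: ('X^n * (q * q))) +
     (- (d / 2)) *: q ^+ 2.
  rewrite scaleNr -(mul_polyC (d / 2)) /p mulrBr -scalerAr big_distrr/=.
  rewrite (mulrC _ (d / 2)%:P); congr (_ *: _ - _).
  by apply: eq_bigr => i _; rewrite -scalerAr expr2 mulrC.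
rewrite (momentD mL) !(momentZ mL) (moment_sum _ _ mL).
under eq_bigr do rewrite (momentZ mL).
have := pairing_tail N gb hD; rewrite bq sub0r normrN.
set S := \sum_(_ <= _ < _) _ => h2.
by have := ler_norm (s * S); rewrite normrM s1' mul1r; lra.
Qed.

(** Every zero [y] of the power series in [0,1] can be divided out, replacing
    the constant [C] by [C / 3]; as the series does not vanish at [x0] this
    cannot go on forever unless some [X - y] is annihilated. *)
Lemma annihilator_root : exists y : R, exists r,
  [/\ 0 <= y <= 1, L (('X - y%:P) ^+ 2 * r ^+ 2) = 0 & L (r ^+ 2) != 0].
Proof.
apply: contrapT => H.
have {}H (y : R) r : 0 <= y <= 1 -> L (r ^+ 2) != 0 -> L ((r * ('X - y%:P)) ^+ 2) != 0.
  move=> y01 r0; apply/eqP => h; apply: H; exists y, r; split=> //.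
  by rewrite -h; congr L; rewrite exprMn mulrC.
have claim N : exists b q, [/\ geo (C / 3 ^+ N) b, L (q ^+ 2) != 0,
    forall u, pairing b (fun n => L ('X^n * (q * u))) = 0 &
    `|pairing a (powseq x0)| <= `|pairing b (powseq x0)|].
  elim: N => [|N [b [q [gb q0 bann bx0]]]].
    exists a, 1; split=> [|||//].
    - by rewrite expr0 divr1.
    - by rewrite expr1n gt_eqF.
    - by move=> u; under [X in pairing a X]funext do rewrite mul1r.
  case: (annihilator_no_zero gb q0 (bann q)) => y y01 bz.
  exists (quotient b y), (q * ('X - y%:P)); split.
  - have -> : C / 3 ^+ N.+1 = C / 3 ^+ N / 3 by rewrite exprSr invfM mulrA.
    exact: geo_quotient.
  - exact: H.
  - move=> u; have [D hD] := moment_bounded (q * u) mL.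
    have := bann u; rewrite (pairing_quotient gb hD y01) bz mul0r add0r => <-.
    congr pairing; apply/funext => n; rewrite -(momentZ mL) -[in RHS]mulN1r.
    rewrite mulN1r -(mulN1r (L _)) -(momentZ mL) -(momentD mL); congr L.
    by rewrite exprS -!mul_polyC polyCN polyC1; ring.
  - apply: le_trans bx0 _.
    rewrite (pairing_pow_quotient gb x01 y01) bz add0r normrM ler_piMl//.
    move: x01 y01 => /andP[? ?] /andP[? ?]; rewrite ler_norml; apply/andP; split; lra.
have ax0' : 0 < `|pairing a (powseq x0)| by rewrite normr_gt0.
have h : (fun n => 4 / 3 * C * 3^-1 ^+ n) @ \oo --> (4 / 3 * C * 0 : R).
  by apply: cvgMr; apply: cvg_expr; rewrite ger0_norm; lra.
have /cvgrPdist_lt/(_ _ ax0')[N _ /(_ N (leqnn N))]/= := h.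
rewrite mulr0 sub0r normrN => hN.
have [b [q [gb _ _]]] := claim N.
have [_] := pairing_cvg gb (bd_powseq x01).
rewrite mulr1 => h1 h2; have := le_trans h2 h1; rewrite leNgt => /negP; apply.
apply: le_lt_trans hN; rewrite exprVn mulrA; exact: ler_norm.
Qed.

End Annihilator.

(** * Differential calculus on the unit interval *)

Section Calculus.
Context {R : realType}.
Implicit Types (f g h : R -> R) (t : R).

Definition hasD f f' := forall t : R, 0 <= t <= 1 -> is_derive t 1 f (f' t).

Lemma hasD_within f f' : hasD f f' -> forall s t : R, 0 <= s -> t <= 1 ->
  {within `[s, t], continuous f}.
Proof.
move=> h s t s0 t1; apply: derivable_within_continuous => x.
rewrite in_itv/= => /andP[sx xt]; apply: ex_derive.
by apply: h; rewrite (le_trans s0)//= (le_trans xt).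
Qed.

Lemma hasD_ext f f' f'' : hasD f f' -> (forall t : R, 0 <= t <= 1 -> f' t = f'' t) ->
  hasD f f''.
Proof. by move=> h e t t01; rewrite -e//; exact: h. Qed.

Lemma hasD_cst (c : R) : hasD (fun=> c) (fun=> 0).
Proof. by move=> t _; apply: is_derive_cst. Qed.

Lemma hasDD f f' g g' : hasD f f' -> hasD g g' ->
  hasD (fun t => f t + g t) (fun t => f' t + g' t).
Proof. by move=> hf hg t t01; apply: is_deriveD; [exact: hf|exact: hg]. Qed.

Lemma hasDB f f' g g' : hasD f f' -> hasD g g' ->
  hasD (fun t => f t - g t) (fun t => f' t - g' t).
Proof. by move=> hf hg t t01; apply: is_deriveB; [exact: hf|exact: hg]. Qed.

Lemma hasDM f f' g g' : hasD f f' -> hasD g g' ->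
  hasD (fun t => f t * g t) (fun t => f' t * g t + f t * g' t).
Proof.
move=> hf hg t t01; have := hf t t01; have := hg t t01 => ? ?.
by apply: is_derive_eq; rewrite /GRing.scale/=; ring.
Qed.

Lemma hasDZ (c : R) f f' : hasD f f' -> hasD (fun t => c * f t) (fun t => c * f' t).
Proof.
move=> hf t t01; have := hf t t01 => ?.
by apply: is_derive_eq; rewrite /GRing.scale/=; ring.
Qed.

Lemma hasD_rev f f' : hasD f f' -> hasD (fun t => f (1 - t)) (fun t => - f' (1 - t)).
Proof.
move=> hf t /andP[t0 t1]; have : 0 <= 1 - t <= 1 by apply/andP; split; lra.
by move=> /hf ?; apply: is_derive_eq; ring.
Qed.

Lemma hasD_mono f f' : hasD f f' -> (forall t : R, 0 <= t <= 1 -> 0 <= f' t) ->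
  forall s t, 0 <= s -> s <= t -> t <= 1 -> f s <= f t.
Proof.
move=> hf f0 s t s0; rewrite le_eqVlt => /predU1P[->//|st] t1.
have [|c] := @MVT _ f f' s t st _ (hasD_within hf s0 t1).
  move=> x; rewrite in_itv/= => /andP[sx xt]; apply: hf.
  by rewrite (le_trans s0 (ltW sx)) (le_trans (ltW xt)).
rewrite in_itv/= => /andP[sc ct] h; rewrite -subr_ge0 h mulr_ge0//; last lra.
by apply: f0; rewrite (le_trans s0 (ltW sc)) (le_trans (ltW ct)).
Qed.

Lemma hasD_const f f' : hasD f f' -> (forall t : R, 0 <= t <= 1 -> f' t = 0) ->
  forall t, 0 <= t <= 1 -> f t = f 0.
Proof.
move=> hf f0 t /andP[t0 t1]; apply/eqP; rewrite eq_le; apply/andP; split.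
  have := @hasD_mono (fun t => 0 - f t) _ (hasDB (hasD_cst 0) hf).
  move=> /(_ _ 0 t (lexx _) t0 t1) H.
  have : 0 - f 0 <= 0 - f t by apply: H => u u01; rewrite f0// subrr.
  lra.
by apply: (hasD_mono hf) => // u u01; rewrite f0.
Qed.

(** Normalized so that the derivative of one is its predecessor. *)
Definition mon k t : R := t ^+ k / k`!%:R.

Lemma mon0 k : mon k.+1 0 = 0.
Proof. by rewrite /mon expr0n/= mul0r. Qed.

Lemma mon_ge0 k t : 0 <= t -> 0 <= mon k t.
Proof. by move=> t0; rewrite divr_ge0// exprn_ge0. Qed.

Lemma hasD_mon k : hasD (mon k.+1) (mon k).
Proof.
have hX : hasD (fun t => t ^+ k.+1) (fun t => k.+1%:R * t ^+ k).
  move=> t _; have -> : (fun t : R => t ^+ k.+1) = (@id R) ^+ k.+1.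
    by apply/funext => x; rewrite exprfctE.
  by apply: is_derive_eq; rewrite /GRing.scale/= mulr1.
rewrite (_ : mon k.+1 = fun t => (k.+1)`!%:R^-1 * t ^+ k.+1); last first.
  by apply/funext => t; rewrite /mon mulrC.
apply: hasD_ext (hasDZ _ hX) _ => t _.
rewrite /mon factS natrM.
have : (k`!%:R : R) != 0 by rewrite pnatr_eq0 -lt0n fact_gt0.
have : (k.+1%:R : R) != 0 by rewrite pnatr_eq0.
by move=> h1 h2; field; rewrite ?h1 ?h2 ?(addrC 1) ?natr1 ?h1.
Qed.

(** Compare [f] and [- f] with [M t^(k+1) / (k+1)!] by monotonicity. *)
Lemma deriv_bound f f' (M : R) k : hasD f f' -> f 0 = 0 ->
  (forall t : R, 0 <= t <= 1 -> `|f' t| <= M * mon k t) ->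
  forall t : R, 0 <= t <= 1 -> `|f t| <= M * mon k.+1 t.
Proof.
move=> hf f0 bd t /andP[t0 t1].
have hM := hasDZ M (hasD_mon k).
have h1 := @hasD_mono _ _ (hasDB hM hf) _ 0 t (lexx _) t0 t1.
have h2 := @hasD_mono _ _ (hasDD hM hf) _ 0 t (lexx _) t0 t1.
rewrite ler_norml; apply/andP; split.
  have : M * mon k.+1 0 + f 0 <= M * mon k.+1 t + f t.
    by apply: h2 => u /bd; rewrite ler_norml => /andP[]; lra.
  by rewrite mon0 f0; lra.
have : M * mon k.+1 0 - f 0 <= M * mon k.+1 t - f t.
  by apply: h1 => u /bd; rewrite ler_norml => /andP[]; lra.
by rewrite mon0 f0; lra.
Qed.

End Calculus.

(** The complex functions [G n = G1 n + i G2 n] solve the infinite system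
    [(G n)'' = (b1 + i b2) G n.+1] with [G n 0 = 0] and [(G n)' 0 = l n], and are
    uniformly bounded.  Hence [G n] is the sum of its Taylor series
    [sum_k (b1 + i b2)^k l (n + k) t^(2k+1) / (2k+1)!]. *)
Section Taylor.
Context {R : realType}.
Variables (b1 b2 C : R) (G1 G2 D1 D2 : nat -> R -> R) (l : nat -> R).
Hypothesis hG1 : forall n, hasD (G1 n) (D1 n).
Hypothesis hG2 : forall n, hasD (G2 n) (D2 n).
Hypothesis hD1 : forall n, hasD (D1 n) (fun t => b1 * G1 n.+1 t - b2 * G2 n.+1 t).
Hypothesis hD2 : forall n, hasD (D2 n) (fun t => b2 * G1 n.+1 t + b1 * G2 n.+1 t).
Hypothesis G10 : forall n, G1 n 0 = 0.
Hypothesis G20 : forall n, G2 n 0 = 0.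
Hypothesis D10 : forall n, D1 n 0 = l n.
Hypothesis D20 : forall n, D2 n 0 = 0.
Hypothesis G1C : forall n (t : R), 0 <= t <= 1 -> `|G1 n t| <= C.
Hypothesis G2C : forall n (t : R), 0 <= t <= 1 -> `|G2 n t| <= C.

(** Real and imaginary parts of [(b1 + i b2) ^ k]. *)
Fixpoint cpow k : R * R :=
  if k is k'.+1 then (b1 * (cpow k').1 - b2 * (cpow k').2,
                      b2 * (cpow k').1 + b1 * (cpow k').2) else (1, 0).

Definition psum (c : nat -> R) e N n t : R :=
  \sum_(0 <= k < N) c k * l (n + k)%N * mon (k.*2 + e) t.

Lemma hasD_psum c e N n : hasD (psum c e.+1 N n) (psum c e N n).
Proof.
elim: N => [|N IH].
  rewrite (_ : psum c e.+1 0 n = fun=> 0); last by apply/funext => t; rewrite /psum big_nil.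
  by apply: hasD_ext (hasD_cst 0) _ => t _; rewrite /psum big_nil.
rewrite (_ : psum c e.+1 N.+1 n = fun t => psum c e.+1 N n t +
   c N * l (n + N)%N * mon (N.*2 + e).+1 t); last first.
  by apply/funext => t; rewrite /psum big_nat_recr//= addnS.
apply: hasD_ext (hasDD IH (hasDZ _ (hasD_mon _))) _ => t _.
by rewrite /psum [RHS]big_nat_recr.
Qed.

Lemma hasD_psum0 c N n : hasD (psum c 0 N.+1 n)
  (fun t => \sum_(0 <= k < N) c k.+1 * l (n.+1 + k)%N * mon (k.*2 + 1) t).
Proof.
rewrite (_ : psum c 0 N.+1 n = fun t => c 0%N * l n +
  \sum_(0 <= k < N) c k.+1 * l (n.+1 + k)%N * mon (k.*2 + 2) t); last first.
  apply/funext => t; rewrite /psum big_nat_recl//= addn0 double0 addn0.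
  rewrite {1}/mon expr0 fact0 divr1 mulr1; congr (_ + _); apply: eq_bigr => k _.
  by rewrite addnS addSn doubleS addn0 addn2.
apply: hasD_ext (hasDD (hasD_cst _) (hasD_psum (fun k => c k.+1) 1 N n.+1)) _.
by move=> t _; rewrite add0r.
Qed.

Lemma psum0 c e N n : psum c e.+1 N n 0 = 0.
Proof. by rewrite /psum big1// => k _; rewrite addnS mon0 mulr0. Qed.

(** Two integrations, each by [deriv_bound], gain the factor
    [t^2 / ((2N + 1) (2N + 2))] in the remainder and trade [G n] for [G n.+1]. *)
Lemma taylor_rem N n (t : R) : 0 <= t <= 1 ->
  let M := C * (`|b1| + `|b2|) ^+ N * mon N.*2 t in
  `|G1 n t - psum (fun k => (cpow k).1) 1 N n t| <= M /\
  `|G2 n t - psum (fun k => (cpow k).2) 1 N n t| <= M.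
Proof.
elim: N n t => [|N IH] n t t01 /=.
  by rewrite /psum !big_nil !subr0 /mon fact0 divr1 !mulr1; split; [exact: G1C|exact: G2C].
set b := `|b1| + `|b2|.
have step (u : R) : 0 <= u <= 1 ->
    `|(b1 * G1 n.+1 u - b2 * G2 n.+1 u) -
      \sum_(0 <= k < N) (cpow k.+1).1 * l (n.+1 + k)%N * mon (k.*2 + 1) u|
      <= C * b ^+ N.+1 * mon N.*2 u /\
    `|(b2 * G1 n.+1 u + b1 * G2 n.+1 u) -
      \sum_(0 <= k < N) (cpow k.+1).2 * l (n.+1 + k)%N * mon (k.*2 + 1) u|
      <= C * b ^+ N.+1 * mon N.*2 u.
  move=> u01; have [h1 h2] := IH n.+1 u u01; move: h1 h2.
  set e1 := G1 _ _ - _; set e2 := G2 _ _ - _; set M := C * _ * _ => h1 h2.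
  have -> : (b1 * G1 n.+1 u - b2 * G2 n.+1 u) -
      \sum_(0 <= k < N) (cpow k.+1).1 * l (n.+1 + k)%N * mon (k.*2 + 1) u =
      b1 * e1 - b2 * e2.
    rewrite /e1 /e2 (_ : \sum_(0 <= k < N) _ =
      b1 * psum (fun k => (cpow k).1) 1 N n.+1 u - b2 * psum (fun k => (cpow k).2) 1 N n.+1 u).
      by ring.
    by rewrite /psum !big_distrr/= -sumrB; apply: eq_bigr => k _; ring.
  have -> : (b2 * G1 n.+1 u + b1 * G2 n.+1 u) -
      \sum_(0 <= k < N) (cpow k.+1).2 * l (n.+1 + k)%N * mon (k.*2 + 1) u =
      b2 * e1 + b1 * e2.
    rewrite /e1 /e2 (_ : \sum_(0 <= k < N) _ =
      b2 * psum (fun k => (cpow k).1) 1 N n.+1 u + b1 * psum (fun k => (cpow k).2) 1 N n.+1 u).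
      by ring.
    by rewrite /psum !big_distrr/= -big_split/=; apply: eq_bigr => k _; ring.
  have -> : C * b ^+ N.+1 * mon N.*2 u = `|b1| * M + `|b2| * M.
    by rewrite /M exprS -/b; rewrite /b; ring.
  split; [apply: le_trans (ler_normB _ _) _|
          rewrite (addrC (b2 * e1)); apply: le_trans (ler_normD _ _) _];
    by apply: lerD; rewrite normrM ler_wpM2l.
split.
  rewrite doubleS; apply: (deriv_bound (hasDB (hG1 n) (hasD_psum _ 0 _ n))) => //.
    by rewrite G10 psum0 subrr.
  apply: (deriv_bound (hasDB (hD1 n) (hasD_psum0 _ N n))).
    rewrite D10 /psum big_nat_recl//= addn0 double0 addn0 {1}/mon expr0 fact0 divr1.
    rewrite !mul1r mulr1 big1 ?addr0 ?subrr// => k _.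
    by rewrite addn0 doubleS mon0 mulr0.
  by move=> u u01; have [] := step u u01.
rewrite doubleS; apply: (deriv_bound (hasDB (hG2 n) (hasD_psum _ 0 _ n))) => //.
  by rewrite G20 psum0 subrr.
apply: (deriv_bound (hasDB (hD2 n) (hasD_psum0 _ N n))).
  rewrite D20 /psum big_nat_recl//= addn0 double0 addn0 !mul0r.
  by rewrite big1 ?addr0 ?subrr// => k _; rewrite addn0 doubleS mon0 mulr0.
by move=> u u01; have [] := step u u01.
Qed.

Definition tcoef (c : nat -> R) k : R := c k / (k.*2.+1)`!%:R.

Lemma psum_tcoef c N : psum c 1 N 0 1 = series (fun k => tcoef c k * l k) N.
Proof.
rewrite /psum /series/=; apply: eq_bigr => k _.
by rewrite /mon addn1 expr1n /tcoef add0n; ring.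
Qed.

Lemma cpow_le k : `|(cpow k).1| <= (`|b1| + `|b2|) ^+ k /\
  `|(cpow k).2| <= (`|b1| + `|b2|) ^+ k.
Proof.
elim: k => [|k [IH1 IH2]] /=; first by rewrite normr1 normr0 expr0 ler01.
rewrite exprS mulrDl; split.
  by apply: le_trans (ler_normB _ _) _; apply: lerD; rewrite normrM ler_wpM2l.
rewrite addrC; apply: le_trans (ler_normD _ _) _.
by apply: lerD; rewrite normrM ler_wpM2l.
Qed.

Lemma fact_le m n : (m <= n)%N -> (n`!%:R^-1 : R) <= m`!%:R^-1.
Proof.
by move=> mn; rewrite lef_pV2 ?posrE ?ltr0n ?fact_gt0// ler_nat leq_fact.
Qed.

(** Factorials beat [4^k]. *)
Lemma geo_tcoef (c : nat -> R) (b : R) : 0 <= b -> (forall k, `|c k| <= b ^+ k) ->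
  exists K, geo K (tcoef c).
Proof.
move=> b0 cb.
have := cvg_seq_bounded (cvgP _ (cvg_exp_coeff (4 * b))).
move=> [M [_ /(_ (M + 1))]]; rewrite ltrDl ltr01 => /(_ isT) hM.
exists (M + 1) => k; have := hM k I; rewrite /exp_coeff /= => h.
rewrite /tcoef normrM (ger0_norm (x := _^-1)) ?invr_ge0//.
apply: (@le_trans _ _ (b ^+ k * k`!%:R^-1)).
  rewrite ler_pM ?invr_ge0 ?cb//.
  by apply: fact_le; rewrite -addnn -addnS leq_addr.
move: h; rewrite ger0_norm ?divr_ge0 ?exprn_ge0 ?mulr_ge0// exprMn => h.
have h4 : 0 < (4 : R) ^+ k by rewrite exprn_gt0.
by rewrite exprVn ler_pdivlMr// mulrC mulrA.
Qed.

Lemma taylor_cvg (t : R) : 0 <= t <= 1 ->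
  (fun N => C * (`|b1| + `|b2|) ^+ N * mon N.*2 t) @ \oo --> (0 : R).
Proof.
move=> /andP[t0 t1]; set b := `|b1| + `|b2|.
have b0 : 0 <= b by rewrite addr_ge0.
have C0 : 0 <= C by apply: le_trans (normr_ge0 _) (G1C 0%N (t := 0) _); rewrite lexx ler01.
have h : (fun N => C * exp_coeff b N) @ \oo --> (C * 0 : R).
  by apply: cvgMr; exact: cvg_exp_coeff.
rewrite mulr0 in h; apply: squeeze_cvgr (@cvg_cst _ 0 _ _ _) h.
near=> N; apply/andP; split.
  by rewrite mulr_ge0 ?mon_ge0// mulr_ge0// exprn_ge0.
rewrite -mulrA ler_wpM2l// /exp_coeff /=; apply: ler_wpM2l; first exact: exprn_ge0.
rewrite /mon; apply: (@le_trans _ _ (1 * (N.*2)`!%:R^-1)).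
  by apply: ler_wpM2r; [rewrite invr_ge0|exact: exprn_ile1].
by rewrite mul1r; apply: fact_le; rewrite -addnn leq_addr.
Unshelve. all: by end_near. Qed.

Lemma taylor_zero : (forall n, l n = 0) ->
  forall n (t : R), 0 <= t <= 1 -> G1 n t = 0 /\ G2 n t = 0.
Proof.
move=> l0 n t t01.
have P c N : psum c 1 N n t = 0 by rewrite /psum big1// => k _; rewrite l0 mulr0 mul0r.
have Q (x : R) : (forall N, `|x| <= C * (`|b1| + `|b2|) ^+ N * mon N.*2 t) -> x = 0.
  move=> h; apply/eqP; rewrite -normr_le0.
  by apply: (cvgr_to_ge (taylor_cvg t01)); exact: nearW.
by split; apply: Q => N; have [] := taylor_rem N n t01; rewrite /= !P !subr0.
Qed.

Lemma taylor_value :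
  pairing (tcoef (fun k => (cpow k).1)) l = G1 0 1 /\
  pairing (tcoef (fun k => (cpow k).2)) l = G2 0 1.
Proof.
have t01 : 0 <= (1 : R) <= 1 by rewrite lexx ler01.
have Q c (x : R) : (forall N, `|x - psum c 1 N 0 1| <=
    C * (`|b1| + `|b2|) ^+ N * mon N.*2 1) -> pairing (tcoef c) l = x.
  move=> h; apply: cvg_lim => //.
  rewrite (_ : series _ = (fun N => psum c 1 N 0 1)); last first.
    by apply/funext => N; rewrite psum_tcoef.
  apply/cvgrPdist_le => e e0.
  have /cvgrPdist_le/(_ _ e0) := taylor_cvg t01.
  apply: filterS => N; rewrite sub0r normrN => hN.
  exact: le_trans (h N) (le_trans (ler_norm _) hN).
by split; apply: Q => N; have [] := taylor_rem N 0 t01.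
Qed.

End Taylor.

(** The equation [h' t = alpha (h (1 - t) + p h t)] with [h 0 = 0] for the complex
    function [h = h1 + i h2] and [alpha = a + i b], the inverse of the
    eigenvalue. *)
Section Scalar.
Context {R : realType}.
Variables (a b p : R) (h1 h2 : R -> R).
Let g1 t := h1 (1 - t) + p * h1 t.
Let g2 t := h2 (1 - t) + p * h2 t.
Hypothesis d1 : hasD h1 (fun t => a * g1 t - b * g2 t).
Hypothesis d2 : hasD h2 (fun t => b * g1 t + a * g2 t).
Hypothesis h10 : h1 0 = 0.
Hypothesis h20 : h2 0 = 0.
Hypothesis hn0 : exists2 t : R, 0 <= t <= 1 & (h1 t != 0) || (h2 t != 0).
Hypothesis p1 : p ^+ 2 <= 1.

(** The function [h] is then linear, [h t = alpha (h 1) t], and evaluating at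
    [t = 1] gives [alpha = 1] and [p = 1]. *)
Lemma scalar_const : (forall t : R, 0 <= t <= 1 -> g1 t = g1 0 /\ g2 t = g2 0) ->
  [/\ a = 1, b = 0 & p = 1].
Proof.
move=> gc.
have g10 : g1 0 = h1 1 by rewrite /g1 h10 mulr0 addr0 subr0.
have g20 : g2 0 = h2 1 by rewrite /g2 h20 mulr0 addr0 subr0.
set x := h1 1 in g10 *; set y := h2 1 in g20 *.
have lin (h : R -> R) h' c : hasD h h' -> (forall t : R, 0 <= t <= 1 -> h' t = c) ->
    h 0 = 0 -> forall t : R, 0 <= t <= 1 -> h t = c * t.
  move=> hd hc h0 t t01.
  have hid : hasD (fun t : R => c * t) (fun=> c).
    move=> u _; apply: is_derive_eq; rewrite /GRing.scale/=; ring.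
  have := @hasD_const _ _ _ (hasDB hd hid) _ t t01.
  rewrite h0 mulr0 subrr => /(_ _)/eqP; rewrite subr_eq0 => H; apply/eqP/H.
  by move=> u u01; rewrite hc// subrr.
have l1 := lin _ _ (a * x - b * y) d1.
have l2 := lin _ _ (b * x + a * y) d2.
have {}l1 t : 0 <= t <= 1 -> h1 t = (a * x - b * y) * t.
  by apply: l1 => // u /gc[-> ->]; rewrite g10 g20.
have {}l2 t : 0 <= t <= 1 -> h2 t = (b * x + a * y) * t.
  by apply: l2 => // u /gc[-> ->]; rewrite g10 g20.
have t1 : 0 <= (1 : R) <= 1 by rewrite lexx ler01.
have ex : x = a * x - b * y by have := l1 _ t1; rewrite mulr1.
have ey : y = b * x + a * y by have := l2 _ t1; rewrite mulr1.
have xy0 : 0 < x ^+ 2 + y ^+ 2.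
  rewrite lt_neqAle addr_ge0 ?sqr_ge0// andbT eq_sym paddr_eq0 ?sqr_ge0//.
  rewrite !sqrf_eq0; apply/negP => /andP[/eqP x0 /eqP y0].
  move: hn0 => [t t01]; rewrite (l1 t t01) (l2 t t01) -ex -ey x0 y0 !mul0r.
  by rewrite eqxx.
have : ((a - 1) ^+ 2 + b ^+ 2) * (x ^+ 2 + y ^+ 2) = 0.
  have -> : ((a - 1) ^+ 2 + b ^+ 2) * (x ^+ 2 + y ^+ 2) =
    (a * x - b * y - x) ^+ 2 + (b * x + a * y - y) ^+ 2 by ring.
  by rewrite -ex -ey !subrr expr0n addr0.
move=> /eqP; rewrite mulf_eq0 (gt_eqF xy0) orbF paddr_eq0 ?sqr_ge0// !sqrf_eq0.
rewrite subr_eq0 => /andP[/eqP a1 /eqP b0]; split=> //.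
have [g11 g21] := gc 1 t1.
have e1 : p * x = x by rewrite -[RHS]g10 -g11 /g1 subrr h10 add0r.
have e2 : p * y = y by rewrite -[RHS]g20 -g21 /g2 subrr h20 add0r.
have : (p - 1) * (x ^+ 2 + y ^+ 2) = 0.
  have -> : (p - 1) * (x ^+ 2 + y ^+ 2) = (p * x - x) * x + (p * y - y) * y by ring.
  by rewrite e1 e2 !subrr !mul0r addr0.
by move=> /eqP; rewrite mulf_eq0 (gt_eqF xy0) orbF subr_eq0 => /eqP.
Qed.

(** The quantity [Im (h(t) conj(h(1 - t)))] vanishes at both ends of [0,1], and
    its derivative is [b] times a positive definite form [N] of [h t] and
    [h (1 - t)].  So [b <> 0] makes [N] vanish; to avoid arguing about zeros of
    [N] pointwise, the derivative of [|h|^2] is bounded by a multiple of that of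
    [M]. *)
Lemma scalar_real : p ^+ 2 < 1 -> b = 0.
Proof.
move=> p2; apply: contrapT => /eqP b0.
pose N t := h1 t ^+ 2 + h2 t ^+ 2 + h1 (1 - t) ^+ 2 + h2 (1 - t) ^+ 2 +
  2 * p * (h1 t * h1 (1 - t) + h2 t * h2 (1 - t)).
pose M t := b * (h2 t * h1 (1 - t) - h1 t * h2 (1 - t)).
have dM : hasD M (fun t => b ^+ 2 * N t).
  have := hasDZ b (hasDB (hasDM d2 (hasD_rev d1)) (hasDM d1 (hasD_rev d2))).
  move=> /hasD_ext; apply => t t01.
  by rewrite /N /g1 /g2 subKr; ring.
have q0 : 0 < 1 - p ^+ 2 by lra.
have N0 t : 0 <= N t.
  have -> : N t = (h1 t + p * h1 (1 - t)) ^+ 2 + (h2 t + p * h2 (1 - t)) ^+ 2 +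
     (1 - p ^+ 2) * (h1 (1 - t) ^+ 2 + h2 (1 - t) ^+ 2) by rewrite /N; ring.
  by rewrite !addr_ge0 ?sqr_ge0// (mulr_ge0 (ltW q0))// addr_ge0 ?sqr_ge0.
have b20 : 0 < b ^+ 2 by rewrite exprn_even_gt0.
pose E t := h1 t ^+ 2 + h2 t ^+ 2.
have NE t : (1 - p ^+ 2) * (E t + g1 t ^+ 2 + g2 t ^+ 2) <= N t.
  have -> : N t = g1 t ^+ 2 + g2 t ^+ 2 + (1 - p ^+ 2) * E t.
    by rewrite /N /E /g1 /g2; ring.
  have : 0 <= p ^+ 2 * (g1 t ^+ 2 + g2 t ^+ 2) by rewrite mulr_ge0 ?addr_ge0 ?sqr_ge0.
  by lra.
have dE : hasD E (fun t => 2 * a * (h1 t * g1 t + h2 t * g2 t) +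
                           2 * b * (h2 t * g1 t - h1 t * g2 t)).
  have := hasDD (hasDM d1 d1) (hasDM d2 d2).
  rewrite (_ : (fun t => h1 t * h1 t + h2 t * h2 t) = E); last first.
    by apply/funext => t; rewrite /E; ring.
  by move=> /hasD_ext; apply => t t01; ring.
pose K := (`|a| + `|b|) / (1 - p ^+ 2) / b ^+ 2.
have sq2 (c x y z : R) : `|x| <= z -> `|c * x| <= `|c| * z.
  by move=> h; rewrite normrM ler_wpM2l.
have KE t : 2 * a * (h1 t * g1 t + h2 t * g2 t) + 2 * b * (h2 t * g1 t - h1 t * g2 t)
    <= K * (b ^+ 2 * N t).
  have -> : K * (b ^+ 2 * N t) = (`|a| + `|b|) / (1 - p ^+ 2) * N t.
    by rewrite /K; field; rewrite ?(gt_eqF b20) ?(gt_eqF q0) ?b0.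
  set Q := E t + g1 t ^+ 2 + g2 t ^+ 2.
  apply: (@le_trans _ _ ((`|a| + `|b|) * Q)).
    have xy (x y : R) : `|2 * (x * y)| <= x ^+ 2 + y ^+ 2.
      have h1' : 0 <= x ^+ 2 - 2 * (x * y) + y ^+ 2.
        by rewrite (_ : _ + _ = (x - y) ^+ 2) ?sqr_ge0//; ring.
      have h2' : 0 <= x ^+ 2 + 2 * (x * y) + y ^+ 2.
        by rewrite (_ : _ + _ = (x + y) ^+ 2) ?sqr_ge0//; ring.
      by rewrite ler_norml; apply/andP; split; lra.
    have e1 : a * (2 * (h1 t * g1 t) + 2 * (h2 t * g2 t)) <= `|a| * Q.
      apply: le_trans (ler_norm _) _; rewrite normrM ler_wpM2l//.
      apply: le_trans (ler_normD _ _) _.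
      by have := xy (h1 t) (g1 t); have := xy (h2 t) (g2 t); rewrite /Q /E; lra.
    have e2 : b * (2 * (h2 t * g1 t) - 2 * (h1 t * g2 t)) <= `|b| * Q.
      apply: le_trans (ler_norm _) _; rewrite normrM ler_wpM2l//.
      apply: le_trans (ler_normB _ _) _.
      by have := xy (h2 t) (g1 t); have := xy (h1 t) (g2 t); rewrite /Q /E; lra.
    by rewrite mulrDl; lra.
  rewrite -mulrA ler_wpM2l ?addr_ge0//.
  rewrite -(ler_pM2l q0) mulrA mulfV ?gt_eqF// mul1r; exact: NE.
have M0 : M 0 = 0 by rewrite /M h10 h20 !mul0r subrr mulr0.
have M1 : M 1 = 0 by rewrite /M subrr h10 h20 !mulr0 subrr mulr0.
have mM := hasD_mono dM (fun t _ => mulr_ge0 (sqr_ge0 b) (N0 t)).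
have Mt (t : R) : 0 <= t <= 1 -> M t = 0.
  move=> /andP[t0 t1]; apply/eqP; rewrite eq_le -{1}M1 -{1}M0.
  by rewrite !mM.
have mE := hasD_mono (hasDB (hasDZ K dM) dE).
have {}mE (t : R) : 0 <= t <= 1 -> E t = 0.
  move=> t01; move: (t01) => /andP[t0 t1].
  have E0 : 0 <= E t by rewrite addr_ge0 ?sqr_ge0.
  have : K * M 0 - E 0 <= K * M t - E t.
    by apply: mE => // u u01; rewrite subr_ge0; exact: KE.
  by rewrite M0 Mt// {1}/E h10 h20 expr0n/= mulr0 addr0; lra.
move: hn0 => [t t01]; have /eqP := mE t t01.
by rewrite /E paddr_eq0 ?sqr_ge0// !sqrf_eq0 => /andP[-> ->].
Qed.

(** With [w = a sqrt (1 - p^2)] the equation becomes [h'' = - w^2 h], whose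
    solution is [h t = h' 0 sin (w t) / w]; the values at [t = 1] give the
    claims.  The functions [A] and [B] below are the two constants of motion. *)
Lemma scalar_trig : p ^+ 2 < 1 -> a != 0 ->
  exists w, [/\ w != 0, cos w = p & a * sin w = w].
Proof.
move=> p2 a0; have b0 := scalar_real p2.
pose w := a * Num.sqrt (1 - p ^+ 2).
have q0 : 0 < 1 - p ^+ 2 by lra.
have w0 : w != 0 by rewrite mulf_neq0// gt_eqF// sqrtr_gt0.
have w2 : w ^+ 2 = a ^+ 2 * (1 - p ^+ 2) by rewrite exprMn sqr_sqrtr// ltW.
have [h [hd h0 hne]] : exists h : R -> R,
    [/\ hasD h (fun t => a * (h (1 - t) + p * h t)), h 0 = 0 &
        exists2 t : R, 0 <= t <= 1 & h t != 0].
  have [t t01 /orP[ht|ht]] := hn0.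
    exists h1; split=> //; last by exists t.
    by apply: hasD_ext d1 _ => u u01; rewrite b0 mul0r subr0.
  exists h2; split=> //; last by exists t.
  by apply: hasD_ext d2 _ => u u01; rewrite b0 mul0r add0r.
pose d t := a * (h (1 - t) + p * h t).
have dd : hasD d (fun t => - (w ^+ 2) * h t).
  have := hasDZ a (hasDD (hasD_rev hd) (hasDZ p hd)).
  by move=> /hasD_ext; apply => t t01; rewrite subKr w2; ring.
have dw : hasD (fun t => w * t) (fun=> w).
  by move=> u _; apply: is_derive_eq; rewrite /GRing.scale/=; ring.
have ds : hasD (fun t => sin (w * t)) (fun t => w * cos (w * t)).
  by move=> u _; apply: is_derive_eq; rewrite /GRing.scale/=; ring.
have dc : hasD (fun t => cos (w * t)) (fun t => - w * sin (w * t)).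
  by move=> u _; apply: is_derive_eq; rewrite /GRing.scale/=; ring.
pose A t := w * (h t * cos (w * t)) - d t * sin (w * t).
pose B t := w * (h t * sin (w * t)) + d t * cos (w * t).
have dA : hasD A (fun=> 0).
  apply: hasD_ext (hasDB (hasDZ w (hasDM hd dc)) (hasDM dd ds)) _ => t _.
  by rewrite -/(d t); ring.
have dB : hasD B (fun=> 0).
  apply: hasD_ext (hasDD (hasDZ w (hasDM hd ds)) (hasDM dd dc)) _ => t _.
  by rewrite -/(d t); ring.
have d0 : d 0 = a * h 1 by rewrite /d h0 subr0 mulr0 addr0.
have At t : 0 <= t <= 1 -> A t = 0.
  move=> /(hasD_const dA (fun _ _ => erefl)) ->.
  by rewrite /A h0 mulr0 sin0 !(mul0r, mulr0) subrr.
have Bt t : 0 <= t <= 1 -> B t = a * h 1.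
  move=> /(hasD_const dB (fun _ _ => erefl)) ->.
  by rewrite /B h0 mulr0 cos0 !(mul0r, mulr0) add0r mulr1.
have AB t : w * h t = A t * cos (w * t) + B t * sin (w * t).
  have -> : w * h t = w * h t * (cos (w * t) ^+ 2 + sin (w * t) ^+ 2).
    by rewrite cos2Dsin2 mulr1.
  by rewrite /A /B; ring.
have h10' : h 1 != 0.
  apply/eqP => h1z; have [t t01] := hne; apply/negP; rewrite negbK.
  have := AB t; rewrite At// Bt// h1z mulr0 !mul0r addr0 => /eqP.
  by rewrite mulf_eq0 (negbTE w0).
have t1 : 0 <= (1 : R) <= 1 by rewrite lexx ler01.
have d1' : d 1 = a * p * h 1 by rewrite /d subrr h0 add0r mulrA.
have := At 1 t1; have := Bt 1 t1; rewrite /A /B d1' !mulr1 => e2 e1.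
have {}e1 : w * cos w = a * p * sin w.
  by apply: (mulfI h10'); apply/eqP; rewrite -subr_eq0 -{}e1; apply/eqP; ring.
have {}e2 : w * sin w + a * p * cos w = a.
  by apply: (mulfI h10'); rewrite (mulrC _ a) -{}e2; ring.
have cp : cos w = p.
  apply: (mulfI a0); rewrite -[in LHS]e2 mulrDl.
  have -> : w * sin w * cos w = (w * cos w) * sin w by ring.
  rewrite e1 -[RHS]mulr1 -(cos2Dsin2 w); ring.
have s2 : sin w ^+ 2 = 1 - p ^+ 2 by rewrite sin2cos2 cp.
have s0 : sin w != 0 by rewrite -sqrf_eq0 s2 gt_eqF.
exists w; split=> //; apply: (mulIf s0); rewrite -mulrA -expr2 s2.
by move: e2; rewrite cp => e2; lra.
Qed.

(** If [p^2 = 1] then [g t = h (1 - t) + p h t] satisfies [g (1 - t) = p g t] and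
    has derivative [alpha (- g (1 - t) + p g t) = 0], so that [scalar_const]
    applies. *)
Lemma scalar_eigen : (a != 0) || (b != 0) ->
  b = 0 /\ ((a = 1 /\ p = 1) \/ exists w, [/\ w != 0, cos w = p & a * sin w = w]).
Proof.
move: p1; rewrite le_eqVlt => /orP[/eqP p2|p2] ab; last first.
  have b0 := scalar_real p2; split=> //; right.
  by apply: scalar_trig => //; move: ab; rewrite b0 eqxx orbF.
have rev1 t : g1 (1 - t) = p * g1 t.
  by rewrite /g1 subKr mulrDr mulrA -expr2 p2 mul1r addrC.
have rev2 t : g2 (1 - t) = p * g2 t.
  by rewrite /g2 subKr mulrDr mulrA -expr2 p2 mul1r addrC.
have e1 : hasD g1 (fun=> 0).
  apply: hasD_ext (hasDD (hasD_rev d1) (hasDZ p d1)) _ => t _.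
  by rewrite rev1 rev2; ring.
have e2 : hasD g2 (fun=> 0).
  apply: hasD_ext (hasDD (hasD_rev d2) (hasDZ p d2)) _ => t _.
  by rewrite rev1 rev2; ring.
have [a1 b0 pE] : [/\ a = 1, b = 0 & p = 1].
  by apply: scalar_const => t t01; rewrite (hasD_const e1)// (hasD_const e2).
by split=> //; left.
Qed.

End Scalar.

(** * Polynomials in the operator *)

Section OperatorB.
Context {R : realType} (X : wgraph R).
Hypothesis hX : is_network X.
Implicit Types (u v f g : X -> R) (p q r : {poly R}).

(** The wave satisfies [H'' = - alpha^2 (opB H)], and [0 <= opB <= 1] because [P]
    is a symmetric contraction. *)
Definition opB u : X -> R := fun x => u x - opP (opP u) x.

Lemma l2_opB u : l2 u -> l2 (opB u).
Proof. by move=> su; apply: (l2B hX) => //; do 2 apply: (l2P hX). Qed.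

Lemma opBD u v x : l2 u -> l2 v -> opB (fun y => u y + v y) x = opB u x + opB v x.
Proof.
move=> su sv; rewrite /opB.
rewrite (_ : opP (fun y => u y + v y) = fun y => opP u y + opP v y); last first.
  by apply/funext => y; exact: opPD.
rewrite (opPD hX _ (l2P hX su) (l2P hX sv)); ring.
Qed.

Lemma opBZ c u x : l2 u -> opB (fun y => c * u y) x = c * opB u x.
Proof.
move=> su; rewrite /opB.
rewrite (_ : opP (fun y => c * u y) = fun y => c * opP u y); last first.
  by apply/funext => y; exact: opPZ.
rewrite (opPZ hX _ _ (l2P hX su)); ring.
Qed.

Lemma opB_sym u v : l2 u -> l2 v -> ip (opB u) v = ip u (opB v).
Proof.
move=> su sv; have sPu := l2P hX su; have sPv := l2P hX sv.
rewrite /opB (ipBl hX su (l2P hX sPu) sv) [RHS]ipC (ipBl hX sv (l2P hX sPv) su).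
by rewrite (ipC v u) (opP_sym hX sPu sv) (opP_sym hX su sPv) [ip (opP (opP v)) u]ipC.
Qed.

Lemma opB_le u : l2 u -> 0 <= ip u (opB u) <= ip u u.
Proof.
move=> su; have sPu := l2P hX su.
rewrite ipC /opB (ipBl hX su (l2P hX sPu) su) (opP_sym hX sPu su).
have := opP_contr hX su; have := ip_ge0 hX (opP u); lra.
Qed.

(** The vector [q(B) u]. *)
Definition pol q u : X -> R :=
  fun x => \sum_(0 <= i < size q) q`_i * iter i opB u x.

Lemma l2_iterB n u : l2 u -> l2 (iter n opB u).
Proof. by move=> su; elim: n => //= n; exact: l2_opB. Qed.

Lemma polE n q u x : (size q <= n)%N ->
  pol q u x = \sum_(0 <= i < n) q`_i * iter i opB u x.
Proof.
move=> sq; rewrite /pol (big_cat_nat (n := size q) (p := n))//=.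
rewrite [X in _ + X]big_nat_cond [X in _ + X]big1 ?addr0// => i.
by rewrite andbT => /andP[si _]; rewrite nth_default// mul0r.
Qed.

Lemma polD p q u x : pol (p + q) u x = pol p u x + pol q u x.
Proof.
pose n := maxn (size p) (size q).
rewrite (polE (n := n) u x (size_polyD _ _)) (polE (n := n) _ _ (leq_maxl _ _)).
rewrite (polE (n := n) _ _ (leq_maxr _ _)) -big_split/=.
by apply: eq_bigr => i _; rewrite coefD mulrDl.
Qed.

Lemma polZ c p u x : pol (c *: p) u x = c * pol p u x.
Proof.
rewrite (polE _ _ (size_scale_leq _ _)) /pol big_distrr/=.
by apply: eq_bigr => i _; rewrite coefZ mulrA.
Qed.

Lemma polC c u x : pol c%:P u x = c * u x.
Proof. by rewrite (polE _ _ (size_polyC_leq1 _)) big_nat1 coefC. Qed.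

Lemma l2_sum n (F : nat -> X -> R) : (forall i, l2 (F i)) ->
  l2 (fun x => \sum_(0 <= i < n) F i x).
Proof.
move=> sF; elim: n => [|n IH].
  rewrite (_ : (fun x => _) = fun=> 0); first exact: l20.
  by apply/funext => x; rewrite big_nil.
rewrite (_ : (fun x => _) = fun x => \sum_(0 <= i < n) F i x + F n x).
  exact: (l2D hX).
by apply/funext => x; rewrite big_nat_recr.
Qed.

Lemma l2_pol q u : l2 u -> l2 (pol q u).
Proof.
by move=> su; apply: l2_sum => i; apply: l2Z; exact: l2_iterB.
Qed.

Lemma opB_sum n (F : nat -> X -> R) x : (forall i, l2 (F i)) ->
  opB (fun x => \sum_(0 <= i < n) F i x) x = \sum_(0 <= i < n) opB (F i) x.
Proof.
move=> sF; elim: n => [|n IH].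
  rewrite big_nil (_ : (fun x => _) = fun x => 0 * F 0%N x); last first.
    by apply/funext => y; rewrite big_nil mul0r.
  by rewrite opBZ// mul0r.
rewrite big_nat_recr//= -IH -opBD//; last exact: l2_sum.
by congr (opB _ x); apply/funext => y; rewrite big_nat_recr.
Qed.

Lemma polXM q u x : l2 u -> pol ('X * q) u x = opB (pol q u) x.
Proof.
move=> su; rewrite (polE (n := (size q).+1)); last first.
  by rewrite (leq_trans (size_polyMleq _ _))// size_polyX.
rewrite big_nat_recl//= coefXM/= mul0r add0r /pol opB_sum; last first.
  by move=> i; apply: l2Z; exact: l2_iterB.
by apply: eq_bigr => i _; rewrite coefXM/= opBZ//; exact: l2_iterB.
Qed.

Lemma polM p q u x : l2 u -> pol (p * q) u x = pol p (pol q u) x.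
Proof.
move=> su; elim/poly_ind: p x => [|p c IH] x.
  by rewrite mul0r -(scale0r 0) !polZ !mul0r.
rewrite mulrDl !polD mul_polyC polZ polC; congr (_ + _).
rewrite -(mulrC 'X) -mulrA !polXM//; last exact: l2_pol.
by congr (opB _ x); apply/funext => y; exact: IH.
Qed.

Lemma pol_sym p u v : l2 u -> l2 v -> ip (pol p u) v = ip u (pol p v).
Proof.
move=> su sv; elim/poly_ind: p u v su sv => [|p c IH] u v su sv.
  have Z w : pol 0 w = fun y => 0 * w y.
    by apply/funext => y; rewrite -(scale0r 0) polZ !mul0r.
  by rewrite !Z (ipZl hX)// [RHS]ipC (ipZl hX)// !mul0r.
have E w : l2 w -> pol (p * 'X + c%:P) w = fun y => opB (pol p w) y + c * w y.
  by move=> sw; apply/funext => y; rewrite polD polC mulrC polXM.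
have sB w : l2 w -> l2 (opB (pol p w)) by move=> sw; apply: l2_opB; exact: l2_pol.
have C w : l2 w -> pol p (opB w) = opB (pol p w).
  move=> sw; apply/funext => y; rewrite -polXM// mulrC polM//.
  congr (pol p _ y); apply/funext => z.
  have := polXM 1 z sw; rewrite mulr1 => ->; congr (opB _ z).
  by apply/funext => t; rewrite -polyC1 polC mul1r.
rewrite !E// (ipDl hX (sB _ su) (l2Z _ su) sv) (ipZl hX _ su sv).
rewrite [RHS]ipC (ipDl hX (sB _ sv) (l2Z _ sv) su) (ipZl hX _ sv su).
rewrite (ipC v u); congr (_ + _).
rewrite opB_sym//; last exact: l2_pol.
by rewrite IH//; [rewrite C// ipC|exact: l2_opB].
Qed.

Definition functional u q : R := ip u (pol q u).

Lemma functionalM u p q : l2 u -> functional u (p * q) = ip (pol p u) (pol q u).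
Proof.
move=> su; rewrite pol_sym//; last exact: l2_pol.
by congr ip; apply/funext => x; exact: polM.
Qed.

Lemma moment_functional u : l2 u -> moment (functional u).
Proof.
move=> su; split.
- move=> p q; rewrite /functional !(ipC u) -(ipDl hX (l2_pol p su) (l2_pol q su) su).
  by congr ip; apply/funext => x; exact: polD.
- move=> c p; rewrite /functional !(ipC u) -(ipZl hX c (l2_pol p su) su).
  by congr ip; apply/funext => x; exact: polZ.
- move=> q; rewrite expr2 mulrCA functionalM//.
  rewrite (_ : pol ('X * q) u = opB (pol q u)); last by apply/funext => x; exact: polXM.
  by have /andP[] := opB_le (l2_pol q su).
- move=> q; rewrite expr2 mulrCA functionalM//.
  have sq := l2_pol q su.
  rewrite (_ : pol ((1 - 'X) * q) u = fun x => pol q u x - opB (pol q u) x); last first.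
    apply/funext => x; rewrite mulrBl mul1r polD -scaleN1r polZ polXM//.
    by rewrite mulN1r.
  rewrite ipC (ipBl hX sq (l2_opB sq) sq) (ipC (opB _)) subr_ge0.
  by have /andP[] := opB_le sq.
Qed.

Lemma functional1 u : l2 u -> functional u 1 = ip u u.
Proof.
by move=> su; rewrite /functional; congr ip; apply/funext => x; rewrite -polyC1 polC mul1r.
Qed.

Lemma pol_zero p v x : (forall x, v x = 0) -> pol p v x = 0.
Proof.
move=> v0; rewrite /pol big1// => i _.
suff -> : iter i (@opB) v = fun=> 0 by rewrite mulr0.
elim: i => [|i IH] /=; first exact/funext.
rewrite IH; apply/funext => y.
have -> : (fun=> 0) = (fun x : X => 0 * (0 : R)) by apply/funext => z; rewrite mul0r.
by rewrite (opBZ 0 y (l20 X)) mul0r.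
Qed.

(** Since [P^2 u = p^2 u] with [p = sqrt (1 - y)], the vectors [P u + p u] and
    [P u - p u] are eigenvectors of [P] or zero, and their difference is
    [2 p u], so one of them is not orthogonal to [v].  If [p = 0], then
    [|P u|^2 = <P^2 u, u> = 0] and [u] itself will do. *)
Lemma eigen_sqrt (y : R) u v : l2 u -> l2 v -> 0 <= y <= 1 ->
  (forall x, opB u x = y * u x) -> ip v u != 0 ->
  exists (p : R) u', [/\ l2 u', forall x, opP u' x = p * u' x, p ^+ 2 <= 1 & ip v u' != 0].
Proof.
move=> su sv /andP[y0 y1] Bu vu; have sP := l2P hX su.
have PP x : opP (opP u) x = (1 - y) * u x.
  by have := Bu x; rewrite /opB => h; lra.
pose p := Num.sqrt (1 - y).
have p2 : p ^+ 2 = 1 - y by rewrite sqr_sqrtr// subr_ge0.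
have p21 : p ^+ 2 <= 1 by rewrite p2; lra.
have [p0|p0] := eqVneq p 0.
  exists 0, u; split=> //; last by rewrite expr0n/= ler01.
  have Pu0 : ip (opP u) (opP u) = 0.
    rewrite (opP_sym hX su sP) ipC.
    rewrite (_ : opP (opP u) = fun x => 0 * u x); last first.
      by apply/funext => x; rewrite PP -p2 p0 expr0n.
    by rewrite (ipZl hX _ su su) mul0r.
  by move=> x; rewrite mul0r; exact: (ip_eq0 hX sP Pu0).
have spu c' : l2 (fun x => c' * u x) by exact: l2Z.
have E e (h : e ^+ 2 = 1 - y) x :
    opP (fun x => opP u x + e * u x) x = e * (opP u x + e * u x).
  by rewrite (opPD hX _ sP (spu _)) (opPZ hX _ _ su) PP -h; ring.
have sE e : l2 (fun x => opP u x + e * u x) by exact: (l2D hX).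
have np2 : (- p) ^+ 2 = 1 - y by rewrite sqrrN.
have [vp|vp] := eqVneq (ip v (fun x => opP u x + p * u x)) 0; last first.
  by exists p, (fun x => opP u x + p * u x); split=> //; exact: E.
have [vm|vm] := eqVneq (ip v (fun x => opP u x + - p * u x)) 0; last first.
  exists (- p), (fun x => opP u x + - p * u x); split=> //; first exact: E.
  by rewrite sqrrN.
exfalso; move: vp vm; rewrite !(ipC v) !(ipDl hX sP (spu _) sv) !(ipZl hX _ su sv) => vp vm.
have : 2 * p * ip u v = 0 by lra.
by apply/eqP; rewrite !mulf_neq0// ?(ipC u)// pnatr_eq0.
Qed.

End OperatorB.

(** * Waves driven by the transition operator *)

Section MomentSum.
Context {R : realType}.

Lemma moment_add (L1 L2 : {poly R} -> R) : moment L1 -> moment L2 ->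
  moment (fun p => L1 p + L2 p).
Proof.
move=> m1 m2; split.
- by move=> p q; rewrite (momentD m1) (momentD m2); ring.
- by move=> c p; rewrite (momentZ m1) (momentZ m2); ring.
- by move=> q; rewrite addr_ge0 ?(momentX m1) ?(momentX m2).
- by move=> q; rewrite addr_ge0 ?(momentB m1) ?(momentB m2).
Qed.

Lemma geo_sub0 K e (t : nat -> R) : geo K t ->
  geo (K + `|e|) (fun k => t k - (if k == 0%N then e else 0)).
Proof.
move=> gt k; apply: le_trans (ler_normB _ _) _; rewrite mulrDl lerD//.
by case: k => [|k]; rewrite ?expr0 ?mulr1//= normr0 mulr_ge0 ?exprn_ge0.
Qed.

Lemma pairing_sub0 K D e (t xi : nat -> R) : geo K t -> bdseq D xi ->
  pairing (fun k => t k - (if k == 0%N then e else 0)) xi = pairing t xi - e * xi 0%N.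
Proof.
move=> gt bx; rewrite (pairingE 1 gt bx) (pairingE 1 (geo_sub0 e gt) bx) !big_nat1 /=.
rewrite (_ : (fun n => t (1 + n)%N - 0) = (fun n => t (1 + n)%N)); first by ring.
by apply/funext => n; rewrite subr0.
Qed.

Lemma pairing_pow0 K (t : nat -> R) : geo K t -> pairing t (powseq 0) = t 0%N.
Proof.
have I0 : 0 <= (0 : R) <= 1 by rewrite lexx ler01.
move=> gt; rewrite (pairingE 1 gt (bd_powseq I0)) big_nat1 /powseq expr0 mulr1.
rewrite [X in _ + X](_ : _ = 0) ?addr0//; apply: cvg_lim => //.
rewrite (_ : series _ = fun=> 0); first exact: cvg_cst.
apply/funext => n; rewrite /series/= big1// => k _.
by rewrite add1n expr0n/= mulr0.
Qed.

Lemma sin1_lt1 : sin 1 < 1 :> R.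
Proof.
have := @cos2Dsin2 R 1; have := sqr_ge0 (1 - sin (1 : R)).
have h : 0 < cos (1 : R) ^+ 2 by rewrite exprn_gt0// cos1_gt0.
move=> _ h2; rewrite ltNge; apply/negP => h3.
have : 1 <= sin (1 : R) ^+ 2 by rewrite -[leLHS](expr1n _ 2) lerXn2r ?nnegrE// (le_trans ler01).
lra.
Qed.

End MomentSum.

(** The [l^2]-valued function [H = H1 + i H2] on [[0,1]] satisfies
    [H' t = alpha (H (1 - t) + P (H t))] weakly, with [alpha = a + i b] and
    [H 0 = 0].  The functions [h1 u] and [h2 u] are the coefficients [<H1 t, u>]
    and [<H2 t, u>]; they are given separately since their two-sided derivatives
    at 0 and 1 require an extension beyond [[0,1]]. *)
Section Wave.
Context {R : realType} (X : wgraph R).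
Hypothesis hX : is_network X.
Variables (a b C : R) (H1 H2 : R -> X -> R) (h1 h2 : (X -> R) -> R -> R).
Hypothesis ab0 : (a != 0) || (b != 0).
Hypothesis sH1 : forall t : R, 0 <= t <= 1 -> l2 (H1 t).
Hypothesis sH2 : forall t : R, 0 <= t <= 1 -> l2 (H2 t).
Hypothesis H1C : forall t : R, 0 <= t <= 1 -> ip (H1 t) (H1 t) <= C.
Hypothesis H2C : forall t : R, 0 <= t <= 1 -> ip (H2 t) (H2 t) <= C.
Hypothesis H10 : forall x, H1 0 x = 0.
Hypothesis H20 : forall x, H2 0 x = 0.
Hypothesis h1E : forall u (t : R), l2 u -> 0 <= t <= 1 -> h1 u t = ip (H1 t) u.
Hypothesis h2E : forall u (t : R), l2 u -> 0 <= t <= 1 -> h2 u t = ip (H2 t) u.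
Let g1 u t := h1 u (1 - t) + h1 (opP u) t.
Let g2 u t := h2 u (1 - t) + h2 (opP u) t.
Hypothesis d1 : forall u, l2 u -> hasD (h1 u) (fun t => a * g1 u t - b * g2 u t).
Hypothesis d2 : forall u, l2 u -> hasD (h2 u) (fun t => b * g1 u t + a * g2 u t).

Let I0 : 0 <= (0 : R) <= 1. Proof. by rewrite lexx ler01. Qed.
Let I1 : 0 <= (1 : R) <= 1. Proof. by rewrite lexx ler01. Qed.

(** Real and imaginary part of the initial velocity [H' 0 = alpha (H 1)]. *)
Definition init1 : X -> R := fun x => a * H1 1 x - b * H2 1 x.
Definition init2 : X -> R := fun x => b * H1 1 x + a * H2 1 x.

Lemma l2_init1 : l2 init1.
Proof. by apply: (l2B hX); apply: l2Z; [exact: sH1|exact: sH2]. Qed.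

Lemma l2_init2 : l2 init2.
Proof. by apply: (l2D hX); apply: l2Z; [exact: sH1|exact: sH2]. Qed.

Let v1 := init1.
Let v2 := init2.
Let sv1 : l2 v1 := l2_init1.
Let sv2 : l2 v2 := l2_init2.

Lemma h10 u : l2 u -> h1 u 0 = 0.
Proof.
move=> su; rewrite h1E//; apply: etrans (@tsum0 R X).
by apply: eq_tsum => x; rewrite H10 mul0r mulr0.
Qed.

Lemma h20 u : l2 u -> h2 u 0 = 0.
Proof.
move=> su; rewrite h2E//; apply: etrans (@tsum0 R X).
by apply: eq_tsum => x; rewrite H20 mul0r mulr0.
Qed.

Lemma hZ c u (t : R) : l2 u -> 0 <= t <= 1 ->
  h1 (fun x => c * u x) t = c * h1 u t /\ h2 (fun x => c * u x) t = c * h2 u t.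
Proof.
move=> su t01; have scu := l2Z c su.
rewrite !h1E// !h2E// !(ipC _ (fun x => c * u x)).
by rewrite (ipZl hX _ su (sH1 t01)) (ipZl hX _ su (sH2 t01)) !(ipC u).
Qed.

Lemma h_opB u (t : R) : l2 u -> 0 <= t <= 1 ->
  h1 (opB u) t = h1 u t - h1 (opP (opP u)) t /\
  h2 (opB u) t = h2 u t - h2 (opP (opP u)) t.
Proof.
move=> su t01; have sP := l2P hX (l2P hX su); have sB := l2_opB hX su.
rewrite !h1E// !h2E// !(ipC _ (opB u)).
by rewrite (ipBl hX su sP (sH1 t01)) (ipBl hX su sP (sH2 t01)) !(ipC u) !(ipC (opP _)).
Qed.

Let D1 u t := a * g1 u t - b * g2 u t.
Let D2 u t := b * g1 u t + a * g2 u t.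

Lemma D_init u : l2 u -> D1 u 0 = ip v1 u /\ D2 u 0 = ip v2 u.
Proof.
move=> su; have sP := l2P hX su; have [s1 s2] := (sH1 I1, sH2 I1).
rewrite /D1 /D2 /g1 /g2 subr0 !h10// !h20// !addr0 h1E// h2E//; split.
- by rewrite /v1 /init1 (ipBl hX (l2Z a s1) (l2Z b s2) su) !(ipZl hX).
- by rewrite /v2 /init2 (ipDl hX (l2Z b s1) (l2Z a s2) su) !(ipZl hX).
Qed.

Let b1 := b ^+ 2 - a ^+ 2.
Let b2 := - (2 * a * b).

Lemma second_deriv u : l2 u ->
  hasD (D1 u) (fun t => b1 * h1 (opB u) t - b2 * h2 (opB u) t) /\
  hasD (D2 u) (fun t => b2 * h1 (opB u) t + b1 * h2 (opB u) t).
Proof.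
move=> su; have sP := l2P hX su.
have dg1 := hasDD (hasD_rev (d1 su)) (d1 sP).
have dg2 := hasDD (hasD_rev (d2 su)) (d2 sP).
have E (t : R) : 0 <= t <= 1 -> g1 u (1 - t) - g1 (opP u) t = h1 (opB u) t /\
    g2 u (1 - t) - g2 (opP u) t = h2 (opB u) t.
  move=> t01; have [-> ->] := h_opB su t01.
  by rewrite /g1 /g2 subKr; split; ring.
split.
  apply: hasD_ext (hasDB (hasDZ a dg1) (hasDZ b dg2)) _ => t t01.
  by have [<- <-] := E t t01; rewrite /b1 /b2; ring.
apply: hasD_ext (hasDD (hasDZ b dg1) (hasDZ a dg2)) _ => t t01.
by have [<- <-] := E t t01; rewrite /b1 /b2; ring.
Qed.

Section ComplexTest.
Variables u1 u2 : X -> R.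
Hypothesis su1 : l2 u1.
Hypothesis su2 : l2 u2.
Hypothesis sym : forall n, ip v2 (iter n (@opB R X) u1) = ip v1 (iter n (@opB R X) u2).

Let it n u := iter n (@opB R X) u.
Let sit1 n : l2 (it n u1) := l2_iterB hX n su1.
Let sit2 n : l2 (it n u2) := l2_iterB hX n su2.

(** The pairing of [H t] with [B^n (u1 + i u2)].  By [sym] its initial velocity is
    real, which is what the Taylor expansion above assumes. *)
Let G1 n t := h1 (it n u1) t + h2 (it n u2) t.
Let G2 n t := h2 (it n u1) t - h1 (it n u2) t.
Let E1 n t := D1 (it n u1) t + D2 (it n u2) t.
Let E2 n t := D2 (it n u1) t - D1 (it n u2) t.
Definition test_moment n := ip v1 (it n u1) + ip v2 (it n u2).

Let K := C + C + (ip u1 u1 + ip u2 u2).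

Lemma ip_iterB u n : l2 u -> ip (it n u) (it n u) <= ip u u.
Proof.
move=> su; elim: n => // n IH; apply: le_trans IH; rewrite /it /= -/(it n u).
have sn : l2 (it n u) by exact: l2_iterB.
have sPn := l2P hX sn; have sPPn := l2P hX sPn.
have e1 : ip (it n u) (opB (it n u)) = ip (it n u) (it n u) - ip (opP (it n u)) (opP (it n u)).
  by rewrite ipC (ipBl hX sn sPPn sn) (opP_sym hX sPn sn).
have e2 : ip (opP (opP (it n u))) (opB (it n u)) =
    ip (opP (it n u)) (opP (it n u)) - ip (opP (opP (it n u))) (opP (opP (it n u))).
  by rewrite ipC (ipBl hX sn sPPn sPPn) -(opP_sym hX sn sPn).
have -> : ip (opB (it n u)) (opB (it n u)) =
    ip (it n u) (opB (it n u)) - ip (opP (opP (it n u))) (opB (it n u)).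
  by rewrite -(ipBl hX sn sPPn (l2_opB hX sn)).
have := ip_ge0 hX (opP (opP (it n u))); have := opP_contr hX sPn.
have := ip_ge0 hX (opP (it n u)); rewrite e1 e2; lra.
Qed.

Lemma G_bound n (t : R) : 0 <= t <= 1 -> `|G1 n t| <= K /\ `|G2 n t| <= K.
Proof.
move=> t01; rewrite /G1 /G2 !h1E// !h2E//.
have := ip_bound hX (sH1 t01) (sit1 n); have := ip_bound hX (sH2 t01) (sit1 n).
have := ip_bound hX (sH1 t01) (sit2 n); have := ip_bound hX (sH2 t01) (sit2 n).
have := ip_iterB n su1; have := ip_iterB n su2.
have := H1C t01; have := H2C t01; rewrite /K => ? ? ? ? ? ? ? ?; split.
  by apply: le_trans (ler_normD _ _) _; lra.
by apply: le_trans (ler_normB _ _) _; lra.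
Qed.

Lemma test_taylor :
  (pairing (tcoef (fun k => (cpow b1 b2 k).1)) test_moment =
     h1 u1 1 + h2 u2 1 /\
   pairing (tcoef (fun k => (cpow b1 b2 k).2)) test_moment =
     h2 u1 1 - h1 u2 1) /\
  ((forall n, test_moment n = 0) -> forall t : R, 0 <= t <= 1 ->
     h1 u1 t + h2 u2 t = 0 /\ h2 u1 t - h1 u2 t = 0).
Proof.
have hG1 n : hasD (G1 n) (E1 n) by apply: hasDD; [exact: d1|exact: d2].
have hG2 n : hasD (G2 n) (E2 n) by apply: hasDB; [exact: d2|exact: d1].
have hE1 n : hasD (E1 n) (fun t => b1 * G1 n.+1 t - b2 * G2 n.+1 t).
  have [e1 _] := second_deriv (sit1 n); have [_ e2] := second_deriv (sit2 n).
  by apply: hasD_ext (hasDD e1 e2) _ => t _; rewrite /G1 /G2 /it /=; ring.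
have hE2 n : hasD (E2 n) (fun t => b2 * G1 n.+1 t + b1 * G2 n.+1 t).
  have [_ e1] := second_deriv (sit1 n); have [e2 _] := second_deriv (sit2 n).
  by apply: hasD_ext (hasDB e1 e2) _ => t _; rewrite /G1 /G2 /it /=; ring.
have G10 n : G1 n 0 = 0 by rewrite /G1 h10// h20// addr0.
have G20 n : G2 n 0 = 0 by rewrite /G2 h10// h20// subr0.
have E10 n : E1 n 0 = test_moment n.
  by have [e1 _] := D_init (sit1 n); have [_ e2] := D_init (sit2 n); rewrite /E1 e1 e2.
have E20 n : E2 n 0 = 0.
  have [_ e1] := D_init (sit1 n); have [e2 _] := D_init (sit2 n).
  by rewrite /E2 e1 e2 /it sym subrr.
have B1 n (t : R) : 0 <= t <= 1 -> `|G1 n t| <= K by move=> /(G_bound n)[].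
have B2 n (t : R) : 0 <= t <= 1 -> `|G2 n t| <= K by move=> /(G_bound n)[].
split; first exact: (taylor_value hG1 hG2 hE1 hE2 G10 G20 E10 E20 B1 B2).
by move=> l0 t; exact: (taylor_zero hG1 hG2 hE1 hE2 G10 G20 E10 E20 B1 B2 l0 0).
Qed.

End ComplexTest.

Let L p := functional v1 p + functional v2 p.

Let mL : moment L.
Proof. by apply: moment_add; exact: moment_functional. Qed.

(** All moments vanish together with the initial velocity, so the Taylor series
    is zero against every test vector. *)
Lemma wave_zero : (forall x, v1 x = 0) -> (forall x, v2 x = 0) ->
  forall (t : R) x, 0 <= t <= 1 -> H1 t x = 0 /\ H2 t x = 0.
Proof.
move=> v10 v20 t x t01.
have Z (v u : X -> R) : (forall x, v x = 0) -> ip v u = 0.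
  move=> v0; apply: etrans (@tsum0 R X).
  by apply: eq_tsum => y; rewrite v0 mul0r mulr0.
have z u : l2 u -> ip (H1 t) u = 0 /\ ip (H2 t) u = 0.
  move=> su; have [|_] := @test_taylor u (fun=> 0) su (l20 X).
    by move=> n; rewrite !Z.
  move=> /(_ _ t t01)[|]; first by move=> n; rewrite /test_moment !Z// addr0.
  have z0 (f : X -> R) : ip f (fun=> 0) = 0 by rewrite ipC Z.
  by rewrite !h1E// ?h2E//; try exact: (l20 X); rewrite !z0 addr0 subr0.
split.
- by apply: (ip_eq0 hX (sH1 t01)); have [] := z _ (sH1 t01).
- by apply: (ip_eq0 hX (sH2 t01)); have [] := z _ (sH2 t01).
Qed.

Variables (c d : R).
Hypothesis cd1 : c * a - d * b = 1.
Hypothesis cd2 : c * b + d * a = 0.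

(** With [c + i d] the inverse of [alpha], that is, the eigenvalue: the equation
    at [t = 0] says that [H 1 = (c + i d) (H' 0)]. *)
Lemma final_init x : H1 1 x = c * v1 x - d * v2 x /\ H2 1 x = d * v1 x + c * v2 x.
Proof.
set p := H1 1 x; set q := H2 1 x.
have -> : c * v1 x - d * v2 x = (c * a - d * b) * p - (c * b + d * a) * q.
  by rewrite /v1 /v2 /init1 /init2 -/p -/q; ring.
have -> : d * v1 x + c * v2 x = (c * b + d * a) * p + (c * a - d * b) * q.
  by rewrite /v1 /v2 /init1 /init2 -/p -/q; ring.
by rewrite cd1 cd2; split; ring.
Qed.

Lemma iter_pol n p u : l2 u -> iter n (@opB R X) (pol p u) = pol ('X^n * p) u.
Proof.
move=> su; elim: n => [|n IH] /=; first by rewrite expr0 mul1r.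
by rewrite IH; apply/funext => x; rewrite exprS -mulrA polXM.
Qed.

(** The Taylor series at [t = 1], tested against [p(B)] applied to the initial
    velocity, computes the pairing with [H 1], which is itself a multiple of the
    initial velocity. *)
Lemma wave_annihilates p :
  pairing (tcoef (fun k => (cpow b1 b2 k).1)) (fun n => L ('X^n * p)) = c * L p /\
  pairing (tcoef (fun k => (cpow b1 b2 k).2)) (fun n => L ('X^n * p)) = d * L p.
Proof.
have su1 := l2_pol hX p sv1; have su2 := l2_pol hX p sv2.
have sym n : ip v2 (iter n (@opB R X) (pol p v1)) = ip v1 (iter n (@opB R X) (pol p v2)).
  by rewrite !iter_pol// -(pol_sym hX _ sv2 sv1) ipC.
have [[e1 e2] _] := test_taylor su1 su2 sym.
have mE : test_moment (pol p v1) (pol p v2) = fun n => L ('X^n * p).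
  by apply/funext => n; rewrite /test_moment !iter_pol.
rewrite -mE e1 e2 !h1E// !h2E//.
have [s1 s2] := (sH1 I1, sH2 I1).
have F u : l2 u -> ip (H1 1) u = c * ip v1 u - d * ip v2 u /\
    ip (H2 1) u = d * ip v1 u + c * ip v2 u.
  move=> su; split.
    rewrite -(ipZl hX c sv1 su) -(ipZl hX d sv2 su) -(ipBl hX (l2Z c sv1) (l2Z d sv2) su).
    by congr ip; apply/funext => x; have [] := final_init x.
  rewrite -(ipZl hX d sv1 su) -(ipZl hX c sv2 su) -(ipDl hX (l2Z d sv1) (l2Z c sv2) su).
  by congr ip; apply/funext => x; have [] := final_init x.
have [-> ->] := F _ su1; have [-> ->] := F _ su2.
have := sym 0%N; rewrite /= /L /functional => ->.
by split; ring.
Qed.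

(** Coefficients of [sin (alpha sqrt x) / (alpha sqrt x) - (c + i d)], real and
    imaginary part. *)
Let f1 k := tcoef (fun k => (cpow b1 b2 k).1) k - (if k == 0%N then c else 0).
Let f2 k := tcoef (fun k => (cpow b1 b2 k).2) k - (if k == 0%N then d else 0).

Lemma geo_f : (exists K, geo K f1) /\ (exists K, geo K f2).
Proof.
have b0 : 0 <= `|b1| + `|b2| by rewrite addr_ge0.
have [K1 g1'] := geo_tcoef b0 (fun k => (cpow_le b1 b2 k).1).
have [K2 g2'] := geo_tcoef b0 (fun k => (cpow_le b1 b2 k).2).
by split; eexists; [exact: (geo_sub0 c g1')|exact: (geo_sub0 d g2')].
Qed.

(** The value at 0 is [1 - (c + i d)].  If this vanishes, then [alpha = 1] and the
    value at 1 is [sin 1 - 1]. *)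
Lemma f_nonzero : exists2 x0 : R, 0 <= x0 <= 1 &
  pairing f1 (powseq x0) != 0 \/ pairing f2 (powseq x0) != 0.
Proof.
have [[K1 g1'] [K2 g2']] := geo_f.
have [c1|c1] := eqVneq c 1; last first.
  exists 0 => //; left; rewrite (pairing_pow0 g1') /f1 /tcoef /= (_ : 1`! = 1)%N// divr1.
  by rewrite subr_eq0 eq_sym.
have [d0|d0] := eqVneq d 0; last first.
  exists 0 => //; right; rewrite (pairing_pow0 g2') /f2 /tcoef /= mul0r sub0r.
  by rewrite oppr_eq0.
have a1 : a = 1 by move: cd1; rewrite c1 d0; lra.
have b0 : b = 0 by move: cd2; rewrite c1 d0; lra.
have bE : b1 = -1 /\ b2 = 0 by rewrite /b1 /b2 a1 b0; split; ring.
exists 1 => //; left.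
have bb : 0 <= `|b1| + `|b2| by rewrite addr_ge0.
have [K gK] := geo_tcoef bb (fun k => (cpow_le b1 b2 k).1).
rewrite (pairing_sub0 c gK (bd_powseq I1)) /powseq expr0 mulr1 c1.
have cp k : cpow b1 b2 k = ((-1) ^+ k, 0).
  elim: k => //= k ->; have [-> ->] := bE; rewrite /= exprS; congr (_, _); ring.
rewrite (_ : pairing _ _ = sin 1); first by rewrite lt_eqF// subr_lt0 sin1_lt1.
have sn : limn (series (sin_coeff' (1 : R))) = sin 1.
  by apply: cvg_lim => //; exact: cvg_sin_coeff'.
rewrite -sn; congr (limn (series _)).
by apply/funext => k; rewrite /tcoef cp /= !expr1n !mulr1 /sin_coeff'/= expr1n mulr1.
Qed.

Lemma wave_root : L 1 != 0 -> exists y : R, exists r,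
  [/\ 0 <= y <= 1, L (('X - y%:P) ^+ 2 * r ^+ 2) = 0 & L (r ^+ 2) != 0].
Proof.
move=> L1; have L1' : 0 < L 1.
  by rewrite lt_neqAle eq_sym L1 -(expr1n _ 2) moment_sqr.
have [[K1 g1'] [K2 g2']] := geo_f.
have bb : 0 <= `|b1| + `|b2| by rewrite addr_ge0.
have [J1 j1] := geo_tcoef bb (fun k => (cpow_le b1 b2 k).1).
have [J2 j2] := geo_tcoef bb (fun k => (cpow_le b1 b2 k).2).
have [x0 x01 [n0|n0]] := f_nonzero.
  apply: (annihilator_root mL g1' L1' x01 _ n0) => u.
  have [D hD] := moment_bounded u mL.
  by rewrite (pairing_sub0 c j1 hD) (wave_annihilates u).1 expr0 mul1r subrr.
apply: (annihilator_root mL g2' L1' x01 _ n0) => u.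
have [D hD] := moment_bounded u mL.
by rewrite (pairing_sub0 d j2 hD) (wave_annihilates u).2 expr0 mul1r subrr.
Qed.

Hypothesis nz : exists2 t : R, 0 <= t <= 1 & exists x, (H1 t x != 0) || (H2 t x != 0).

Lemma wave_L1 : L 1 != 0.
Proof.
apply/eqP; rewrite /L !functional1// => h.
have e1 := ip_ge0 hX v1; have e2 := ip_ge0 hX v2.
have z1 : ip v1 v1 = 0 by lra.
have z2 : ip v2 v2 = 0 by lra.
have [t t01 [x]] := nz.
by have [-> ->] := wave_zero (ip_eq0 hX sv1 z1) (ip_eq0 hX sv2 z2) x t01; rewrite eqxx.
Qed.

(** If [L] kills [(X - y)^2 r^2], then [(B - y) r(B)] kills the initial velocity
    [v], so [r(B)^2 v] is an eigenvector of [B].  It is not orthogonal to [v] as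
    [<r(B)^2 v, v> = L (r^2)]. *)
Lemma wave_eigen : exists (p : R) (u : X -> R),
  [/\ l2 u, exists x, u x != 0, forall x, opP u x = p * u x, b = 0 &
    (a = 1 /\ p = 1) \/ exists w, [/\ w != 0, cos w = p & a * sin w = w]].
Proof.
have [y [r [y01 yr r0]]] := wave_root wave_L1.
pose q : {poly R} := ('X - y%:P) * r.
have qv (v : X -> R) : l2 v -> functional v (('X - y%:P) ^+ 2 * r ^+ 2) = ip (pol q v) (pol q v).
  by move=> sv; rewrite -exprMn expr2; exact: (functionalM hX _ _ sv).
have q0 : ip (pol q v1) (pol q v1) + ip (pol q v2) (pol q v2) = 0.
  by rewrite -!qv.
have n1 := ip_ge0 hX (pol q v1); have n2 := ip_ge0 hX (pol q v2).
have q1 : forall x, pol q v1 x = 0 by apply: (ip_eq0 hX (l2_pol hX q sv1)); lra.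
have q2 : forall x, pol q v2 x = 0 by apply: (ip_eq0 hX (l2_pol hX q sv2)); lra.
have eig (v : X -> R) : l2 v -> (forall x, pol q v x = 0) -> functional v (r ^+ 2) != 0 ->
    exists (p : R) u', [/\ l2 u', forall x, opP u' x = p * u' x, p ^+ 2 <= 1 & ip v u' != 0].
  move=> sv qv0 rv; have su := l2_pol hX (r * r) sv.
  apply: (@eigen_sqrt _ _ hX y (pol (r * r) v)) => //.
  move=> x; apply/eqP; rewrite -subr_eq0; apply/eqP.
  rewrite -polXM// -polZ -mulN1r -polZ -polD.
  have -> : 'X * (r * r) + -1 *: (y *: (r * r)) = r * q.
    by rewrite /q -!mul_polyC polyCN polyC1; ring.
  by rewrite polM// pol_zero.
have [p [u [su Pu p1 vu]]] : exists (p : R) u, [/\ l2 u, forall x, opP u x = p * u x,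
    p ^+ 2 <= 1 & (ip v1 u != 0) || (ip v2 u != 0)].
  have [e1|e1] := eqVneq (functional v1 (r ^+ 2)) 0.
    have e2 : functional v2 (r ^+ 2) != 0 by move: r0; rewrite /L e1 add0r.
    have [p [u [? ? ? vu]]] := eig v2 sv2 q2 e2.
    by exists p, u; split=> //; rewrite vu orbT.
  have [p [u [? ? ? vu]]] := eig v1 sv1 q1 e1.
  by exists p, u; split=> //; rewrite vu.
exists p, u.
have PE : opP u = fun x => p * u x by exact/funext.
have k1 : hasD (h1 u) (fun t => a * (h1 u (1 - t) + p * h1 u t) -
                              b * (h2 u (1 - t) + p * h2 u t)).
  apply: hasD_ext (d1 su) _ => t t01; rewrite /g1 /g2 PE.
  by have [-> ->] := hZ p su t01.
have k2 : hasD (h2 u) (fun t => b * (h1 u (1 - t) + p * h1 u t) +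
                              a * (h2 u (1 - t) + p * h2 u t)).
  apply: hasD_ext (d2 su) _ => t t01; rewrite /g1 /g2 PE.
  by have [-> ->] := hZ p su t01.
have hn0 : exists2 t : R, 0 <= t <= 1 & (h1 u t != 0) || (h2 u t != 0).
  exists 1 => //; apply: contraT; rewrite negb_or !negbK => /andP[/eqP z1 /eqP z2].
  move: vu; have [<- <-] := D_init su; rewrite /D1 /D2 /g1 /g2 subr0 z1 z2.
  have sP := l2P hX su.
  by rewrite !h10// !h20// !(addr0, mulr0, subrr) eqxx.
have [b0 cas] := scalar_eigen k1 k2 (h10 su) (h20 su) hn0 p1 ab0.
split=> //; apply: contrapT => nu.
move: vu; have u0 x : u x = 0.
  by apply/eqP; apply: contraT => ux; exfalso; apply: nu; exists x.
have Z (v : X -> R) : ip v u = 0.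
  by apply: etrans (@tsum0 R X); apply: eq_tsum => x; rewrite u0 !mulr0.
by rewrite !Z eqxx.
Qed.

End Wave.

(** * Primitives of square integrable functions *)

Section Integrals.
Context {R : realType}.
Notation mu := (@lebesgue_measure R).
Implicit Types (f g : R -> R) (t : R).

Lemma continuous_clamp f : {within `[0, 1], continuous f} ->
  continuous (fun t => f (clamp t)).
Proof.
move=> /subspace_continuousP cf t.
have c01 : `[0, 1]%classic (clamp t) by rewrite /= in_itv/=; exact: clamp01.
apply: (cvg_comp clamp f _ (cf _ c01)) => A [e /= e0 hA].
exists e => //= s st; apply: hA.
  by apply: le_lt_trans (clamp_lip _ _) st.
by rewrite /= in_itv/=; exact: clamp01.
Qed.

Lemma continuous_integrable f (s t : R) : continuous f ->
  mu.-integrable `[s, t] (EFin \o f).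
Proof.
move=> cf; apply: continuous_compact_integrable; first exact: segment_compact.
exact: continuous_subspaceT.
Qed.

(** Starting the integral at -1 makes the derivatives at 0 and 1 two-sided. *)
Definition antid g t : R := Rintegral mu `[-1, t] g - Rintegral mu `[-1, 0] g.

Lemma antid0 g : antid g 0 = 0.
Proof. by rewrite /antid subrr. Qed.

Lemma is_derive_antid g t : continuous g -> -1 < t < 2 -> is_derive t 1 (antid g) (g t).
Proof.
move=> cg /andP[tm t2].
have [df dE] := continuous_FTC1_closed t2 (continuous_integrable (-1) 2 cg) tm (cg t).
have h : is_derive t 1 (fun x => Rintegral mu `[-1, x] g) (g t).
  by apply: DeriveDef => //; rewrite -derive1E dE.
by rewrite /antid; apply: is_derive_eq; rewrite subr0.
Qed.

Lemma hasD_antid g : continuous g -> hasD (antid g) g.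
Proof.
move=> cg t /andP[t0 t1]; apply: is_derive_antid => //.
by apply/andP; split; lra.
Qed.

Lemma Rintegral_FTC g G : continuous g -> hasD G g -> G 0 = 0 ->
  forall t, 0 <= t <= 1 -> Rintegral mu `[0, t] g = G t.
Proof.
move=> cg dG G0 t /andP[]; rewrite le_eqVlt => /predU1P[<-|t0] t1.
  by rewrite set_itv1 Rintegral_set1 G0.
rewrite /Rintegral (@continuous_FTC2 _ g G 0 t t0).
- by rewrite G0 sube0.
- exact: continuous_subspaceT.
- have cG := hasD_within dG (lexx 0) t1; move: cG => /(continuous_within_itvP _ t0)[_ cl cr].
  split=> // x; rewrite in_itv/= => /andP[x0 xt]; apply: ex_derive.
  by apply: dG; rewrite ltW//= ltW// (lt_le_trans xt).
- move=> x; rewrite in_itv/= => /andP[x0 xt]; rewrite derive1E.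
  by apply: derive_val; apply: dG; rewrite ltW//= ltW// (lt_le_trans xt).
Qed.

Section SquareIntegrable.
Variable f : R -> R.
Hypothesis mf : measurable_fun (`[0, 1]%classic : set R) f.
Hypothesis f2 : (\int[mu]_(t in `[0%R, 1%R]) (f t ^+ 2)%:E < +oo)%E.

Let m01 := measurable_itv `[(0 : R), 1].

Lemma integrable_sqr : mu.-integrable `[0, 1] (EFin \o (fun t => f t ^+ 2)).
Proof.
apply/integrableP; split; first by apply/measurable_EFinP; exact: measurable_funX.
apply: le_lt_trans f2; apply: ge0_le_integral => //.
- apply: measurableT_comp => //; apply/measurable_EFinP; exact: measurable_funX.
- by apply/measurable_EFinP; exact: measurable_funX.
- by move=> x _; rewrite /= ger0_norm ?sqr_ge0.
Qed.

Lemma integrable_cst (c : R) (s t : R) : mu.-integrable `[s, t] (EFin \o cst c).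
Proof. by apply: continuous_integrable; exact: cst_continuous. Qed.

Lemma integrable_L2 : mu.-integrable `[0, 1] (EFin \o f).
Proof.
have h : mu.-integrable `[0, 1] (EFin \o (fun t => 1 + f t ^+ 2)).
  by apply: (@integrableD _ _ _ mu _ _ (EFin \o cst 1) (EFin \o (fun t => f t ^+ 2))) => //;
    [exact: integrable_cst|exact: integrable_sqr].
apply: le_integrable h => //; first exact/measurable_EFinP.
move=> x _ /=; rewrite lee_fin [leRHS]ger0_norm ?addr_ge0 ?sqr_ge0//.
have : 0 <= (`|f x| - 1) ^+ 2 by exact: sqr_ge0.
have := normr_ge0 (f x).
by rewrite -(real_normK (x := f x)) ?num_real// sqrrB1; lra.
Qed.

Definition L1norm : R := Rintegral mu `[0, 1] (fun t => `|f t|).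

Lemma integrable_sub t : t <= 1 -> mu.-integrable `[0, t] (EFin \o f).
Proof.
move=> t1; apply: integrableS integrable_L2 => //.
by apply: subset_itvl; rewrite bnd_simp.
Qed.

Lemma L1norm_ge0 : 0 <= L1norm.
Proof. by apply: Rintegral_ge0 => x _. Qed.

Lemma integrable_norm : mu.-integrable `[0, 1] (EFin \o (fun t => `|f t|)).
Proof. exact: (integrable_norm integrable_L2). Qed.

Lemma prim_le t : 0 <= t <= 1 -> `|Rintegral mu `[0, t] f| <= L1norm.
Proof.
move=> /andP[t0 t1].
have it : mu.-integrable `[0, t] (EFin \o (fun t => `|f t|)).
  apply: integrableS integrable_norm => //.
  by apply: subset_itvl; rewrite bnd_simp.
apply: le_trans (le_normr_Rintegral _ (integrable_sub t1)) _ => //.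
rewrite /L1norm /Rintegral fine_le//.
- exact: integrable_fin_num it.
- exact: integrable_fin_num integrable_norm.
apply: ge0_subset_integral => //.
- by have /integrableP[] := integrable_norm.
- by apply: subset_itvl; rewrite bnd_simp.
Qed.

(** Integrate [2 A |f| <= f^2 + A^2] with [A] the integral of [|f|]. *)
Lemma L1norm_sqr : L1norm ^+ 2 <= Rintegral mu `[0, 1] (fun t => f t ^+ 2).
Proof.
set A := L1norm; set Q := Rintegral _ _ _.
have iA : mu.-integrable `[0, 1] (EFin \o (fun t => (2 * A) * `|f t|)).
  by apply: (@integrableZl _ _ _ mu _ _ (2 * A) (EFin \o (fun t => `|f t|))) => //;
    exact: integrable_norm.
have iQ : mu.-integrable `[0, 1] (EFin \o (fun t => f t ^+ 2 + A ^+ 2)).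
  by apply: (@integrableD _ _ _ mu _ _ (EFin \o (fun t => f t ^+ 2)) (EFin \o cst (A ^+ 2))) => //;
    [exact: integrable_sqr|exact: integrable_cst].
have : Rintegral mu `[0, 1] (fun t => (2 * A) * `|f t|) <=
       Rintegral mu `[0, 1] (fun t => f t ^+ 2 + A ^+ 2).
  apply: le_Rintegral => // t _.
  have : 0 <= `|f t| ^+ 2 - 2 * A * `|f t| + A ^+ 2.
    by rewrite (_ : _ + _ = (`|f t| - A) ^+ 2) ?sqr_ge0//; ring.
  by rewrite real_normK ?num_real//; lra.
rewrite RintegralZl//; last exact: integrable_norm.
rewrite RintegralD//; [|exact: integrable_sqr|exact: integrable_cst].
have c1 : Rintegral mu `[0, 1] (fun=> A ^+ 2) = A ^+ 2.
  rewrite (@Rintegral_FTC (fun=> A ^+ 2) (fun t => A ^+ 2 * t)) ?mulr1 ?mulr0 ?lexx ?ler01//.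
    exact: cst_continuous.
  by move=> t _; apply: is_derive_eq; rewrite /GRing.scale/=; ring.
rewrite c1 -/L1norm -/Q -/A.
by rewrite expr2; lra.
Qed.

Lemma prim_continuous : {within `[0, 1], continuous (fun t => Rintegral mu `[0, t] f)}.
Proof. exact: parameterized_integral_continuous ler01 integrable_L2. Qed.

Lemma prim_ae g t : continuous g ->
  {ae mu, forall t, t \in `]0%R, 1%R[ -> f t = g t} -> 0 <= t <= 1 ->
  Rintegral mu `[0, t] f = Rintegral mu `[0, t] g.
Proof.
move=> cg ae /andP[t0 t1].
have ig := continuous_integrable 0 t cg.
have i1 : mu.-integrable `]0, t] (EFin \o f).
  by apply: integrableS (integrable_sub t1) => //; exact: subset_itv_oc_cc.
have i2 : mu.-integrable `]0, t[ (EFin \o f).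
  by apply: integrableS i1 => //; exact: subset_itv_oo_oc.
have j1 : mu.-integrable `]0, t] (EFin \o g).
  by apply: integrableS ig => //; exact: subset_itv_oc_cc.
have j2 : mu.-integrable `]0, t[ (EFin \o g).
  by apply: integrableS j1 => //; exact: subset_itv_oo_oc.
rewrite -(Rintegral_itv_obnd_cbnd i1) -(Rintegral_itv_bndo_bndc i2).
rewrite -(Rintegral_itv_obnd_cbnd j1) -(Rintegral_itv_bndo_bndc j2).
rewrite /Rintegral; congr fine; apply: ae_eq_integral => //.
- by have /integrableP[] := i2.
- by have /integrableP[] := j2.
move: ae; apply: filterS; first exact: (ae_filter_ringOfSetsType mu).
move=> x; rewrite /= !in_itv/= => h /andP[x0 xt].
by congr _%:E; apply: h; rewrite x0 (lt_le_trans xt).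
Qed.

End SquareIntegrable.
End Integrals.

(** * Averages over the edges at a vertex *)

Section Antiderivative.
Context {R : realType}.
Notation mu := (@lebesgue_measure R).
Variables (g : R -> R) (M : R).
Hypothesis cg : continuous g.
Hypothesis gM : forall t, `|g t| <= M.

Lemma antid_lip (s t : R) : -1 < s < 2 -> -1 < t < 2 ->
  `|antid g s - antid g t| <= M * `|s - t|.
Proof.
have P (u v : R) : u <= v -> -1 < u -> v < 2 -> `|antid g v - antid g u| <= M * `|v - u|.
  move=> uv um v2.
  have d (x : R) : u <= x <= v -> is_derive x 1 (antid g) (g x).
    by move=> /andP[ux xv]; apply: is_derive_antid => //; rewrite (lt_le_trans um ux) (le_lt_trans xv v2).
  have [||c _ ->] := @MVT_segment _ (antid g) g u v uv.
  - by move=> x; rewrite in_itv/= => /andP[/ltW ux /ltW xv]; apply: d; rewrite ux.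
  - apply: derivable_within_continuous => x; rewrite in_itv/= => xI.
    by apply: ex_derive; exact: d.
  by rewrite normrM ler_wpM2r.
move=> /andP[s1 s2] /andP[t1 t2]; have /orP[st|ts] := le_total s t; last exact: P.
by rewrite (distrC s) (distrC (antid g s)); exact: P.
Qed.

Lemma antid_le (t : R) : -1 < t < 2 -> `|antid g t| <= 2 * M.
Proof.
move=> h; have M0 : 0 <= M by exact: le_trans (gM 0).
have h0 : -1 < (0 : R) < 2 by apply/andP; split; lra.
have := antid_lip h h0; rewrite antid0 !subr0 => /le_trans; apply.
rewrite mulrC ler_wpM2r//; move: h => /andP[? ?].
by rewrite ler_norml; apply/andP; split; lra.
Qed.

End Antiderivative.

Lemma is_derive_quotient {R : realType} (f : R -> R) (t v : R) :
  is_derive t 1 f v <-> h^-1 * (f (h + t) - f t) @[h --> 0^'] --> v.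
Proof.
have E : (fun h : R => h^-1 *: ((f \o shift t) (h *: 1) - f t)) =
         (fun h => h^-1 * (f (h + t) - f t)).
  by apply/funext => h; rewrite /GRing.scale/= mulr1.
split=> [d|c].
  have c := @ex_derive _ _ _ _ _ _ _ d; have dv := @derive_val _ _ _ _ _ _ _ d.
  by move: c dv; rewrite /derivable /derive E => c <-.
by apply: DeriveDef; rewrite /derivable /derive E; [exact: cvgP c|exact: cvg_lim c].
Qed.

Section EdgeAverages.
Context {R : realType} (X : wgraph R).
Hypothesis hX : is_network X.
Notation mu := (@lebesgue_measure R).
Variable f : X -> X -> R -> R.
Hypothesis mf : forall x y : X, adj x y -> measurable_fun (`[0, 1]%classic : set R) (f x y).
Hypothesis f2 : forall x y : X, adj x y ->
  (\int[mu]_(t in `[0%R, 1%R]) (f x y t ^+ 2)%:E < +oo)%E.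
Hypothesis sQ : summ2 (fun x y => wt x y * Rintegral mu `[0, 1] (fun t => f x y t ^+ 2)).

(** The values [H t x] of the wave attached to [f], with [t] clamped to [[0,1]] so
    that continuity holds on the whole line. *)
Definition edge_avg t x : R :=
  (mass x)^-1 * tsum (fun u => wt x u * Rintegral mu `[0, clamp t] (f x u)).

(** A majorant in [l^2] which is uniform in [t]; it dominates all limits below. *)
Definition edge_avg_bd x : R := (mass x)^-1 * tsum (fun u => wt x u * L1norm (f x u)).

Lemma summ_L1sqr : summ2 (fun x y => wt x y * L1norm (f x y) ^+ 2).
Proof.
apply: summ2_le sQ => x y; rewrite ger0_norm; last first.
  by apply: mulr_ge0; [exact: wt_ge0|exact: sqr_ge0].
have [xy|nxy] := boolP (adj x y); last by rewrite /wt (negbTE nxy) !mul0r.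
by rewrite ler_wpM2l ?wt_ge0//; apply: L1norm_sqr; [exact: mf|exact: f2].
Qed.

Lemma summ_L1 x : summ (fun u => wt x u * L1norm (f x u)).
Proof.
apply: jensen_summ; [exact: wt_ge0|exact: summ_wt|].
exact: (summ2_row summ_L1sqr).
Qed.

Lemma edge_avg_bd_ge0 x : 0 <= edge_avg_bd x.
Proof.
rewrite mulr_ge0 ?invr_ge0 ?mass_ge0// tsum_ge0// => u.
by rewrite mulr_ge0 ?wt_ge0 ?L1norm_ge0.
Qed.

Lemma l2_edge_avg_bd : l2 edge_avg_bd.
Proof.
apply: summ_le (summ2_tsum summ_L1sqr) => x; rewrite ger0_norm ?mass_sqr_ge0//.
have := jensen_tsum (wt_ge0 hX x) (summ_wt hX x) (tsum_wt hX x) (mass_gt0 hX x)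
  (summ2_row summ_L1sqr x).
rewrite /edge_avg_bd; set Q := tsum _; set S := tsum _ => h.
have m0 := mass_gt0 hX x.
have -> : mass x * ((mass x)^-1 * Q) ^+ 2 = (mass x)^-1 * Q ^+ 2.
  by field; rewrite gt_eqF.
by rewrite mulrC ler_pdivrMr// mulrC.
Qed.

Lemma prim_bound x u t : `|wt x u * Rintegral mu `[0, clamp t] (f x u)| <=
  wt x u * L1norm (f x u).
Proof.
have [xu|nxu] := boolP (adj x u); last by rewrite /wt (negbTE nxu) !mul0r normr0.
rewrite normrM ger0_norm ?wt_ge0// ler_wpM2l ?wt_ge0//.
by apply: prim_le; [exact: mf|exact: f2|exact: clamp01].
Qed.

Lemma summ_prim x t : summ (fun u => wt x u * Rintegral mu `[0, clamp t] (f x u)).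
Proof. by apply: summ_le (summ_L1 x) => u; exact: prim_bound. Qed.

Lemma edge_avg_bound t x : `|edge_avg t x| <= edge_avg_bd x.
Proof.
rewrite /edge_avg /edge_avg_bd normrM ger0_norm ?invr_ge0 ?mass_ge0//.
rewrite ler_wpM2l ?invr_ge0 ?mass_ge0//.
apply: (le_trans (ler_abs_tsum (summ_prim x t))); apply: ler_tsum (prim_bound x ^~ t).
- exact/summ_abs/summ_prim.
- exact: summ_L1.
Qed.

Lemma l2_edge_avg t : l2 (edge_avg t).
Proof.
apply: (l2_le hX) l2_edge_avg_bd => x; rewrite (ger0_norm (edge_avg_bd_ge0 x)); exact: edge_avg_bound.
Qed.

Lemma edge_avg_continuous x : continuous (edge_avg ^~ x).
Proof.
move=> t; apply: cvgMr; apply: (@tsum_cvg R X R (nbhs t) _ _ _ _ (summ_L1 x)).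
- by apply: nearW => s u; exact: prim_bound.
move=> u; have [xu|nxu] := boolP (adj x u); last first.
  rewrite /wt (negbTE nxu); under eq_fun do rewrite mul0r.
  by rewrite mul0r; exact: cvg_cst.
apply: cvgMr; apply: (continuous_clamp (f := fun s => Rintegral mu `[0, s] (f x u))).
by apply: prim_continuous; [exact: mf|exact: f2].
Qed.

Lemma edge_avg0 x : edge_avg 0 x = 0.
Proof.
rewrite /edge_avg clamp_id ?lexx ?ler01//.
rewrite (@eq_tsum _ _ _ (fun=> 0)) ?tsum0 ?mulr0// => u.
by rewrite set_itv1 Rintegral_set1 mulr0.
Qed.

Definition edge_prim t x : R := antid (edge_avg ^~ x) t.

Lemma edge_prim0 x : edge_prim 0 x = 0. Proof. exact: antid0. Qed.

Lemma hasD_edge_prim x : hasD (edge_prim ^~ x) (edge_avg ^~ x).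
Proof. by apply: hasD_antid; exact: edge_avg_continuous. Qed.

Lemma edge_prim_le (t : R) x : -1 < t < 2 -> `|edge_prim t x| <= 2 * edge_avg_bd x.
Proof.
by apply: antid_le; [exact: edge_avg_continuous|move=> s; exact: edge_avg_bound].
Qed.

Lemma l2_edge_prim (t : R) : -1 < t < 2 -> l2 (edge_prim t).
Proof.
move=> h; apply: (l2_le hX) (l2Z 2 l2_edge_avg_bd) => x; rewrite [leRHS]ger0_norm.
  exact: edge_prim_le.
by rewrite mulr_ge0 ?edge_avg_bd_ge0.
Qed.

(** Differentiation under the sum: the difference quotients of the primitive are
    dominated by the majorant of its derivative. *)
Lemma hasD_ip_edge_prim u : l2 u -> hasD (fun t => ip (edge_prim t) u) (fun t => ip (edge_avg t) u).
Proof.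
move=> su t /andP[t0 t1]; apply/is_derive_quotient.
have tI : -1 < t < 2 by apply/andP; split; lra.
have tI' : \forall h \near 0^', -1 < h + t < 2.
  near=> h; have : `|h| < 1 / 2.
    by near: h; apply: dnbhs0_lt; lra.
  by rewrite ltr_norml => /andP[? ?]; apply/andP; split; lra.
pose phi h x := mass x * ((h^-1 * (edge_prim (h + t) x - edge_prim t x)) * u x).
have c : tsum (phi h) @[h --> 0^'] --> ip (edge_avg t) u.
  have sM : summ (fun x => mass x * (edge_avg_bd x * `|u x|)).
    by apply: (l2_mul hX l2_edge_avg_bd); apply: (l2_le hX) su => x; rewrite normr_id.
  apply: (@tsum_cvg R X R (0^') _ _ _ _ sM).
  - near=> h => x; rewrite normrM (gtr0_norm (mass_gt0 hX x)) ler_wpM2l ?mass_ge0//.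
    rewrite normrM ler_wpM2r//.
    have h0 : h != 0 by near: h; exact: nbhs_dnbhs_neq.
    rewrite normrM normfV mulrC ler_pdivrMr ?normr_gt0//.
    have hI : -1 < h + t < 2 by near: h.
    have := antid_lip (@edge_avg_continuous x) (fun s => edge_avg_bound s x) hI tI.
    by rewrite addrK.
  move=> x; apply: cvgMr; apply: cvgMl.
  have d := @is_derive_antid _ (edge_avg ^~ x) t (@edge_avg_continuous x) tI.
  exact: (is_derive_quotient _ _ _).1 d.
apply: cvg_trans c; apply: near_eq_cvg; near=> h.
have hI : -1 < h + t < 2 by near: h.
have sh := l2_edge_prim hI; have st := l2_edge_prim tI.
rewrite -(ipBl hX sh st su) -(ipZl hX _ (l2B hX sh st) su).
by [].
Unshelve. all: by end_near. Qed.

Lemma ip_edge_avg_bound t : ip (edge_avg t) (edge_avg t) <= ip edge_avg_bd edge_avg_bd.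
Proof.
apply: ler_tsum.
- by apply: (l2_mul hX); exact: l2_edge_avg.
- by apply: (l2_mul hX); exact: l2_edge_avg_bd.
move=> x; rewrite ler_wpM2l ?mass_ge0// -!expr2 -real_normK ?num_real//.
by rewrite lerXn2r ?nnegrE ?edge_avg_bd_ge0// edge_avg_bound.
Qed.

End EdgeAverages.

(** * From eigenfunctions on edges to eigenvectors on vertices *)

Section L2Parts.
Context {R : realType} (X : wgraph R).
Hypothesis hX : is_network X.
Notation mu := (@lebesgue_measure R).
Implicit Type F : X -> X -> R -> R[i].

Definition rpart F : X -> X -> R -> R := fun x y t => complex.Re (F x y t).
Definition ipart F : X -> X -> R -> R := fun x y t => complex.Im (F x y t).

Lemma normsqX1_wt F : normsqX1 F = ((2^-1)%:E * \esum_(x in [set: X])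
  \esum_(y in [set: X]) ((wt x y)%:E * \int[mu]_(t in `[0%R, 1%R])
     (ComplexField.Normc.normc (F x y t) ^+ 2)%:E))%E.
Proof.
by rewrite /normsqX1; congr (_ * _)%E; apply: eq_esum => x _; rewrite esum_nbr.
Qed.

Lemma measurable_normc2 F x y : cmeasurable `[0, 1] (F x y) ->
  measurable_fun (`[0, 1]%classic : set R)
    (EFin \o (fun t => ComplexField.Normc.normc (F x y t) ^+ 2)).
Proof.
move=> [m1 m2]; apply/measurable_EFinP.
rewrite (_ : (fun t => _) = (fun t => rpart F x y t ^+ 2 + ipart F x y t ^+ 2)).
  by apply: measurable_funD; exact: measurable_funX.
by apply/funext => t; exact: normc2E.
Qed.

(** Square integrability of the real and of the imaginary part, edge by edge and
    summed over all edges, from the finite norm of [F]. *)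
Lemma L2X1_square F (f : X -> X -> R -> R) : L2X1 F ->
  (forall x y, adj x y -> measurable_fun (`[0, 1]%classic : set R) (f x y)) ->
  (forall x y t, f x y t ^+ 2 <= ComplexField.Normc.normc (F x y t) ^+ 2) ->
  (forall x y, adj x y -> (\int[mu]_(t in `[0%R, 1%R]) (f x y t ^+ 2)%:E < +oo)%E) /\
  summ2 (fun x y => wt x y * Rintegral mu `[0, 1] (fun t => f x y t ^+ 2)).
Proof.
move=> [_ mF]; rewrite normsqX1_wt => nF mf fF.
pose N x y := (\int[mu]_(t in `[0%R, 1%R])
     (ComplexField.Normc.normc (F x y t) ^+ 2)%:E)%E.
have N0 x y : (0 <= N x y)%E by apply: integral_ge0 => t _; rewrite lee_fin sqr_ge0.
have wN0 x y : (0 <= (wt x y)%:E * N x y)%E by rewrite mule_ge0// lee_fin wt_ge0.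
have sN : (\esum_(x in [set: X]) \esum_(y in [set: X]) ((wt x y)%:E * N x y) < +oo)%E.
  have S0 : (0 <= \esum_(x in [set: X]) \esum_(y in [set: X]) ((wt x y)%:E * N x y))%E.
    by apply: esum_ge0 => x _; exact: esum_ge0.
  move: nF S0; rewrite -/N; case: (esum _ _) => //= [r _ _|]; first exact: ltry.
  by rewrite mulry gtr0_sg ?invr_gt0// mul1e.
have fN x y : adj x y -> (\int[mu]_(t in `[0%R, 1%R]) (f x y t ^+ 2)%:E <= N x y)%E.
  move=> xy; apply: ge0_le_integral => //.
  - by move=> t _; rewrite lee_fin sqr_ge0.
  - by apply/measurable_EFinP; apply: measurable_funX; exact: mf.
  - by apply: measurable_normc2; exact: mF.
  - by move=> t _; rewrite lee_fin.
have wf x y : ((wt x y)%:E * \int[mu]_(t in `[0%R, 1%R]) (f x y t ^+ 2)%:E <=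
   (wt x y)%:E * N x y)%E.
  have [xy|nxy] := boolP (adj x y); last by rewrite /wt (negbTE nxy) !mul0e.
  by rewrite lee_wpmul2l ?lee_fin ?wt_ge0//; exact: fN.
have f0 x y : (0 <= \int[mu]_(t in `[0%R, 1%R]) (f x y t ^+ 2)%:E)%E.
  by apply: integral_ge0 => t _; rewrite lee_fin sqr_ge0.
have ffin x y : adj x y -> (\int[mu]_(t in `[0%R, 1%R]) (f x y t ^+ 2)%:E < +oo)%E.
  move=> xy; apply: le_lt_trans (fN x y xy) _.
  have : ((wt x y)%:E * N x y < +oo)%E.
    apply: le_lt_trans sN; rewrite [leRHS](esumID [set x]); last first.
      by move=> z _; exact: esum_ge0.
    rewrite setTI esum_set1 ?esum_ge0//; apply: (@le_trans _ _ (\esum_(z in [set: X]) ((wt x z)%:E * N x z))%E).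
      by rewrite (esumID [set y])// setTI esum_set1// leeDl// esum_ge0.
    by rewrite leeDl// esum_ge0// => z _; exact: esum_ge0.
  have := wt_gt0 hX xy; have := N0 x y; case: (N x y) => //= [r _ _ _|_ w0]; first exact: ltry.
  by rewrite mulry gtr0_sg// mul1e.
split=> //; apply: le_lt_trans sN; apply: le_esum => x _; apply: le_esum => y _.
apply: le_trans (wf x y); have [xy|nxy] := boolP (adj x y); last first.
  by rewrite /wt (negbTE nxy) !mul0r mul0e normr0.
rewrite ger0_norm ?mulr_ge0 ?wt_ge0 ?Rintegral_ge0//; last first.
  by move=> t _; exact: sqr_ge0.
rewrite EFinM lee_wpmul2l ?lee_fin ?wt_ge0// /Rintegral fineK//.
by rewrite fin_numElt (ffin _ _ xy) andbT (lt_le_trans (ltNyr 0)).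
Qed.

Lemma rpart_le F x y t : rpart F x y t ^+ 2 <= ComplexField.Normc.normc (F x y t) ^+ 2.
Proof. by rewrite normc2E lerDl sqr_ge0. Qed.

Lemma ipart_le F x y t : ipart F x y t ^+ 2 <= ComplexField.Normc.normc (F x y t) ^+ 2.
Proof. by rewrite normc2E lerDr sqr_ge0. Qed.

Lemma Re_avgA F x y (t : R) : 0 <= t <= 1 ->
  complex.Re (avgA F x y t) = edge_avg (rpart F) (1 - t) x + edge_avg (rpart F) t y.
Proof.
move=> t01; rewrite /avgA ReD !ReM /= !mul0r !subr0 /edge_avg (clamp_id t01).
rewrite clamp_id; last by move: t01 => /andP[? ?]; apply/andP; split; lra.
rewrite -!rsum_nbr; congr (_ * _ + _ * _); congr rsum; apply/funext => z;
  by rewrite ?ReM /= mul0r subr0.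
Qed.

Lemma Im_avgA F x y (t : R) : 0 <= t <= 1 ->
  complex.Im (avgA F x y t) = edge_avg (ipart F) (1 - t) x + edge_avg (ipart F) t y.
Proof.
move=> t01; rewrite /avgA ImD !ImM /= !mul0r !addr0 /edge_avg (clamp_id t01).
rewrite clamp_id; last by move: t01 => /andP[? ?]; apply/andP; split; lra.
rewrite -!rsum_nbr; congr (_ * _ + _ * _); congr rsum; apply/funext => z;
  by rewrite ?ImM /= mul0r addr0.
Qed.

End L2Parts.

Section Eigenfunction.
Context {R : realType} (X : wgraph R).
Hypothesis hX : is_network X.
Notation mu := (@lebesgue_measure R).
Variables (F : X -> X -> R -> R[i]) (lam : R[i]).
Hypothesis LF : L2X1 F.
Hypothesis nF : ~ aeX1 F (fun _ _ _ => 0).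
Hypothesis eF : aeX1 (avgA F) (fun x y t => lam * F x y t).
Hypothesis lam0 : lam != 0.

Let f1 := rpart F.
Let f2 := ipart F.
Let mF1 (x y : X) : adj x y -> measurable_fun (`[0, 1]%classic : set R) (f1 x y).
Proof. by move=> xy; have [_ /(_ x y xy)[]] := LF. Qed.
Let mF2 (x y : X) : adj x y -> measurable_fun (`[0, 1]%classic : set R) (f2 x y).
Proof. by move=> xy; have [_ /(_ x y xy)[]] := LF. Qed.
Let L1 := L2X1_square hX LF mF1 (@rpart_le R X F).
Let L2 := L2X1_square hX LF mF2 (@ipart_le R X F).
Let i1 := L1.1. Let q1 := L1.2. Let i2 := L2.1. Let q2 := L2.2.

Let a := complex.Re lam^-1.
Let b := complex.Im lam^-1.
Let H1 := edge_avg f1.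
Let H2 := edge_avg f2.
Let K1 := edge_prim f1.
Let K2 := edge_prim f2.
Let cH1 x : continuous (H1 ^~ x) := @edge_avg_continuous R X hX f1 mF1 i1 q1 x.
Let cH2 x : continuous (H2 ^~ x) := @edge_avg_continuous R X hX f2 mF2 i2 q2 x.

(** The eigenvalue equation solved for [F], split into real and imaginary parts,
    with [a + i b] the inverse of the eigenvalue. *)
Lemma F_ae x y : adj x y ->
  {ae mu, forall t, t \in `]0%R, 1%R[ ->
    f1 x y t = a * (H1 (1 - t) x + H1 t y) - b * (H2 (1 - t) x + H2 t y)} /\
  {ae mu, forall t, t \in `]0%R, 1%R[ ->
    f2 x y t = b * (H1 (1 - t) x + H1 t y) + a * (H2 (1 - t) x + H2 t y)}.
Proof.
move=> xy; have ae := eF xy.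
have E (t : R) : t \in `]0%R, 1%R[ -> avgA F x y t = lam * F x y t ->
  F x y t = lam^-1 * avgA F x y t.
  by move=> _ ->; rewrite mulKf.
have I (t : R) : t \in `]0%R, 1%R[ -> 0 <= t <= 1.
  by rewrite in_itv/= => /andP[/ltW-> /ltW->].
split; move: ae; apply: filterS; try exact: (ae_filter_ringOfSetsType mu);
  move=> t h tI; have := E t tI (h tI) => FE.
- by rewrite /f1 /rpart FE ReM (Re_avgA _ _ _ (I _ tI)) (Im_avgA _ _ _ (I _ tI)).
- by rewrite /f2 /ipart FE ImM (Re_avgA _ _ _ (I _ tI)) (Im_avgA _ _ _ (I _ tI)) addrC.
Qed.

Lemma prim_edge c d (f : R -> R) x y (t : R) :
  measurable_fun (`[0, 1]%classic : set R) f ->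
  (\int[mu]_(t in `[0%R, 1%R]) (f t ^+ 2)%:E < +oo)%E ->
  {ae mu, forall t, t \in `]0%R, 1%R[ ->
    f t = c * (H1 (1 - t) x + H1 t y) + d * (H2 (1 - t) x + H2 t y)} ->
  0 <= t <= 1 -> Rintegral mu `[0, t] f =
    c * (K1 1 x - K1 (1 - t) x + K1 t y) + d * (K2 1 x - K2 (1 - t) x + K2 t y).
Proof.
move=> mf f2' ae t01.
have crev (h : R -> R) : continuous h -> continuous (fun t : R => h (1 - t)).
  move=> ch s; apply: (cvg_comp (fun t : R => 1 - t) h _ (ch _)).
  by apply: cvgB; [exact: cvg_cst|exact: cvg_id].
have cg : continuous (fun t : R => c * (H1 (1 - t) x + H1 t y) + d * (H2 (1 - t) x + H2 t y)).
  by move=> s; apply: cvgD; apply: cvgMr; apply: cvgD;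
    [exact: (crev _ (@cH1 x))|exact: cH1|exact: (crev _ (@cH2 x))|exact: cH2].
rewrite (prim_ae mf f2' cg ae t01).
apply: (Rintegral_FTC (G := fun t : R => c * (K1 1 x - K1 (1 - t) x + K1 t y) +
   d * (K2 1 x - K2 (1 - t) x + K2 t y)) cg _ _ t01).
  have d1 z : hasD (K1 ^~ z) (H1 ^~ z) by apply: hasD_edge_prim.
  have d2 z : hasD (K2 ^~ z) (H2 ^~ z) by apply: hasD_edge_prim.
  apply: hasD_ext (hasDD
    (hasDZ c (hasDD (hasDB (hasD_cst (K1 1 x)) (hasD_rev (d1 x))) (d1 y)))
    (hasDZ d (hasDD (hasDB (hasD_cst (K2 1 x)) (hasD_rev (d2 x))) (d2 y)))) _ => s _.
  by rewrite !sub0r !opprK.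
by rewrite /K1 /K2 !edge_prim0 !subr0 !subrr !addr0 !mulr0 addr0.
Qed.

Let tI (t : R) : 0 <= t <= 1 -> -1 < t < 2.
Proof. by move=> /andP[? ?]; apply/andP; split; lra. Qed.
Let tJ (t : R) : 0 <= t <= 1 -> -1 < 1 - t < 2.
Proof. by move=> /andP[? ?]; apply/andP; split; lra. Qed.
Let I1 : 0 <= (1 : R) <= 1. Proof. by rewrite lexx ler01. Qed.
Let sK1 (t : R) : -1 < t < 2 -> l2 (K1 t) := @l2_edge_prim R X hX f1 mF1 i1 q1 t.
Let sK2 (t : R) : -1 < t < 2 -> l2 (K2 t) := @l2_edge_prim R X hX f2 mF2 i2 q2 t.

(** Averaging over the edges at [x] turns the primitive at the far end of the edge
    into [P] applied to the primitive. *)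
Lemma edge_avg_edge c d (f : X -> X -> R -> R) :
  (forall x y, adj x y -> forall t : R, 0 <= t <= 1 -> Rintegral mu `[0, t] (f x y) =
    c * (K1 1 x - K1 (1 - t) x + K1 t y) + d * (K2 1 x - K2 (1 - t) x + K2 t y)) ->
  forall (t : R) x, 0 <= t <= 1 -> edge_avg f t x =
    c * (K1 1 x - K1 (1 - t) x + opP (K1 t) x) + d * (K2 1 x - K2 (1 - t) x + opP (K2 t) x).
Proof.
move=> hf t x t01; have [s1 s2] := (sK1 (tI t01), sK2 (tI t01)).
pose A := c * (K1 1 x - K1 (1 - t) x) + d * (K2 1 x - K2 (1 - t) x).
rewrite /edge_avg clamp_id// (@eq_tsum _ _ _ (fun u => A * wt x u +
    (c * (wt x u * K1 t u) + d * (wt x u * K2 t u)))); last first.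
  move=> u; have [xu|nxu] := boolP (adj x u); last first.
    by rewrite /wt (negbTE nxu) !(mul0r, mulr0, addr0).
  by rewrite (hf _ _ xu t t01) /A; ring.
have r1 := summ_row hX x s1; have r2 := summ_row hX x s2; have r0 := summ_wt hX x.
rewrite (tsumD (summZ A r0) (summD (summZ c r1) (summZ d r2))).
rewrite (tsumD (summZ c r1) (summZ d r2)) (tsumZ A r0) (tsumZ c r1) (tsumZ d r2).
rewrite tsum_wt// /opP /A; have m0 := mass_gt0 hX x; field; by rewrite gt_eqF.
Qed.

(** The pairing [<H t, u>] for [t] in [[0,1]], rewritten through the primitives of
    [H], which are differentiable in a neighbourhood of [[0,1]]. *)
Let hh c d u (t : R) : R :=
  c * (ip (K1 1) u - ip (K1 (1 - t)) u + ip (K1 t) (opP u)) +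
  d * (ip (K2 1) u - ip (K2 (1 - t)) u + ip (K2 t) (opP u)).

Lemma hh_ip c d (f : X -> X -> R -> R) u (t : R) :
  (forall x y, adj x y -> forall t : R, 0 <= t <= 1 -> Rintegral mu `[0, t] (f x y) =
    c * (K1 1 x - K1 (1 - t) x + K1 t y) + d * (K2 1 x - K2 (1 - t) x + K2 t y)) ->
  l2 u -> 0 <= t <= 1 -> hh c d u t = ip (edge_avg f t) u.
Proof.
move=> hf su t01.
have [s1 s2] := (sK1 (tI t01), sK2 (tI t01)).
have [s1' s2'] := (sK1 (tJ t01), sK2 (tJ t01)).
have [z1 z2] := (sK1 (tI I1), sK2 (tI I1)).
rewrite (_ : edge_avg f t = fun x => c * (K1 1 x - K1 (1 - t) x + opP (K1 t) x) +
    d * (K2 1 x - K2 (1 - t) x + opP (K2 t) x)); last first.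
  by apply/funext => x; exact: edge_avg_edge.
have p1 := l2P hX s1; have p2 := l2P hX s2.
have w1 := l2D hX (l2B hX z1 s1') p1; have w2 := l2D hX (l2B hX z2 s2') p2.
rewrite (ipDl hX (l2Z c w1) (l2Z d w2) su) (ipZl hX c w1 su) (ipZl hX d w2 su).
rewrite (ipDl hX (l2B hX z1 s1') p1 su) (ipDl hX (l2B hX z2 s2') p2 su).
by rewrite (ipBl hX z1 s1' su) (ipBl hX z2 s2' su) (opP_sym hX s1 su) (opP_sym hX s2 su).
Qed.

Let d1 u : l2 u -> hasD (fun t => ip (K1 t) u) (fun t => ip (H1 t) u) :=
  @hasD_ip_edge_prim R X hX f1 mF1 i1 q1 u.
Let d2 u : l2 u -> hasD (fun t => ip (K2 t) u) (fun t => ip (H2 t) u) :=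
  @hasD_ip_edge_prim R X hX f2 mF2 i2 q2 u.

Lemma hasD_hh c d u : l2 u -> hasD (hh c d u)
  (fun t => c * (ip (H1 (1 - t)) u + ip (H1 t) (opP u)) +
            d * (ip (H2 (1 - t)) u + ip (H2 t) (opP u))).
Proof.
move=> su; have sP := l2P hX su.
apply: hasD_ext (hasDD
  (hasDZ c (hasDD (hasDB (hasD_cst (ip (K1 1) u)) (hasD_rev (d1 su))) (d1 sP)))
  (hasDZ d (hasDD (hasDB (hasD_cst (ip (K2 1) u)) (hasD_rev (d2 su))) (d2 sP)))) _ => t _.
by rewrite !sub0r !opprK.
Qed.

Lemma eigenfunction_eigen : exists (p : R) (u : X -> R),
  [/\ l2 u, exists x, u x != 0, forall x, opP u x = p * u x, b = 0 &
    (a = 1 /\ p = 1) \/ exists w, [/\ w != 0, cos w = p & a * sin w = w]].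
Proof.
have e1 x y (xy : adj x y) (t : R) : 0 <= t <= 1 -> Rintegral mu `[0, t] (f1 x y) =
    a * (K1 1 x - K1 (1 - t) x + K1 t y) + (- b) * (K2 1 x - K2 (1 - t) x + K2 t y).
  apply: prim_edge; [exact: mF1|exact: i1|].
  have [ae _] := F_ae xy; move: ae; apply: filterS.
    exact: (ae_filter_ringOfSetsType mu).
  by move=> s h sI; rewrite h// mulNr.
have e2 x y (xy : adj x y) (t : R) : 0 <= t <= 1 -> Rintegral mu `[0, t] (f2 x y) =
    b * (K1 1 x - K1 (1 - t) x + K1 t y) + a * (K2 1 x - K2 (1 - t) x + K2 t y).
  by apply: prim_edge; [exact: mF2|exact: i2|have [_ ae] := F_ae xy].
have h1E u (t : R) : l2 u -> 0 <= t <= 1 -> hh a (- b) u t = ip (H1 t) u.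
  by move=> su t01; apply: hh_ip => // x y xy; exact: e1.
have h2E u (t : R) : l2 u -> 0 <= t <= 1 -> hh b a u t = ip (H2 t) u.
  by move=> su t01; apply: hh_ip => // x y xy; exact: e2.
have lamE : complex.Re lam * a - complex.Im lam * b = 1 /\
    complex.Re lam * b + complex.Im lam * a = 0.
  by rewrite /a /b -ReM -ImM mulfV.
have sH1 (t : R) : 0 <= t <= 1 -> l2 (H1 t).
  by move=> _; exact: (l2_edge_avg hX mF1 i1 q1 t).
have sH2 (t : R) : 0 <= t <= 1 -> l2 (H2 t).
  by move=> _; exact: (l2_edge_avg hX mF2 i2 q2 t).
pose C := ip (edge_avg_bd f1) (edge_avg_bd f1) + ip (edge_avg_bd f2) (edge_avg_bd f2).
have C1 (t : R) : 0 <= t <= 1 -> ip (H1 t) (H1 t) <= C.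
  move=> _; apply: le_trans (ip_edge_avg_bound hX mF1 i1 q1 t) _.
  by rewrite lerDl; exact: ip_ge0.
have C2 (t : R) : 0 <= t <= 1 -> ip (H2 t) (H2 t) <= C.
  move=> _; apply: le_trans (ip_edge_avg_bound hX mF2 i2 q2 t) _.
  by rewrite lerDr; exact: ip_ge0.
have rI (t : R) : 0 <= t <= 1 -> 0 <= 1 - t <= 1.
  by move=> /andP[? ?]; apply/andP; split; lra.
have D1 u : l2 u -> hasD (hh a (- b) u) (fun t =>
    a * (hh a (- b) u (1 - t) + hh a (- b) (opP u) t) -
    b * (hh b a u (1 - t) + hh b a (opP u) t)).
  move=> su; have sP := l2P hX su; apply: hasD_ext (hasD_hh a (- b) su) _ => t t01.
  by rewrite !h1E ?h2E ?rI// mulNr.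
have D2 u : l2 u -> hasD (hh b a u) (fun t =>
    b * (hh a (- b) u (1 - t) + hh a (- b) (opP u) t) +
    a * (hh b a u (1 - t) + hh b a (opP u) t)).
  move=> su; have sP := l2P hX su; apply: hasD_ext (hasD_hh b a su) _ => t t01.
  by rewrite !h1E ?h2E ?rI.
have ab0 : (a != 0) || (b != 0).
  apply: contraT; rewrite negb_or !negbK => /andP[/eqP a0 /eqP b0].
  by move: lamE => [] /eqP; rewrite a0 b0 !mulr0 subrr eq_sym oner_eq0.
have nz : exists2 t : R, 0 <= t <= 1 & exists x, (H1 t x != 0) || (H2 t x != 0).
  apply: contrapT => z; apply: nF => x y xy.
  have z0 (t : R) u : 0 <= t <= 1 -> H1 t u = 0 /\ H2 t u = 0.
    move=> t01; split; apply/eqP; apply: contraT => n; exfalso; apply: z;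
      by exists t => //; exists u; rewrite n ?orbT.
  have [ae1 ae2] := F_ae xy.
  move: ae1 ae2; apply: filterS2; first exact: (ae_filter_ringOfSetsType mu).
  move=> t g1 g2 tI'.
  have t01 : 0 <= t <= 1 by move: tI'; rewrite in_itv/= => /andP[/ltW-> /ltW->].
  have [y1 y2] := z0 t y t01; have [x1 x2] := z0 (1 - t) x (rI t t01).
  move: (g1 tI') (g2 tI'); rewrite y1 y2 x1 x2 addr0 !mulr0 subrr addr0.
  by rewrite /f1 /f2 /rpart /ipart; case: (F x y t) => ? ? /= -> ->.
exact: (wave_eigen hX ab0 sH1 sH2 C1 C2 (edge_avg0 f1) (edge_avg0 f2) h1E h2E D1 D2 lamE.1 lamE.2 nz).
Qed.

End Eigenfunction.

Section Forward.
Context {R : realType} (X : wgraph R).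
Hypothesis hX : is_network X.

Lemma specpP_real (p : R) (u : X -> R) : l2 u -> (exists x, u x != 0) ->
  (forall x, opP u x = p * u x) -> specpP X (p%:C)%C.
Proof.
move=> su [x ux] Pu; exists (fun x => (u x)%:C)%C; split.
- by apply/(l2X0_parts hX); split=> //=; exact: l20.
- by exists x; apply: contra ux => /eqP[->].
move=> z; apply: complexP.
  by rewrite (Re_transP) ReM /= mul0r subr0 Pu.
rewrite Im_transP ImM /= mul0r mulr0 addr0 /opP (@eq_tsum _ _ _ (fun=> 0)) ?tsum0 ?mulr0//.
by move=> y; rewrite mulr0.
Qed.

(** The inverse [a] of the eigenvalue satisfies [a sin w = w], so
    [lam = sin w / w]. *)
Lemma specpA_specpP lam : specpA X lam -> lam != 0 ->
  (lam = 1 /\ specpP X 1) \/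
  exists2 w : R, w != 0 /\ specpP X ((cos w)%:C)%C & ((sin w / w)%:C)%C = lam.
Proof.
move=> [F [LF nF eF]] lam0.
have [p [u [su u0 Pu b0 cas]]] := eigenfunction_eigen hX LF nF eF lam0.
have lE : lam^-1 = ((complex.Re lam^-1)%:C)%C by apply: complexP.
case: cas => [[a1 p1]|[w [w0 cw aw]]].
  left; have l1 : lam = 1 by rewrite -(invrK lam) lE a1 invr1.
  by split=> //; have := specpP_real su u0 Pu; rewrite p1.
right; exists w; first by split=> //; rewrite cw; exact: specpP_real Pu.
rewrite -(invrK lam) lE; set a := complex.Re _ in aw *.
have s0 : sin w != 0 by apply: contra_neq w0 => s0; rewrite -aw s0 mulr0.
by rewrite -{2}aw invfM mulrCA mulfV// mulr1 -fmorphV.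
Qed.

End Forward.

(** * Real edge functions *)

Section NonZero.
Context {R : realType}.
Notation mu := (@lebesgue_measure R).

Lemma lebesgue_unit_itv : mu `[0%R, 1%R] = 1%E.
Proof. by rewrite lebesgue_measure_itv/= lte_fin ltr01 -EFinB subr0. Qed.

(** A continuous function that vanishes almost everywhere on [0,1] has a
    vanishing antiderivative, hence by the mean value theorem it has zeros in
    every subinterval. *)
Lemma continuous_not_ae0 (psi : R -> R) (t0 : R) : continuous psi ->
  0 <= t0 <= 1 -> psi t0 != 0 ->
  ~ {ae mu, forall t, t \in `]0%R, 1%R[ -> psi t = 0}.
Proof.
move=> cp /andP[t00 t01] p0 ae.
have mp : measurable_fun (`[0, 1]%classic : set R) psi.
  by apply: measurable_funTS; exact: continuous_measurable_fun.
have i2 : (\int[mu]_(t in `[0%R, 1%R]) (psi t ^+ 2)%:E < +oo)%E.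
  have c2 : continuous (fun t => psi t ^+ 2).
    by move=> t; rewrite /continuous_at; under eq_fun do rewrite expr2; rewrite expr2; apply: cvgM; exact: cp.
  by apply: integrable_lty => //; exact: (continuous_integrable 0 1 c2).
have z (t : R) : 0 <= t <= 1 -> antid psi t = 0.
  move=> tI; rewrite -(Rintegral_FTC cp (hasD_antid cp) (antid0 psi) tI).
  rewrite (prim_ae mp i2 (g := fun=> 0) _ ae tI); last exact: cst_continuous.
  rewrite (@Rintegral_FTC _ (fun=> 0) (fun=> 0))//; first exact: cst_continuous.
  exact: hasD_cst.
have /cvgr_neq0/(_ p0)/nbhs_ballP[e /= e0 he] : psi @ t0 --> psi t0 by exact: cp.
pose s := Num.max 0 (t0 - e / 2); pose t := Num.min 1 (t0 + e / 2).
have s0 : 0 <= s by rewrite le_max lexx.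
have t1 : t <= 1 by rewrite ge_min lexx.
have se : t0 - e / 2 <= s by rewrite le_max lexx orbT.
have te : t <= t0 + e / 2 by rewrite ge_min lexx orbT.
have st0 : s <= t0 by rewrite ge_max t00/=; lra.
have t0t : t0 <= t by rewrite le_min t01/=; lra.
have st : s < t by rewrite /s /t gt_max !lt_min; apply/andP; split; apply/andP; split; lra.
have d := hasD_antid cp.
have [|c] := @MVT _ (antid psi) psi s t st _ (hasD_within d s0 t1).
  move=> x; rewrite in_itv/= => /andP[sx xt]; apply: d.
  by rewrite (le_trans s0 (ltW sx)) (le_trans (ltW xt)).
have sI : 0 <= s <= 1 by rewrite s0 (le_trans st0).
have tI : 0 <= t <= 1 by rewrite t1 (le_trans t00 t0t).
rewrite in_itv/= (z _ sI) (z _ tI) => /andP[sc ct].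
move=> /esym/eqP; rewrite subrr mulf_eq0 subr_eq0 (gt_eqF st) orbF; apply/negP.
apply: he; rewrite /ball/= ltr_norml; apply/andP; split; lra.
Qed.

End NonZero.

Section RealEdgeFunctions.
Context {R : realType} (X : wgraph R).
Hypothesis hX : is_network X.
Notation mu := (@lebesgue_measure R).
Variables (f : X -> X -> R -> R) (Q : X -> X -> R).
Hypothesis cf : forall x y, continuous (f x y).
Hypothesis fQ : forall x y (t : R), adj x y -> 0 <= t <= 1 -> f x y t ^+ 2 <= Q x y.
Hypothesis sQ : summ2 (fun x y => wt x y * Q x y).
Hypothesis f_rev : forall x y (t : R), adj x y -> f x y t = f y x (1 - t).
Hypothesis f_vtx : forall x y z, adj x y -> adj x z -> f x y 0 = f x z 0.

Definition edge_fun : X -> X -> R -> R[i] := fun x y t => ((f x y t)%:C)%C.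

Lemma L2X1_edge_fun : L2X1 edge_fun.
Proof.
split.
- split=> [x y t xy _|x y z xy xz]; rewrite /edge_fun; first by rewrite f_rev.
  by rewrite (f_vtx xy xz).
- move=> x y _; split; rewrite /edge_fun /=; last exact: measurable_cst.
  by apply: measurable_funTS; apply: continuous_measurable_fun; exact: cf.
rewrite normsqX1_wt; apply: lte_mul_pinfty => //.
apply: le_lt_trans sQ; apply: le_esum => x _; apply: le_esum => y _.
have [xy|nxy] := boolP (adj x y); last first.
  by rewrite /wt (negbTE nxy) mul0e mul0r normr0.
have Q0 : 0 <= Q x y.
  by apply: le_trans (fQ xy (_ : 0 <= 0 <= 1)); rewrite ?sqr_ge0 ?lexx ?ler01.
rewrite ger0_norm ?mulr_ge0 ?wt_ge0// EFinM lee_wpmul2l ?lee_fin ?wt_ge0//.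
have c2 : continuous (fun t => f x y t ^+ 2).
  move=> t; rewrite /continuous_at; under eq_fun do rewrite expr2.
  by rewrite expr2; apply: cvgM; exact: cf.
apply: (@le_trans _ _ (\int[mu]_(t in `[0%R, 1%R]) (cst (Q x y)%:E t))%E).
  apply: ge0_le_integral => //.
  - by move=> t _; rewrite lee_fin sqr_ge0.
  - apply/measurable_EFinP; apply: measurable_funTS; apply: continuous_measurable_fun.
    rewrite (_ : (fun t => _) = (fun t => f x y t ^+ 2))//.
    by apply/funext => t; rewrite normc2E /= expr0n addr0.
  - move=> t tI; rewrite lee_fin normc2E /= expr0n addr0 fQ//.
rewrite integral_cst// [X in (_ * X)%E](_ : _ = 1%E) ?mule1//.
exact: lebesgue_unit_itv.
Qed.

Lemma edge_fun_nonzero x y (t0 : R) : adj x y -> 0 <= t0 <= 1 -> f x y t0 != 0 ->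
  ~ aeX1 edge_fun (fun _ _ _ => 0).
Proof.
move=> xy tI f0 /(_ x y xy) ae; apply: (continuous_not_ae0 (@cf x y) tI f0).
move: ae; apply: filterS; first exact: (ae_filter_ringOfSetsType mu).
by move=> t h /h [].
Qed.

Lemma avgA_edge_fun x y (t : R) : 0 <= t <= 1 ->
  avgA edge_fun x y t = ((edge_avg f (1 - t) x + edge_avg f t y)%:C)%C.
Proof.
move=> t01; apply: complexP; first by rewrite Re_avgA.
rewrite Im_avgA//= /edge_avg.
have v0 (v : X) (s : R) :
    tsum (fun u => wt v u * Rintegral mu `[0, s] (ipart edge_fun v u)) = 0.
  rewrite (@eq_tsum _ _ _ (fun=> 0)) ?tsum0// => u.
  by rewrite /ipart /edge_fun /= /Rintegral integral0 mulr0.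
by rewrite !v0 !mulr0 addr0.
Qed.

Lemma specpA_edge_fun (lam : R) x y (t0 : R) : adj x y -> 0 <= t0 <= 1 -> f x y t0 != 0 ->
  (forall x y (t : R), adj x y -> 0 <= t <= 1 -> edge_avg f (1 - t) x + edge_avg f t y = lam * f x y t) ->
  specpA X ((lam%:C)%C).
Proof.
move=> xy tI f0 e; exists edge_fun; split.
- exact: L2X1_edge_fun.
- exact: edge_fun_nonzero xy tI f0.
move=> u v uv; apply: nearW => t; rewrite in_itv/= => /andP[ta tb].
have t01 : 0 <= t <= 1 by rewrite !ltW.
by rewrite avgA_edge_fun// e// /edge_fun rmorphM.
Qed.

End RealEdgeFunctions.

Section Interpolation.
Context {R : realType} (X : wgraph R).
Hypothesis hX : is_network X.
Notation mu := (@lebesgue_measure R).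
Variables (g : X -> R) (p B : R) (k kap : R -> R).
Hypothesis sg : l2 g.
Hypothesis Pg : forall x, opP g x = p * g x.
Hypothesis ck : continuous k.
Hypothesis dk : hasD kap k.
Hypothesis kap0 : kap 0 = 0.
Hypothesis kB : forall t : R, 0 <= t <= 1 -> `|k t| <= B.

Definition interp : X -> X -> R -> R := fun x y t => k (1 - t) * g x + k t * g y.

Lemma continuous_interp x y : continuous (interp x y).
Proof.
have ck' : continuous (fun t : R => k (1 - t)).
  move=> s; apply: (cvg_comp (fun t : R => 1 - t) k _ (@ck _)).
  by apply: cvgB; [exact: cvg_cst|exact: cvg_id].
by move=> t; apply: cvgD; apply: cvgMl; [exact: ck'|exact: ck].
Qed.

Lemma edge_avg_interp (t : R) x : 0 <= t <= 1 ->
  edge_avg interp t x = (kap 1 - kap (1 - t) + p * kap t) * g x.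
Proof.
move=> t01; rewrite /edge_avg clamp_id//.
have I u : Rintegral mu `[0, t] (interp x u) = (kap 1 - kap (1 - t)) * g x + kap t * g u.
  apply: (Rintegral_FTC (@continuous_interp x u) _ _ t01 (G := fun t : R =>
    (kap 1 - kap (1 - t)) * g x + kap t * g u)); last first.
    by rewrite kap0 subr0 subrr !mul0r addr0.
  apply: hasD_ext (hasDD (hasDM (hasDB (hasD_cst (kap 1)) (hasD_rev dk)) (hasD_cst (g x)))
    (hasDM dk (hasD_cst (g u)))) _ => s _.
  by rewrite /interp; ring.
rewrite (@eq_tsum _ _ _ (fun u => ((kap 1 - kap (1 - t)) * g x) * wt x u +
  kap t * (wt x u * g u))); last by move=> u; rewrite I; ring.
rewrite (tsumD (summZ _ (summ_wt hX x)) (summZ _ (summ_row hX x sg))).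
rewrite (tsumZ _ (summ_wt hX x)) (tsumZ _ (summ_row hX x sg)) tsum_wt//.
have m0 := mass_gt0 hX x; have := Pg x; rewrite /opP; set S := tsum _ => e.
have -> : S = mass x * (p * g x) by rewrite -e mulVKf// gt_eqF.
by field; rewrite gt_eqF.
Qed.

(** The eigenvalue equation for [F(xy,t) = k (1 - t) g x + k t g y] is the
    displayed identity in the primitive [kap] of [k], because averaging over the
    edges at [x] multiplies [g x] by [p]. *)
Lemma specpA_interp (lam t0 : R) x y :
  (forall x y z, adj x y -> adj x z -> interp x y 0 = interp x z 0) ->
  (forall x y (t : R), adj x y -> 0 <= t <= 1 ->
     (kap 1 - kap t + p * kap (1 - t)) * g x + (kap 1 - kap (1 - t) + p * kap t) * g y =
     lam * interp x y t) ->
  adj x y -> 0 <= t0 <= 1 -> interp x y t0 != 0 -> specpA X ((lam%:C)%C).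
Proof.
move=> hv e xy tI nz.
have rI (t : R) : 0 <= t <= 1 -> 0 <= 1 - t <= 1.
  by move=> /andP[? ?]; apply/andP; split; lra.
have sg' := l2Z (2 * B) sg.
pose Q x y := (2 * B * g x) ^+ 2 + (2 * B * g y) ^+ 2.
apply: (@specpA_edge_fun _ X hX interp Q _ _ _ _ hv lam x y t0 xy tI nz).
- exact: continuous_interp.
- move=> u v t _ t01; rewrite /interp /Q.
  have b1 : k t ^+ 2 <= B ^+ 2.
    by rewrite -real_normK ?num_real// lerXn2r ?nnegrE ?kB// (le_trans _ (kB t01)).
  have b2 : k (1 - t) ^+ 2 <= B ^+ 2.
    have t01' := rI t t01.
    by rewrite -real_normK ?num_real// lerXn2r ?nnegrE ?kB// (le_trans _ (kB t01')).
  have c1 : k t ^+ 2 * g v ^+ 2 <= B ^+ 2 * g v ^+ 2 by rewrite ler_wpM2r ?sqr_ge0.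
  have c2 : k (1 - t) ^+ 2 * g u ^+ 2 <= B ^+ 2 * g u ^+ 2 by rewrite ler_wpM2r ?sqr_ge0.
  have s0 : 0 <= (k (1 - t) * g u - k t * g v) ^+ 2 by exact: sqr_ge0.
  have z1 : 0 <= B ^+ 2 * g u ^+ 2 by rewrite mulr_ge0 ?sqr_ge0.
  have z2 : 0 <= B ^+ 2 * g v ^+ 2 by rewrite mulr_ge0 ?sqr_ge0.
  have -> : (k (1 - t) * g u + k t * g v) ^+ 2 = 2 * (k (1 - t) ^+ 2 * g u ^+ 2) +
     2 * (k t ^+ 2 * g v ^+ 2) - (k (1 - t) * g u - k t * g v) ^+ 2 by ring.
  by rewrite !exprMn; lra.
- have := summ2D (summ2_sqr_l hX sg') (summ2_sqr_r hX sg').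
  rewrite (_ : (fun i j => _) = (fun x y => wt x y * Q x y))//.
  by apply/funext => u; apply/funext => v; rewrite /Q mulrDr.
- by move=> u v t _; rewrite /interp subKr addrC.
- move=> u v t uv t01; rewrite -(e u v t uv t01) edge_avg_interp ?rI// edge_avg_interp//.
  by rewrite subKr.
Qed.

End Interpolation.

Lemma continuous_sinM {R : realType} (c : R) : continuous (fun t : R => sin (c * t)).
Proof.
move=> t; apply: (@continuous_comp _ _ _ (fun t : R => c * t) sin).
  by apply: cvgMr; exact: cvg_id.
exact: continuous_sin.
Qed.

Lemma continuous_cosM {R : realType} (c : R) : continuous (fun t : R => cos (c * t)).
Proof.
move=> t; apply: (@continuous_comp _ _ _ (fun t : R => c * t) cos).
  by apply: cvgMr; exact: cvg_id.
exact: continuous_cos.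
Qed.

Section Flow.
Context {R : realType} (X : wgraph R).
Hypothesis hX : is_network X.

(** The eigenfunction is [psi x y sin (2 pi t)].  Reversing an edge changes both
    signs, and the average over the pieces of length [t] of the edges at [x] is a
    multiple of the divergence of [c psi] at [x]. *)
Lemma specpA_flow (psi : X -> X -> R) x y :
  (forall x y, adj x y -> psi y x = - psi x y) ->
  summ2 (fun x y => wt x y * psi x y ^+ 2) ->
  (forall x, summ (fun y => wt x y * psi x y)) ->
  (forall x, tsum (fun y => wt x y * psi x y) = 0) ->
  adj x y -> psi x y != 0 -> specpA X 0.
Proof.
move=> anti en sp div0 xy nz.
pose f (x y : X) (t : R) := psi x y * sin (2 * pi * t).
have spi (t : R) : sin (2 * pi * (1 - t)) = - sin (2 * pi * t).
  have -> : 2 * pi * (1 - t) = - (2 * pi * t) + pi *+ 2 by rewrite -mulr_natr; ring.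
  by rewrite sinD2pi sinN.
rewrite (_ : 0 = ((0 : R)%:C)%C)//.
have q : 0 <= (4^-1 : R) <= 1 by apply/andP; split; lra.
apply: (@specpA_edge_fun _ X hX f (fun x y => psi x y ^+ 2) _ _ en _ _ 0 x y 4^-1 xy q).
- by move=> u v t; apply: cvgMr; exact: continuous_sinM.
- move=> u v t _ _; rewrite /f exprMn ler_piMr ?sqr_ge0//.
- by move=> u v t uv; rewrite /f spi (anti _ _ uv) mulrNN.
- by move=> u v z _ _; rewrite /f mulr0 sin0 !mulr0.
- rewrite /f (_ : 2 * pi * 4^-1 = pi / 2) ?sin_pihalf ?mulr1//.
  by field.
have h0 t u : edge_avg f t u = 0.
  rewrite /edge_avg (@eq_tsum _ _ _ (fun v => Rintegral lebesgue_measure `[0, clamp t]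
     (fun t => sin (2 * pi * t)) * (wt u v * psi u v))).
    by rewrite (tsumZ _ (sp u)) div0 !mulr0.
  move=> v; rewrite mulrCA; congr (_ * _); rewrite /f RintegralZl//; first exact: mulrC.
  by apply: (continuous_integrable 0 (clamp t)); exact: continuous_sinM.
by move=> u v t _ _; rewrite !h0 addr0 mul0r.
Qed.

End Flow.

(** * From eigenvectors on vertices to eigenfunctions on edges *)

Section Backward.
Context {R : realType} (X : wgraph R).
Hypothesis hX : is_network X.

(** [P] has real coefficients, so the real and the imaginary part of an
    eigenvector for a real eigenvalue are eigenvectors or zero. *)
Lemma specpP_real_inv (p : R) : specpP X ((p%:C)%C) ->
  exists u : X -> R, [/\ l2 u, exists x, u x != 0 & forall x, opP u x = p * u x].
Proof.
move=> [g [/(l2X0_parts hX)[s1 s2] [x gx] Pg]].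
have e1 z : opP (fun y => complex.Re (g y)) z = p * complex.Re (g z).
  by rewrite -Re_transP Pg ReM /= mul0r subr0.
have e2 z : opP (fun y => complex.Im (g y)) z = p * complex.Im (g z).
  by rewrite -Im_transP Pg ImM /= mul0r addr0.
have [r0|r0] := eqVneq (complex.Re (g x)) 0; last first.
  by exists (fun y => complex.Re (g y)); split=> //; exists x.
exists (fun y => complex.Im (g y)); split=> //; exists x.
by apply: contra gx => /eqP i0; apply/eqP; apply: complexP.
Qed.

Lemma specpA_one : specpP X 1 -> specpA X 1.
Proof.
rewrite (_ : 1 = ((1 : R)%:C)%C)// => /specpP_real_inv[g [sg [x gx] Pg]].
have [y xy] := exists_nbr hX x.
pose k := fun t : R => t; pose kap := fun t : R => t ^+ 2 / 2.
have dk : hasD kap k.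
  rewrite (_ : kap = fun t : R => 2^-1 * (t * t)); last first.
    by apply/funext => t; rewrite /kap expr2 mulrC.
  by move=> t _; apply: is_derive_eq; rewrite /k /GRing.scale/=; field.
have I0 : 0 <= (0 : R) <= 1 by rewrite lexx ler01.
apply: (@specpA_interp _ X hX g 1 1 k kap sg Pg _ dk _ _ 1 0 x y _ _ xy I0).
- by move=> t; exact: cvg_id.
- by rewrite /kap expr0n mul0r.
- by move=> t /andP[t0 t1]; rewrite /k ger0_norm.
- by move=> u v z _ _; rewrite /interp /k !mul0r !addr0.
- by move=> u v t _ _; rewrite /kap /interp /k; field.
- by rewrite /interp /k mul0r addr0 subr0 mul1r.
Qed.

Lemma specpA_sinc (w : R) : w != 0 -> sin w != 0 -> specpP X ((cos w)%:C)%C ->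
  specpA X ((sin w / w)%:C)%C.
Proof.
move=> w0 s0 /specpP_real_inv[g [sg [x gx] Pg]].
have [y xy] := exists_nbr hX x.
pose k := fun t : R => sin (w * t); pose kap := fun t : R => (1 - cos (w * t)) / w.
have dk : hasD kap k.
  move=> t _; have d : is_derive t 1 (fun t : R => cos (w * t)) (- w * sin (w * t)).
    by apply: is_derive_eq; rewrite /GRing.scale/=; ring.
  by rewrite /kap /k; apply: is_derive_eq; rewrite /GRing.scale/=; field.
have I0 : 0 <= (0 : R) <= 1 by rewrite lexx ler01.
have key (t : R) : kap 1 - kap (1 - t) + cos w * kap t = sin w / w * k t.
  by rewrite /kap /k mulr1 mulrBr mulr1 cosB; field.
have rI (t : R) : 0 <= t <= 1 -> 0 <= 1 - t <= 1.
  by move=> /andP[? ?]; apply/andP; split; lra.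
apply: (@specpA_interp _ X hX g (cos w) 1 k kap sg Pg _ dk _ _ (sin w / w) 0 x y _ _ xy I0).
- exact: continuous_sinM.
- by rewrite /kap mulr0 cos0 subrr mul0r.
- by move=> t _; rewrite /k ler_norml sin_geN1 sin_le1.
- by move=> u v z _ _; rewrite /interp /k !mulr0 sin0 !mul0r !addr0.
- move=> u v t _ _; rewrite key -{1}(subKr 1 t) key /interp; ring.
- by rewrite /interp /k mulr0 sin0 mul0r addr0 subr0 mulr1 mulf_neq0.
Qed.

(** Constants lie in [l^2], and a full period of the cosine along every edge has
    zero mean against them: the primitive [sin (2 pi t)] is odd about [t = 1/2],
    so the contributions of the two ends of an edge cancel. *)
Lemma specpA_zero_finite : (\esum_(x in [set: X]) m0 x != +oo)%E -> specpA X 0.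
Proof.
move=> fin; pose g := fun _ : X => 1 : R.
have sg : l2 g.
  apply/summ_ge0P; first exact: mass_sqr_ge0.
  rewrite (eq_esum (b := fun x => m0 x)) ?ltey//.
  by move=> x _; rewrite m0E// /g expr1n mulr1.
have Pg x : opP g x = 1 * g x.
  rewrite /opP /g mulr1 (@eq_tsum _ _ _ (wt x)) => [|y]; last by rewrite mulr1.
  by rewrite tsum_wt// mulVf// gt_eqF ?mass_gt0.
have [x [y xy]] := adj_edge hX.
pose k := fun t : R => cos (2 * pi * t) / 2.
pose kap := fun t : R => sin (2 * pi * t) / (4 * pi).
have pi0 : (pi : R) != 0 by rewrite gt_eqF ?pi_gt0.
have ds : hasD (fun t : R => sin (2 * pi * t)) (fun t => 2 * pi * cos (2 * pi * t)).
  by move=> t _; apply: is_derive_eq; rewrite /GRing.scale/=; ring.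
have dk : hasD kap k.
  rewrite (_ : kap = fun t : R => (4 * pi)^-1 * sin (2 * pi * t)); last first.
    by apply/funext => t; rewrite /kap mulrC.
  have F (P c : R) : P != 0 -> (4 * P)^-1 * (2 * P * c) = c / 2 by move=> ?; field.
  by apply: hasD_ext (hasDZ _ ds) _ => t _; exact: F.
have I0 : 0 <= (0 : R) <= 1 by rewrite lexx ler01.
have E (t : R) : 2 * pi * (1 - t) = - (2 * pi * t) + pi *+ 2.
  by rewrite -mulr_natr; ring.
have krev (t : R) : k (1 - t) = k t by rewrite /k E cosD2pi cosN.
have kaprev (t : R) : kap (1 - t) = - kap t by rewrite /kap E sinD2pi sinN mulNr.
have kap0 : kap 0 = 0 by rewrite /kap mulr0 sin0 mul0r.
have kap1 : kap 1 = 0 by rewrite -[1]subr0 kaprev kap0 oppr0.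
rewrite (_ : 0 = ((0 : R)%:C)%C)//.
apply: (@specpA_interp _ X hX g 1 1 k kap sg Pg _ dk kap0 _ 0 0 x y _ _ xy I0).
- by move=> t; apply: cvgMl; exact: continuous_cosM.
- move=> t _; have : `|cos (2 * pi * t)| <= 1 by rewrite ler_norml cos_geN1 cos_le1.
  by rewrite /k normrM (ger0_norm (x := 2^-1)) ?invr_ge0//; lra.
- by move=> u v z _ _; rewrite /interp.
- by move=> u v t _ _; rewrite kap1 kaprev /g; ring.
- rewrite /interp /k /g !mulr1 subr0 mulr0 cos0 mulr1 -[2 * pi]addr0.
  by rewrite (_ : 2 * pi + 0 = 0 + pi *+ 2) ?cosD2pi ?cos0; [lra|rewrite -mulr_natr; ring].
Qed.

End Backward.

(** * Flows of finite energy and transience *)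

Section FlowDef.
Context {R : realType} (X : wgraph R).
Hypothesis hX : is_network X.

(** For the gradient flow [J x y = c(xy) (g x - g y)] of a potential the energy is
    the Dirichlet form of [g]. *)
Record flow (J : X -> X -> R) (d : X -> R) : Prop := Flow {
  flow_anti : forall x y, J y x = - J x y;
  flow_supp : forall x y, ~~ adj x y -> J x y = 0;
  flow_energy : summ2 (fun x y => J x y ^+ 2 / wt x y);
  flow_div : forall x, tsum (J x) = d x }.

Lemma flow_quot J d x y : flow J d -> wt x y * (J x y / wt x y) = J x y.
Proof.
move=> fJ; have [xy|nxy] := boolP (adj x y).
  by rewrite mulrC divfK// gt_eqF ?wt_gt0.
by rewrite (flow_supp fJ nxy) mul0r mulr0.
Qed.

Lemma flow_quot_sqr J d x y : flow J d ->
  wt x y * (J x y / wt x y) ^+ 2 = J x y ^+ 2 / wt x y.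
Proof.
move=> fJ; rewrite expr2 mulrA (flow_quot x y fJ); ring.
Qed.

Lemma flow_quot_energy J d : flow J d ->
  summ2 (fun x y => wt x y * (J x y / wt x y) ^+ 2).
Proof.
move=> fJ; have := flow_energy fJ; congr summ2.
by apply/funext => x; apply/funext => y; rewrite (flow_quot_sqr _ _ fJ).
Qed.

Lemma summ_flow J d x : flow J d -> summ (J x).
Proof.
move=> fJ; rewrite (_ : J x = fun y => wt x y * (J x y / wt x y)); last first.
  by apply/funext => y; rewrite (flow_quot _ _ fJ).
apply: jensen_summ; [exact: wt_ge0|exact: summ_wt|].
exact: (summ2_row (flow_quot_energy fJ)).
Qed.

Lemma flowD J d J' d' : flow J d -> flow J' d' ->
  flow (fun x y => J x y + J' x y) (fun x => d x + d' x).
Proof.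
move=> fJ fJ'; split.
- by move=> x y; rewrite (flow_anti fJ) (flow_anti fJ') opprD.
- by move=> x y h; rewrite (flow_supp fJ h) (flow_supp fJ' h) addr0.
- have s := summ2D (flow_energy fJ) (flow_energy fJ').
  apply: summ2_le (summ2D s s) => x y; set a := J x y; set b := J' x y.
  have w0 : 0 <= (wt x y)^-1 by rewrite invr_ge0 wt_ge0.
  rewrite (ger0_norm (mulr_ge0 (sqr_ge0 _) w0)).
  have -> : a ^+ 2 / wt x y + b ^+ 2 / wt x y + (a ^+ 2 / wt x y + b ^+ 2 / wt x y) =
    ((a + b) ^+ 2 + (a - b) ^+ 2) / wt x y by ring.
  by rewrite ler_wpM2r// lerDl sqr_ge0.
- by move=> x; rewrite (tsumD (summ_flow x fJ) (summ_flow x fJ')) (flow_div fJ) (flow_div fJ').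
Qed.

Lemma flowZ c J d : flow J d -> flow (fun x y => c * J x y) (fun x => c * d x).
Proof.
move=> fJ; split.
- by move=> x y; rewrite (flow_anti fJ) mulrN.
- by move=> x y h; rewrite (flow_supp fJ h) mulr0.
- have := summ2Z (c ^+ 2) (flow_energy fJ).
  have -> // : (fun x y => c ^+ 2 * (J x y ^+ 2 / wt x y)) =
    (fun x y => (c * J x y) ^+ 2 / wt x y).
  by apply/funext => x; apply/funext => y; rewrite exprMn mulrA.
- by move=> x; rewrite (tsumZ _ (summ_flow x fJ)) (flow_div fJ).
Qed.

End FlowDef.

Lemma esum_fatou {R : realType} {T : choiceType} (D : set T) (u : nat -> T -> R)
    (v : T -> R) (E : R) :
  (forall n i, 0 <= u n i) ->
  (forall n, (\esum_(i in D) (u n i)%:E <= E%:E)%E) ->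
  (forall i, u n i @[n --> \oo] --> v i) ->
  (\esum_(i in D) (v i)%:E <= E%:E)%E.
Proof.
move=> u0 uE uv; apply: ge_ereal_sup => _ [A [fA AD] <-].
rewrite fsbig_finite//= sumEFin lee_fin.
have c : \sum_(i <- finmap.enum_fset (fset_set A)) u n i @[n --> \oo] -->
    \sum_(i <- finmap.enum_fset (fset_set A)) v i.
  elim: (finmap.enum_fset _) => [|i s IH].
    by under eq_fun do rewrite big_nil; rewrite big_nil; exact: cvg_cst.
  by under eq_fun do rewrite big_cons; rewrite big_cons; apply: cvgD; [exact: uv|].
apply: (cvgr_to_le c); apply: nearW => n.
rewrite -lee_fin; apply: le_trans (uE n); apply: ereal_sup_ubound.
by exists A => //; rewrite fsbig_finite//= sumEFin.
Qed.

Section Green.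
Context {R : realType} (X : wgraph R).
Hypothesis hX : is_network X.
Implicit Types (x y z : X).

Definition vtx_ind x : X -> R := fun y => (y == x)%:R.

Definition walk x n : X -> R := iter n (@opP R X) (vtx_ind x).

Lemma l2_vtx_ind x : l2 (vtx_ind x).
Proof.
by apply: (summ_set1 (i0 := x)) => y /negbTE yx; rewrite /vtx_ind yx expr0n mulr0.
Qed.

Lemma l2_walk x n : l2 (walk x n).
Proof. by elim: n => [|n IH]; [exact: l2_vtx_ind|exact: l2P]. Qed.

Lemma opP_ge0 (g : X -> R) x : (forall y, 0 <= g y) -> 0 <= opP g x.
Proof.
move=> g0; rewrite mulr_ge0 ?invr_ge0 ?mass_ge0// tsum_ge0// => y.
by rewrite mulr_ge0 ?wt_ge0.
Qed.

Lemma walk_ge0 x n y : 0 <= walk x n y.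
Proof.
elim: n y => [|n IH] y; first by rewrite /walk /vtx_ind /= ler0n.
exact: opP_ge0.
Qed.

Lemma ip_vtx_ind (g : X -> R) x : ip g (vtx_ind x) = mass x * g x.
Proof.
rewrite /ip (tsum_set1 (i0 := x)).
  by rewrite /vtx_ind eqxx mulr1.
by move=> y /negbTE yx; rewrite /vtx_ind yx !mulr0.
Qed.

Lemma ip_walk x y n : ip (walk x n) (vtx_ind y) = ip (vtx_ind x) (walk y n).
Proof.
have P g h : l2 g -> l2 h -> ip (iter n (@opP R X) g) h = ip g (iter n (@opP R X) h).
  elim: n g h => //= n IH g h sg sh.
  have sn k u : l2 u -> l2 (iter k (@opP R X) u).
    by move=> su; elim: k => //= k; exact: l2P.
  by rewrite (opP_sym hX (sn n _ sg) sh) (IH _ _ sg (l2P hX sh)) -iterSr.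
by apply: P; exact: l2_vtx_ind.
Qed.

(** Reversibility of the random walk. *)
Lemma walk_sym x y n : mass y * walk x n y = mass x * walk y n x.
Proof. by rewrite -ip_vtx_ind ip_walk ipC ip_vtx_ind. Qed.

Lemma transP_walk x n y :
  iter n (@transP R X) (@delta R X x) y = ((walk x n y)%:C)%C.
Proof.
elim: n y => [|n IH] y; first by rewrite /= /delta /vtx_ind; case: (y == x).
rewrite /= (_ : iter n _ _ = fun z => ((walk x n z)%:C)%C); last exact/funext.
apply: complexP; first by rewrite Re_transP.
rewrite Im_transP /opP (@eq_tsum _ _ _ (fun=> 0)) ?tsum0 ?mulr0// => z.
by rewrite mulr0.
Qed.

Lemma Re_ip_walk x y n :
  complex.Re (ipX0 (iter n (@transP R X) (@delta R X x)) (@delta R X y)) =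
  mass y * walk x n y.
Proof.
rewrite /ipX0 /csum /= -ip_vtx_ind /ip unlock; congr rsum; apply/funext => z.
rewrite transP_walk /delta /vtx_ind; case: (z == y) => /=.
  by rewrite !(mulr0, mulr1, mul0r, addr0, subr0, oppr0, mul1r) mulrC.
by rewrite !(mulr0, mulr1, mul0r, addr0, subr0, oppr0, mul1r).
Qed.

Definition psumw x N y : R := \sum_(0 <= n < N) walk x n y.

Definition finite_at x y := exists M, forall N, psumw x N y <= M.

Lemma transient_finite : @transient R X -> exists x y, finite_at x y.
Proof.
move=> [x [y h]]; exists x, y.
have t0 n : (0 <= (complex.Re (ipX0 (iter n (@transP R X) (@delta R X x)) (@delta R X y)))%:E)%E.
  by rewrite lee_fin Re_ip_walk mulr_ge0 ?mass_ge0 ?walk_ge0.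
have m0 := mass_gt0 hX y.
move: h; set T := (X in (X < _)%E) => h.
have fT : T \is a fin_num.
  by rewrite fin_numElt h andbT (lt_le_trans (ltNyr 0))// nneseries_ge0.
exists ((mass y)^-1 * fine T) => N; rewrite mulrC ler_pdivlMr// mulrC.
rewrite -lee_fin fineK// /psumw big_distrr/= -sumEFin.
rewrite (eq_bigr (fun n => (complex.Re (ipX0 (iter n (@transP R X) (@delta R X x)) (@delta R X y)))%:E)); last first.
  by move=> n _; rewrite Re_ip_walk.
by rewrite /T; apply: nneseries_lim_ge => n _ _; exact: t0.
Qed.

(** Harnack's inequality for neighbours: the average at [y] is at least its term
    at [z]. *)
Lemma opP_ge_nbr (g : X -> R) y z : l2 g -> (forall y, 0 <= g y) ->
  wt y z * g z <= mass y * opP g y.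
Proof.
move=> sg g0; rewrite /opP mulVKf ?gt_eqF ?mass_gt0//.
apply: (@le_tsum_term _ _ (fun z => wt y z * g z) z); last exact: summ_row.
by move=> u; rewrite mulr_ge0 ?wt_ge0.
Qed.

Lemma finite_at_nbr x y z : adj y z -> finite_at x y -> finite_at x z.
Proof.
move=> yz [M hM]; have w0 := wt_gt0 hX yz.
exists ((wt y z)^-1 * (mass y * M)) => N.
rewrite mulrC ler_pdivlMr// mulrC.
apply: (@le_trans _ _ (mass y * psumw x N.+1 y)); last first.
  by rewrite ler_wpM2l ?mass_ge0.
rewrite /psumw big_nat_recl//= !mulrDr; apply: ler_wpDl.
  by rewrite mulr_ge0 ?mass_ge0 ?walk_ge0.
rewrite !big_distrr/=; apply: ler_sum => n _.
by apply: opP_ge_nbr; [exact: l2_walk|move=> u; exact: walk_ge0].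
Qed.

Lemma finite_at_all x y z : finite_at x y -> finite_at x z.
Proof.
have [p] := adj_connected hX y z; elim: p y => [|u p IH] y /=; first by move=> _ ->.
by move=> /andP[yu pu] lz fy; apply: (IH u) => //; exact: finite_at_nbr fy.
Qed.

Lemma finite_at_sym x y : finite_at x y -> finite_at y x.
Proof.
move=> [M hM]; exists ((mass x)^-1 * (mass y * M)) => N.
have m0 := mass_gt0 hX x.
rewrite mulrC ler_pdivlMr// mulrC (_ : mass x * _ = mass y * psumw x N y).
  by rewrite ler_wpM2l ?mass_ge0.
by rewrite /psumw !big_distrr/=; apply: eq_bigr => n _; rewrite walk_sym.
Qed.

(** Finiteness spreads along edges by Harnack's inequality and is symmetric by
    reversibility, so one pair of vertices decides for all. *)
Lemma transient_finite_all : @transient R X -> forall x y, finite_at x y.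
Proof.
move=> /transient_finite[a [b ab]] x y.
by apply: (finite_at_all (y := a)); apply: finite_at_sym; exact: finite_at_all ab.
Qed.

Section Potential.
Variable o : X.
Hypothesis hfin : forall y, finite_at o y.

Let S := psumw o.

Lemma psumw_ge0 N y : 0 <= S N y.
Proof. by apply: sumr_ge0 => n _; exact: walk_ge0. Qed.

Lemma l2_psumw N : l2 (S N).
Proof.
elim: N => [|N IH].
  rewrite (_ : S 0 = fun=> 0); first exact: l20.
  by apply/funext => y; rewrite /S /psumw big_nil.
rewrite (_ : S N.+1 = fun y => S N y + walk o N y); last first.
  by apply/funext => y; rewrite /S /psumw big_nat_recr.
by apply: (l2D hX) => //; exact: l2_walk.
Qed.

(** Telescoping: [P] shifts the sum of the first powers by one step. *)
Lemma opP_psumw N y : opP (S N) y = S N.+1 y - vtx_ind o y.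
Proof.
elim: N y => [|N IH] y.
  rewrite /S /psumw big_nat1 /walk /= subrr /opP.
  rewrite (@eq_tsum _ _ _ (fun=> 0)) ?tsum0 ?mulr0// => z.
  by rewrite big_nil mulr0.
rewrite (_ : S N.+1 = fun y => S N y + walk o N y); last first.
  by apply/funext => z; rewrite /S /psumw big_nat_recr.
rewrite (opPD hX _ (l2_psumw N) (l2_walk o N)) IH.
rewrite [in RHS]/S /psumw big_nat_recr//= -/(S N.+1 y).
by rewrite -/(psumw o N.+1 y) -/(S N.+1 y) addrAC.
Qed.

Definition green y : R := limn (S ^~ y).

Lemma psumw_ndecr y : nondecreasing_seq (S ^~ y).
Proof.
apply/nondecreasing_seqP => N.
by rewrite /S /psumw big_nat_recr//= lerDl walk_ge0.
Qed.

Lemma cvg_psumw y : S N y @[N --> \oo] --> green y.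
Proof.
have [M hM] := hfin y; apply: nondecreasing_is_cvgn; first exact: psumw_ndecr.
by exists M => _ [N _ <-]; exact: hM.
Qed.

Lemma psumw_le N y : S N y <= green y.
Proof.
by apply: nondecreasing_cvgn_le; [exact: psumw_ndecr|apply: cvgP; exact: cvg_psumw].
Qed.

Lemma green_ge0 y : 0 <= green y.
Proof. exact: le_trans (psumw_ge0 0 y) (psumw_le 0 y). Qed.

Lemma summ_green x : summ (fun y => wt x y * green y).
Proof.
have g0 y : 0 <= wt x y * green y by rewrite mulr_ge0 ?wt_ge0 ?green_ge0.
apply: (summP (M := mass x * green x) g0 _).1.
apply: (esum_fatou (u := fun N y => wt x y * S N y)).
- by move=> N y; rewrite mulr_ge0 ?wt_ge0 ?psumw_ge0.
- move=> N; rewrite esum_summ; [|by move=> y; rewrite mulr_ge0 ?wt_ge0 ?psumw_ge0|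
    exact: (summ_row hX x (l2_psumw N))].
  rewrite lee_fin (_ : tsum _ = mass x * opP (S N) x); last first.
    by rewrite /opP mulVKf// gt_eqF ?mass_gt0.
  rewrite ler_wpM2l ?mass_ge0// opP_psumw; apply: le_trans (psumw_le N.+1 x).
  by rewrite gerBl /vtx_ind ler0n.
- by move=> y; apply: cvgMr; exact: cvg_psumw.
Qed.

Lemma green_eq x : mass x * green x - tsum (fun y => wt x y * green y) = mass x * vtx_ind o x.
Proof.
have c1 : tsum (fun y => wt x y * S N y) @[N --> \oo] --> tsum (fun y => wt x y * green y).
  apply: (@tsum_cvg R X nat \oo _ _ _ _ (summ_green x)).
    apply: nearW => N y; rewrite normrM (ger0_norm (wt_ge0 hX x y)) ler_wpM2l ?wt_ge0//.
    by rewrite ger0_norm ?psumw_ge0 ?psumw_le.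
  by move=> y; apply: cvgMr; exact: cvg_psumw.
have c2 : mass x * (S N.+1 x - vtx_ind o x) @[N --> \oo] --> mass x * (green x - vtx_ind o x).
  apply: cvgMr; apply: cvgB; last exact: cvg_cst.
  have := @cvg_psumw x; rewrite -(cvg_shiftn 1)/=.
  by under eq_fun do rewrite addn1.
have E N : mass x * (S N.+1 x - vtx_ind o x) = tsum (fun y => wt x y * S N y).
  by rewrite -opP_psumw /opP mulVKf// gt_eqF ?mass_gt0.
have c3 : mass x * (S N.+1 x - vtx_ind o x) @[N --> \oo] --> tsum (fun y => wt x y * green y).
  by under eq_fun do rewrite E.
by rewrite -(cvg_unique _ c2 c3)//; ring.
Qed.

Lemma dirichlet_form (u : X -> R) : l2 u ->
  summ2 (fun x y => wt x y * (u x - u y) ^+ 2) /\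
  tsum (fun x => tsum (fun y => wt x y * (u x - u y) ^+ 2)) =
  2 * (ip u u - ip (opP u) u).
Proof.
move=> su.
have sl := summ2_sqr_l hX su; have sr := summ2_sqr_r hX su; have sm := summ2_mixed hX su su.
have s : summ2 (fun x y => wt x y * u x ^+ 2 + wt x y * u y ^+ 2 + (-2) * (wt x y * (u y * u x))).
  by apply: summ2D; [exact: summ2D|exact: summ2Z].
have E x y : wt x y * (u x - u y) ^+ 2 =
    wt x y * u x ^+ 2 + wt x y * u y ^+ 2 + (-2) * (wt x y * (u y * u x)) by ring.
split.
  by move: s; congr summ2; apply/funext => x; apply/funext => y; rewrite E.
rewrite (@eq_tsum _ _ _ (fun x => tsum (fun y => wt x y * u x ^+ 2) +
   tsum (fun y => wt x y * u y ^+ 2) + (-2) * tsum (fun y => wt x y * (u y * u x)))); last first.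
  move=> x; rewrite -(tsumZ _ (summ2_row sm x)) -(tsumD (summ2_row sl x) (summ2_row sr x)).
  rewrite -(tsumD (summD (summ2_row sl x) (summ2_row sr x)) (summZ _ (summ2_row sm x))).
  by apply: eq_tsum => y; exact: E.
have tl := summ2_tsum sl; have tr := summ2_tsum sr; have tm := summ2_tsum sm.
rewrite (tsumD (summD tl tr) (summZ _ tm)) (tsumD tl tr) (tsumZ _ tm).
rewrite (tsum_sqr_r hX su) -(ip_opP hX su su).
rewrite (_ : tsum (fun x => tsum _) = ip u u); first by ring.
apply: eq_tsum => x; rewrite (@eq_tsum _ _ _ (fun y => u x ^+ 2 * wt x y)).
  by rewrite (tsumZ _ (summ_wt hX x)) tsum_wt// expr2 mulrC.
by move=> y; rewrite mulrC.
Qed.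

(** The partial sum [S] satisfies [(1 - P) S = vtx_ind o - P^N (vtx_ind o)], and
    the second term contributes with the right sign; the bound is uniform in [N]. *)
Lemma psumw_energy N :
  tsum (fun x => tsum (fun y => wt x y * (S N x - S N y) ^+ 2)) <= 2 * (mass o * green o).
Proof.
have sS := l2_psumw N; have sP := l2P hX sS.
rewrite (dirichlet_form sS).2 ler_wpM2l// -(ipBl hX sS sP sS).
have E : (fun x => S N x - opP (S N) x) = (fun x => vtx_ind o x - walk o N x).
  by apply/funext => x; rewrite opP_psumw /S /psumw [in X in _ - (X - _)]big_nat_recr//=; ring.
rewrite E (ipBl hX (l2_vtx_ind o) (l2_walk o N) sS) (ipC (vtx_ind o)) ip_vtx_ind.
apply: (@le_trans _ _ (mass o * S N o)).
  rewrite gerBl; apply: tsum_ge0 => x; rewrite mulr_ge0 ?mass_ge0//.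
  by rewrite mulr_ge0 ?walk_ge0 ?psumw_ge0.
by rewrite ler_wpM2l ?mass_ge0// psumw_le.
Qed.

Lemma green_energy : summ2 (fun x y => wt x y * (green x - green y) ^+ 2).
Proof.
have w0 (u : X -> R) x y : 0 <= wt x y * (u x - u y) ^+ 2.
  by rewrite mulr_ge0 ?wt_ge0 ?sqr_ge0.
rewrite /summ2; under eq_esum do under eq_esum do rewrite (ger0_norm (w0 green _ _)).
apply: (@le_lt_trans _ _ (2 * (mass o * green o))%:E); last exact: ltry.
rewrite esum_esum; last by move=> x y _ _; rewrite lee_fin w0.
apply: (esum_fatou (u := fun N k => wt k.1 k.2 * (S N k.1 - S N k.2) ^+ 2)).
- by move=> N k; exact: w0.
- move=> N; rewrite -(@esum_esum _ _ _ [set: X] (fun=> [set: X])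
    (fun x y => (wt x y * (S N x - S N y) ^+ 2)%:E)); last first.
    by move=> x y _ _; rewrite lee_fin w0.
  have [s2 _] := dirichlet_form (l2_psumw N).
  under eq_esum => x _ do rewrite (esum_summ (w0 (S N) x) (summ2_row s2 x)).
  rewrite esum_summ; [|by move=> x; apply: tsum_ge0 => y; exact: w0|exact: summ2_tsum s2].
  by rewrite lee_fin psumw_energy.
- move=> k; apply: cvgMr.
  have c : S N k.1 - S N k.2 @[N --> \oo] --> green k.1 - green k.2.
    by apply: cvgB; exact: cvg_psumw.
  by under eq_fun do rewrite expr2; rewrite expr2; exact: cvgM.
Qed.

Lemma flow_green : flow (fun x y => wt x y * (green x - green y)) (fun x => mass x * vtx_ind o x).
Proof.
split.
- by move=> x y; rewrite (wtC hX y x); ring.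
- by move=> x y nxy; rewrite /wt (negbTE nxy) mul0r.
- have := green_energy; congr summ2; apply/funext => x; apply/funext => y.
  have [xy|nxy] := boolP (adj x y); last by rewrite /wt (negbTE nxy) !mul0r expr0n mul0r.
  by field; rewrite gt_eqF ?wt_gt0.
move=> x; rewrite (@eq_tsum _ _ _ (fun y => green x * wt x y - wt x y * green y)).
  rewrite (tsumB (summZ _ (summ_wt hX x)) (summ_green x)) (tsumZ _ (summ_wt hX x)).
  by rewrite tsum_wt// mulrC green_eq.
by move=> y; ring.
Qed.

End Potential.

(** The gradient of the Green function with pole [o], normalized. *)
Lemma transient_flow o : @transient R X ->
  exists J, flow J (fun x => (x == o)%:R).
Proof.
move=> tr; have f := flow_green (o := o) (fun y => transient_finite_all tr o y).
eexists; have := flowZ hX (mass o)^-1 f; congr flow.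
apply/funext => x; rewrite /vtx_ind; case: eqP => [->|_]; last by rewrite !mulr0.
by rewrite mulr1 mulVf// gt_eqF ?mass_gt0.
Qed.

End Green.

(** * Source-free flows on networks *)

Section InjectiveSums.
Context {R : realType} {I K : choiceType} (h : K -> I).
Hypothesis h_inj : injective h.

Lemma esum_inj (g : I -> \bar R) : (forall i, ~ range h i -> g i = 0%E) ->
  (\esum_(i in [set: I]) g i = \esum_(k in [set: K]) g (h k))%E.
Proof.
move=> g0; rewrite -(@reindex_esum _ _ _ [set: K] (range h)); last first.
  by split=> [k _|k1 k2 _ _|i [k _ <-]]; [exists k|exact: h_inj|exists k].
rewrite [RHS]esum_mkcond; apply: eq_esum => i _.
by case: ifPn => // /negP nr; apply: g0 => ri; apply: nr; rewrite inE.
Qed.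

Lemma summ_inj (f : I -> R) : (forall i, ~ range h i -> f i = 0) ->
  summ f <-> summ (f \o h).
Proof. by move=> f0; rewrite /summ esum_inj// => i /f0 ->; rewrite normr0. Qed.

Lemma tsum_inj (f : I -> R) : (forall i, ~ range h i -> f i = 0) ->
  tsum f = tsum (f \o h).
Proof.
move=> f0; rewrite unlock /rsum !esum_inj// => i /f0 ->.
  by rewrite oppr0 maxxx.
by rewrite maxxx.
Qed.

End InjectiveSums.

Section Reachability.
Context {T : eqType} (e : rel T).

Lemma reach_refl x : reach e x x.
Proof. by exists [::]. Qed.

Lemma reach_trans x y z : reach e x y -> reach e y z -> reach e x z.
Proof.
move=> [p pp lp] [q pq lq]; exists (p ++ q); last by rewrite last_cat lp.
by rewrite cat_path pp lp.
Qed.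

Lemma reach_edge x y : e x y -> reach e x y.
Proof. by move=> xy; exists [:: y] => //=; rewrite xy. Qed.

Lemma reach_sym : symmetric e -> forall x y, reach e x y -> reach e y x.
Proof.
move=> es x _ [p + <-]; elim: p x => [|z p IH] x /=; first by move=> _; exact: reach_refl.
move=> /andP[xz /IH r]; apply: (reach_trans r).
by apply: reach_edge; rewrite es.
Qed.

End Reachability.

Section FiniteFlows.
Context {R : realType} (X : wgraph R).
Hypothesis hX : is_network X.
Implicit Types (x y z : X).

Lemma circulation_specpA (J : X -> X -> R) x y :
  flow J (fun=> 0) -> adj x y -> J x y != 0 -> specpA X 0.
Proof.
move=> fJ xy J0; have q u v := flow_quot hX u v fJ.
apply: (@specpA_flow _ _ hX (fun u v => J u v / wt u v) x y) => //.
- by move=> u v _; rewrite (flow_anti fJ) (wtC hX v u) mulNr.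
- exact: (flow_quot_energy hX fJ).
- move=> u; have := summ_flow hX u fJ; congr summ; apply/funext => v; exact/esym.
- by move=> u; rewrite (eq_tsum (q u)) (flow_div fJ).
- by rewrite mulf_neq0// invr_neq0// gt_eqF// wt_gt0.
Qed.

Lemma flow0 : flow (fun _ _ : X => 0) (fun=> 0 : R).
Proof.
split=> // [x y||x]; [by rewrite oppr0| |exact: tsum0].
rewrite (_ : (fun _ _ => _) = fun _ _ => 0).
  apply: summ2P => [x|]; first exact: summ0.
  by rewrite normr0 tsum0; exact: summ0.
by apply/funext => x; apply/funext => y; rewrite expr0n mul0r.
Qed.

Definition edge_flow a b x y : R :=
  ((x == a) && (y == b))%:R - ((x == b) && (y == a))%:R.

Lemma summ2_set a b (c : R) : summ2 (fun x y => c * ((x == a) && (y == b))%:R).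
Proof.
apply: summ2P => [x|].
  by apply: (summ_set1 (i0 := b)) => y /negbTE ->; rewrite andbF mulr0.
apply: (summ_set1 (i0 := a)) => x /negbTE xa.
rewrite (@eq_tsum _ _ _ (fun=> 0)) ?tsum0// => y.
by rewrite xa mulr0 normr0.
Qed.

Lemma flow_edge a b : adj a b ->
  flow (edge_flow a b) (fun x => (x == a)%:R - (x == b)%:R).
Proof.
move=> ab; have ba : adj b a by rewrite (adj_sym hX).
have nab : (a == b) = false.
  by apply/eqP => E; move: ab; rewrite E (adj_irrefl hX).
split.
- by move=> x y; rewrite /edge_flow opprB; congr (_%:R - _%:R); rewrite andbC.
- move=> x y nxy; rewrite /edge_flow.
  case: andP => [[/eqP xa /eqP yb]|_]; first by rewrite xa yb ab in nxy.
  case: andP => [[/eqP xb /eqP ya]|_]; first by rewrite xb ya ba in nxy.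
  by rewrite subr0.
- have := summ2D (summ2_set a b (wt a b)^-1) (summ2_set b a (wt b a)^-1).
  congr summ2; apply/funext => x; apply/funext => y; rewrite /edge_flow.
  case: (x =P a) => [->|_].
    rewrite nab; case: (y =P b) => [->|_] /=; last by rewrite subr0 expr0n /=; ring.
    by rewrite mulr0 addr0 subr0 expr1n mulr1 mul1r.
  case: (x =P b) => [->|_] /=; last by rewrite subr0 expr0n /=; ring.
  case: (y =P a) => [->|_] /=; last by rewrite subr0 expr0n /=; ring.
  by ring.
move=> x.
have h c d : summ (fun y => ((x == c) && (y == d))%:R : R).
  by apply: (summ_set1 (i0 := d)) => y /negbTE ->; rewrite andbF.
have t c d : tsum (fun y => ((x == c) && (y == d))%:R : R) = (x == c)%:R.
  rewrite (tsum_set1 (i0 := d)) ?eqxx ?andbT// => y /negbTE ->.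
  by rewrite andbF.
by rewrite (tsumB (h a b) (h b a)) !t.
Qed.

(** The sum of the unit flows along the edges of a path.  It lives on the edges of
    the relation in which the path was taken. *)
Lemma flow_path (e : rel X) a b : subrel e (@adj R X) -> symmetric e -> reach e a b ->
  exists2 J, flow J (fun x => (x == a)%:R - (x == b)%:R)
    & forall x y, ~~ e x y -> J x y = 0.
Proof.
move=> eX es [p + <-]; elim: p a => [|c p IH] a /=.
  move=> _; exists (fun _ _ => 0) => //.
  by have := flow0; congr flow; apply/funext => x; rewrite subrr.
move=> /andP[ac /IH[J fJ J0]]; exists (fun x y => edge_flow a c x y + J x y).
  have := flowD hX (flow_edge (eX _ _ ac)) fJ; congr flow.
  by apply/funext => x; rewrite addrA subrK.
move=> x y nxy; rewrite J0// addr0 /edge_flow.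
case: andP => [[/eqP xa /eqP yc]|_]; first by rewrite xa yc ac in nxy.
case: andP => [[/eqP xc /eqP ya]|_]; first by rewrite xc ya es ac in nxy.
by rewrite subr0.
Qed.

Lemma del_edgeE x y (u v : X) : @adj R (del_edge x y) u v =
  @adj R X u v && ~~ (((u == x) && (v == y)) || ((u == y) && (v == x))).
Proof. by []. Qed.

Lemma del_edge_sym x y : symmetric (@adj R (del_edge x y)).
Proof.
move=> u v; rewrite !del_edgeE (adj_sym hX u v) orbC.
by rewrite [(v == x) && _]andbC [(v == y) && _]andbC.
Qed.

Lemma del_edge_sub x y : subrel (@adj R (del_edge x y)) (@adj R X).
Proof. by move=> u v /andP[]. Qed.

Lemma del_edge_removed x y : ~~ @adj R (del_edge x y) x y.
Proof. by rewrite del_edgeE !eqxx andbF. Qed.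

(** Send one unit through the edge and back along a path that avoids it. *)
Lemma edge_on_cycle_specpA x y : adj x y -> reach (@adj R (del_edge x y)) x y ->
  specpA X 0.
Proof.
move=> xy r.
have [J fJ J0] := flow_path (@del_edge_sub x y) (@del_edge_sym x y) r.
have f := flowD hX (flow_edge xy) (flowZ hX (-1) fJ).
apply: (@circulation_specpA (fun u v => edge_flow x y u v + -1 * J u v) x y _ xy).
  by have := f; congr flow; apply/funext => z; ring.
rewrite (J0 _ _ (del_edge_removed x y)) mulr0 addr0 /edge_flow !eqxx.
have -> : (x == y) = false; last by rewrite /= subr0 oner_neq0.
by apply/eqP => E; move: xy; rewrite E (adj_irrefl hX).
Qed.

(** The edge from the last to the first vertex of a simple cycle of length at least
    three is not used by the rest of the cycle. *)
Lemma cycle_edge (p : seq X) : ucycle (@adj R X) p -> (3 <= size p)%N ->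
  exists x y, @adj R X x y /\ reach (@adj R (del_edge x y)) x y.
Proof.
case: p => [|a [|z s]]// /andP[]; rewrite /cycle rcons_path -/(path _ _ _).
move=> /andP[/andP[az pz] la] /andP[nas /andP[nzs _]] s0.
have lz : (z == last z s) = false.
  case: s nzs s0 {pz la nas} => // t s nzs _; apply/eqP => E.
  by move: (mem_last t s) nzs; rewrite -[last t s]/(last z (t :: s)) -E => ->.
exists a, (last z s); split; first by rewrite (adj_sym hX).
exists (z :: s) => //; apply/andP; split.
  rewrite del_edgeE az lz andbF /=; case: eqP => // E.
  by move: (mem_last z s) nas; rewrite -E => ->.
apply: (@sub_in_path _ (predC1 a) _ _ _ z s _ pz) => [u v|].
  by rewrite !inE => /negbTE ua /negbTE va uv; rewrite del_edgeE uv ua va andbF.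
by apply/allP => u us; rewrite inE; apply: contraNneq nas => <-.
Qed.

Lemma not_tree_specpA : ~ is_tree X -> specpA X 0.
Proof.
move=> nt; have [x [y [xy r]]] : exists x y, @adj R X x y /\ reach (@adj R (del_edge x y)) x y.
  apply: contrapT => nex; apply: nt; split; first exact: (adj_connected hX).
  move=> p cp; rewrite ltnNge; apply/negP => sp; apply: nex.
  exact: cycle_edge cp sp.
exact: edge_on_cycle_specpA xy r.
Qed.

End FiniteFlows.

Section Components.
Context {R : realType} (X : wgraph R).
Hypothesis hX : is_network X.
Variables (e : rel X) (r : X).
Hypotheses (eX : subrel e (@adj R X)) (es : symmetric e).

Let Y : wgraph R := component (r : WGraph e (@cond R X)).

Definition comp_root : Y := exist _ r (asboolT (reach_refl e r)).

Let component_val_inj : injective (val : Y -> X) := val_inj.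

Lemma component_reach (u : Y) : reach e r (val u).
Proof. by case: u => z /= /asboolP. Qed.

Lemma component_connected (u v : Y) : reach (@adj R Y) u v.
Proof.
have lift p (a : Y) : path e (val a) p -> forall b : Y, last (val a) p = val b ->
    reach (@adj R Y) a b.
  elim: p a => [|c p IH] a /=.
    by move=> _ b /val_inj ->; exact: reach_refl.
  move=> /andP[ac pc] b lb.
  have rc : reach e r c := reach_trans (component_reach a) (reach_edge ac).
  apply: (reach_trans (y := exist _ c (asboolT rc) : Y)); first exact: reach_edge.
  exact: IH.
have [p pp lp] := reach_trans (reach_sym es (component_reach u)) (component_reach v).
exact: lift pp _ lp.
Qed.

(** Paths in [e] from a vertex of the component stay in it, so they lift; with
    two vertices this also provides an edge.  Vertex masses only decrease. *)
Lemma component_network : ~ (forall u v : Y, u = v) -> is_network Y.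
Proof.
move=> ns; split.
- by move=> u v; exact: es.
- move=> u; apply/negP => /eX; by rewrite (adj_irrefl hX).
- exact: component_connected.
- apply: contrapT => ne; apply: ns => u v.
  have [[|w p] /= + lp] := component_connected u v; first by [].
  by move=> /andP[uw _]; exfalso; apply: ne; exists u, w.
- by move=> u v /eX; exact: (cond_sym hX).
- by move=> u v /eX; exact: (cond_gt0 hX).
- move=> u; apply: le_lt_trans (m0_fin hX (val u)).
  have c0 z : @nbr R X (val u) z -> (0 <= (cond (val u) z)%:E)%E.
    by move=> uz; rewrite lee_fin ltW// (cond_gt0 hX).
  rewrite /m0 [leRHS](esumID (val @` (@nbr R Y u)))//.
  have -> : @nbr R X (val u) `&` (val @` (@nbr R Y u)) = val @` (@nbr R Y u).
    by apply/seteqP; split => [z []//|_ [v uv <-]]; split; [exact: eX|exists v].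
  rewrite (@reindex_esum _ _ _ (@nbr R Y u) _ val); last first.
    by split => [v uv|v w _ _|_ [v uv <-]]; [exists v|exact: val_inj|exists v].
  by rewrite leeDl// esum_ge0// => z [+ _]; exact: c0.
Qed.

Definition extend (J : Y -> Y -> R) (x y : X) : R :=
  if insub x is Some u then if insub y is Some v then J u v else 0 else 0.

Lemma extend_val J (u v : Y) : extend J (val u) (val v) = J u v.
Proof. by rewrite /extend !valK. Qed.

Lemma extend_notin J x y : ~ range (val : Y -> X) x \/ ~ range (val : Y -> X) y ->
  extend J x y = 0.
Proof.
rewrite /extend; case: insubP => // u _ <-; case: insubP => // v _ <-.
by case; case; [exists u|exists v].
Qed.

Lemma component_wt (u v : Y) : e (val u) (val v) -> @wt R X (val u) (val v) = wt u v.
Proof. by move=> uv; rewrite (wt_adj (eX uv)) (@wt_adj R Y u v uv). Qed.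

Lemma flow_extend J : flow J (fun u : Y => (u == comp_root)%:R) ->
  flow (extend J) (fun x => (x == r)%:R) /\
  forall x y, ~~ e x y -> extend J x y = 0.
Proof.
move=> fJ.
have sup x y : ~~ e x y -> extend J x y = 0.
  have [[u _ <-]|nx] := pselect (range (val : Y -> X) x); last by rewrite extend_notin//; left.
  have [[v _ <-]|ny] := pselect (range (val : Y -> X) y); last by rewrite extend_notin//; right.
  by move=> nuv; rewrite extend_val (flow_supp fJ).
split=> //; split.
- move=> x y.
  have [[u _ <-]|nx] := pselect (range (val : Y -> X) x); last first.
    by rewrite !extend_notin ?oppr0//; [left|right].
  have [[v _ <-]|ny] := pselect (range (val : Y -> X) y); last first.
    by rewrite !extend_notin ?oppr0//; [right|left].
  by rewrite !extend_val (flow_anti fJ).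
- by move=> x y nxy; apply: sup; apply: contra nxy; exact: eX.
- have row (u : Y) : (fun y => extend J (val u) y ^+ 2 / @wt R X (val u) y) \o val =
      fun v => J u v ^+ 2 / wt u v.
    apply/funext => v /=; rewrite extend_val.
    have [uv|nuv] := boolP (e (val u) (val v)); first by rewrite component_wt.
    by rewrite (flow_supp fJ)// expr0n !mul0r.
  have out x y : ~ range (val : Y -> X) x \/ ~ range (val : Y -> X) y ->
      extend J x y ^+ 2 / wt x y = 0.
    by move=> /extend_notin ->; rewrite expr0n mul0r.
  apply: summ2P => [x|].
    have [[u _ <-]|nx] := pselect (range (val : Y -> X) x).
      apply/(summ_inj component_val_inj) => [y ny|]; first by rewrite out//; right.
      by rewrite row; exact: (summ2_row (flow_energy fJ)).
    have -> : (fun y => extend J x y ^+ 2 / wt x y) = fun=> 0; last exact: summ0.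
    by apply/funext => y; rewrite out//; left.
  apply/(summ_inj component_val_inj) => [x nx|].
    rewrite (@eq_tsum _ _ _ (fun=> 0)) => [|y]; first by rewrite tsum0.
    by rewrite out ?normr0//; left.
  have := summ2_abs (flow_energy fJ); congr summ; apply/funext => u /=.
  rewrite [RHS](tsum_inj component_val_inj) => [|y ny]; last first.
    by rewrite out ?normr0//; right.
  by apply: eq_tsum => v; rewrite -[in LHS](congr1 (fun f => f v) (row u)).
move=> x; have [[u _ <-]|nx] := pselect (range (val : Y -> X) x).
  rewrite (tsum_inj component_val_inj) => [|y ny]; last by rewrite extend_notin//; right.
  rewrite (@eq_tsum _ _ _ (J u)) => [|v]; last exact: extend_val.
  by rewrite (flow_div fJ) -val_eqE.
rewrite (@eq_tsum _ _ _ (fun=> 0)) => [|y]; last by rewrite extend_notin//; left.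
by rewrite tsum0; case: eqP => // xr; exfalso; apply: nx; exists comp_root.
Qed.

(** A component that is not recurrent has at least two vertices, hence is a
    network, and it is transient; its unit flow from the root to infinity becomes
    a flow on [X] along the edges of [e]. *)
Lemma nonrecurrent_flow : ~ recurrent Y ->
  exists2 J, flow J (fun x => (x == r)%:R) & forall x y, ~~ e x y -> J x y = 0.
Proof.
move=> nrec; have nY : is_network Y by apply: component_network => s; apply: nrec; left.
have tr : transient Y by apply: contrapT => ntr; apply: nrec; right.
have [J /flow_extend[fJ J0]] := transient_flow nY comp_root tr.
by exists (extend J).
Qed.

End Components.

(** One unit flows from infinity to [x] in the first component, through the edge
    to [y], and back to infinity in the second component. *)
Lemma not_edge_removal_specpA (R : realType) (X : wgraph R) : is_network X ->
  ~ edge_removal_recurrent X -> specpA X 0.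
Proof.
move=> hX nrec.
have [x [y [xy nx ny]]] : exists x y, [/\ @adj R X x y,
    ~ recurrent (component (x : del_edge x y)) & ~ recurrent (component (y : del_edge x y))].
  apply: contrapT => nex; apply: nrec => x y xy.
  apply: contrapT => /not_orP[nx ny]; apply: nex; by exists x, y.
have sub := @del_edge_sub _ X x y; have sym := @del_edge_sym _ _ hX x y.
have [Jx fx Jx0] := nonrecurrent_flow hX sub sym nx.
have [Jy fy Jy0] := nonrecurrent_flow hX sub sym ny.
have f := flowD hX (flowD hX (flow_edge hX xy) fy) (flowZ hX (-1) fx).
have rem := del_edge_removed x y.
apply: (@circulation_specpA _ _ hX
  (fun u v => edge_flow x y u v + Jy u v + -1 * Jx u v) x y _ xy).
  by have := f; congr flow; apply/funext => z; ring.
rewrite (Jx0 _ _ rem) (Jy0 _ _ rem) mulr0 !addr0 /edge_flow !eqxx.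
have -> : (x == y) = false; last by rewrite /= subr0 oner_neq0.
by apply/eqP => E; move: xy; rewrite E (adj_irrefl hX).
Qed.

(** * Point spectra *)

Local Open Scope complex_scope.

Theorem theorem1p5 (R : realType) (X : wgraph R) (hX : is_network X) :
  specpA X `\ 0 =
    ([set z | z = 1 /\ specpP X 1] `|`
     [set (sin w / w)%:C | w in [set w : R | w != 0 /\ specpP X (cos w)%:C]])
    `\ 0
  /\ (~ [/\ (\esum_(x in [set: X]) m0 x = +oo)%E, is_tree X
          & edge_removal_recurrent X] ->
      specpA X 0).
Proof.
split.
  apply/seteqP; split => lam [/=].
    move=> sA /eqP lam0; split; last exact/eqP.
    by case: (specpA_specpP hX sA lam0) => [h|[w w0 h]]; [left|right; exists w].
  move=> sP lam0; split=> //; case: sP => [[-> h]|[w [w0 h] E]].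
    exact: specpA_one.
  rewrite -E; apply: specpA_sinc => //.
  by apply: contra_not_neq lam0 => s0; rewrite -E s0 mul0r.
move=> nh; have [m|m] := pselect (\esum_(x in [set: X]) m0 x = +oo)%E; last first.
  by apply: specpA_zero_finite => //; apply/eqP.
have [tX|nt] := pselect (is_tree X); last exact: not_tree_specpA.
by apply: not_edge_removal_specpA => // rec; exact: nh.
Qed.
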